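(* Let $X$ be a Banach function space over $\mathbb R^n$. Assume that there exists $p_0>1$ such that, for all $p\ge p_0$, boundedness of the Hardy--Littlewood maximal operator $M$ on $(X')^{1/p}$ implies its boundedness on $\big[(X')^{1/p}\big]'$. If $m_\lambda$ is bounded on $X$ and on $X'$ for some $\lambda\in(0,1)$, then $M$ is bounded on $X$.
   Context: Let $L^0(\mathbb R^n)$ be the space of measurable functions on $\mathbb R^n$. A vector space $X\subseteq L^0(\mathbb R^n)$ with a norm $\|\cdot\|_X$ is a Banach function space over $\mathbb R^n$ if: (Ideal property) if $f\in X$, $g\in L^0(\mathbb R^n)$ and $|g|\le|f|$, then $g\in X$ and $\|g\|_X\le\|f\|_X$; (Fatou property) if $0\le f_j\uparrow f$ with $f_j\in X$ and $\sup_j\|f_j\|_X<\infty$, then $f\in X$ and $\|f\|_X=\sup_j\|f_j\|_X$; (Saturation property) for every measurable $E\subset\mathbb R^n$ of positive measure there is a measurable $F\subseteq E$ of positive measure with $\chi_F\in X$. The associate space $X'$ is the space of all $f\in L^0(\mathbb R^n)$ with $\|f\|_{X'}:=\sup_{\|g\|_X\le1}\int_{\mathbb R^n}|fg|<\infty$. For a Banach function space $Y$ and $p>0$, $Y^p$ is defined by $\|f\|_{Y^p}:=\||f|^{1/p}\|_Y^p$; thus $\|f\|_{Y^{1/p}}=\||f|^p\|_Y^{1/p}$, and $f\in Y^{1/p}$ iff $|f|^p\in Y$. The Hardy--Littlewood maximal operator is $Mf(x):=\sup_{Q\ni x}\frac1{|Q|}\int_Q|f|$, the supremum over all cubes $Q\subset\mathbb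 R^n$ containing $x$. For $\lambda\in(0,1)$ the $\lambda$-median maximal operator is $$m_\lambda f(x):=\sup_{Q\ni x}(f\chi_Q)^*(\lambda|Q|),$$ the supremum over all cubes containing $x$, where $f^*$ is the non-increasing rearrangement, i.e. $(f\chi_Q)^*(\lambda|Q|)=\inf\{\alpha>0:|\{x\in Q:|f(x)|>\alpha\}|\le\lambda|Q|\}$. An operator $T$ is bounded on a space $Y$ if there is $C>0$ such that $\|Tf\|_Y\le C\|f\|_Y$ for all $f\in Y$. *)

(* Defs.v *)
From HB Require Import structures.
From mathcomp Require Import all_boot all_order all_algebra.
From mathcomp Require Import all_classical all_reals all_analysis.

Set Implicit Arguments.
Unset Strict Implicit.
Unset Printing Implicit Defensive.
Import Order.TTheory GRing.Theory Num.Theory.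
Import numFieldNormedType.Exports.

Local Open Scope classical_set_scope.
Local Open Scope ring_scope.

Section borel_lebesgue.
Variables (R : realType) (n : nat).
Variable mu : {measure set (n.-tuple (measurableTypeR R)) -> \bar R}.

Definition tuple_cons (z : n.-tuple (measurableTypeR R) * measurableTypeR R)
  : n.+1.-tuple (measurableTypeR R) := [tuple of z.2 :: z.1].

Lemma measurable_tuple_cons : measurable_fun [set: _] tuple_cons.
Proof. exact: measurable_cons. Qed.

Definition lebesgue_cons : set (n.+1.-tuple (measurableTypeR R)) -> \bar R :=
  pushforward (mu \x @lebesgue_measure R)%E tuple_cons.

HB.instance Definition _ := Measure.copy lebesgue_cons
  (measure_function_pushforward__canonical__measure_function_Measure
     (mu \x @lebesgue_measure R)%E measurable_tuple_cons).

End borel_lebesgue.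

(* Lebesgue measure on the Borel sets of R^n, as an iterated product measure. *)
Fixpoint borel_lebesgue (R : realType) (n : nat) :
    {measure set (n.-tuple (measurableTypeR R)) -> \bar R} :=
  match n with
  | 0 => dirac [tuple]
  | n'.+1 => lebesgue_cons (borel_lebesgue R n')
  end.

(* R^n with the sigma-algebra of Lebesgue-measurable sets; its elements are
   n-tuples of reals. *)
Definition Rn (R : realType) (n : nat) : measurableType _ :=
  caratheodory_type (borel_lebesgue R n)^*%mu.

(* Lebesgue measure on R^n, i.e. the completion of [borel_lebesgue]. *)
Definition leb (R : realType) (n : nat) : {measure set (Rn R n) -> \bar R} :=
  @completed_measure_extension _ _ _ (borel_lebesgue R n).

Section function_spaces.
Variables (R : realType) (n : nat).

(* A function space is given by its elements and its norm, both on the level of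
   representatives: functions that agree almost everywhere are identified, so
   (in)equalities between functions are required almost everywhere only.  The
   value of the norm outside the carrier is irrelevant. *)
Record fspace := Fspace {
  carrier : set (Rn R n -> R) ;
  fnorm : (Rn R n -> R) -> R }.

Record banach_function_space (X : fspace) : Prop := BanachFunctionSpace {
  bfs_measurable : forall f, carrier X f -> measurable_fun [set: Rn R n] f ;
  bfs0 : carrier X (cst 0) ;
  bfsD : forall f g, carrier X f -> carrier X g -> carrier X (f \+ g) ;
  bfsZ : forall (a : R) f, carrier X f -> carrier X (a \*: f) ;
  fnorm_ge0 : forall f, carrier X f -> 0 <= fnorm X f ;
  fnorm_eq0 : forall f, carrier X f -> fnorm X f = 0 ->
    {ae leb R n, forall x, f x = 0} ;
  fnormZ : forall (a : R) f, carrier X f ->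
    fnorm X (a \*: f) = `|a| * fnorm X f ;
  ler_fnormD : forall f g, carrier X f -> carrier X g ->
    fnorm X (f \+ g) <= fnorm X f + fnorm X g ;
  bfs_ideal : forall f (g : Rn R n -> R), carrier X f -> measurable_fun [set: Rn R n] g ->
    {ae leb R n, forall x, `|g x| <= `|f x|} ->
    carrier X g /\ fnorm X g <= fnorm X f ;
  bfs_fatou : forall (u : (Rn R n -> R)^nat) (f : Rn R n -> R),
    (forall j, carrier X (u j)) -> measurable_fun [set: Rn R n] f ->
    {ae leb R n, forall x, (forall j, 0 <= u j x) /\
      nondecreasing_seq (u ^~ x) /\ u ^~ x @ \oo --> f x} ->
    has_ubound (range (fun j => fnorm X (u j))) ->
    carrier X f /\ fnorm X f = sup (range (fun j => fnorm X (u j))) ;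
  bfs_saturation : forall E : set (Rn R n), measurable E -> (0 < leb R n E)%E ->
    exists F : set (Rn R n), [/\ measurable F, F `<=` E, (0 < leb R n F)%E &
      carrier X (\1_F : Rn R n -> R)] }.

(* The norm of the associate space, [+oo] outside of it. *)
Definition associate_enorm (X : fspace) (f : Rn R n -> R) : \bar R :=
  ereal_sup [set (\int[leb R n]_x `|f x * g x|%:E)%E | g in
    [set g | carrier X g /\ fnorm X g <= 1]].

Definition associate (X : fspace) : fspace := Fspace
  [set f : Rn R n -> R | measurable_fun [set: Rn R n] f /\ (associate_enorm X f < +oo)%E]
  (fun f => fine (associate_enorm X f)).

(* Y^p; in particular [power Y p^-1] is Y^{1/p}. *)
Definition power (Y : fspace) (p : R) : fspace := Fspace
  [set f : Rn R n -> R | measurable_fun [set: Rn R n] f /\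
    carrier Y (fun x => `|f x| `^ p^-1)]
  (fun f => fnorm Y (fun x => `|f x| `^ p^-1) `^ p).

(* Closed cubes with sides parallel to the axes. *)
Definition cube (a : Rn R n) (l : R) : set (Rn R n) :=
  [set y | forall i : 'I_n, tnth a i <= tnth y i <= tnth a i + l].

Definition maximal (f : Rn R n -> R) (x : Rn R n) : \bar R :=
  ereal_sup [set ((fine (leb R n Q))^-1%:E * \int[leb R n]_(y in Q) `|f y|%:E)%E
    | Q in [set Q | exists a (l : R), [/\ 0 < l, Q = cube a l & Q x]]].

Definition rearrangement (f : Rn R n -> R) (t : \bar R) : \bar R :=
  ereal_inf [set alpha%:E | alpha in
    [set alpha : R | 0 < alpha /\
      (leb R n [set x | (alpha < `|f x|)%R] <= t)%E]].

Definition median_maximal (lambda : R) (f : Rn R n -> R) (x : Rn R n) : \bar R :=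
  ereal_sup [set rearrangement (f \* \1_Q) (lambda%:E * leb R n Q)%E
    | Q in [set Q | exists a (l : R), [/\ 0 < l, Q = cube a l & Q x]]].

(* [T f] may take the value [+oo]; it belongs to [Y] when it agrees almost
   everywhere with an element of [Y], whose norm is then the norm of [T f]. *)
Definition bounded_on (T : (Rn R n -> R) -> Rn R n -> \bar R) (Y : fspace) :=
  exists2 C : R, 0 < C & forall f, carrier Y f ->
    exists g, [/\ carrier Y g, {ae leb R n, forall x, T f x = (g x)%:E} &
      fnorm Y g <= C * fnorm Y f].

End function_spaces.

(* Main.v *)
Require Import Defs.
From HB Require Import structures.
From mathcomp Require Import all_boot all_order all_algebra.
From mathcomp Require Import all_classical all_reals all_analysis.
From mathcomp Require Import measurable_realfun ring lra.

(** Write X' for the associate space, Y for its m-convexification (X')^(1/m)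
    with m a large integer, Y' for the associate space of Y, m_lambda for the
    median maximal operator and <f>_P for the mean of |f| over a cube P.

    Medians control averages.  If m_lambda is bounded on X' with constant A, its
    k-th iterate is bounded with constant A^k.  Each iteration enlarges level
    sets: m_lambda h exceeds a on every cube where {|h| > a} has density above
    lambda, and [growth] shows that such cubes cover, inside every cube P where
    {|h| > a} has density at most v, a set larger by a factor theta > 1.  After
    k iterations a set of density theta^(-k) in P has become one of density
    above lambda ([median_iter_gt]), so that the next iterate of f^m dominates on P
    the m-th power of the median of f at the level theta^(-k).  Slicing f
    along these medians bounds <f>_P by a series with coefficients theta^(-k)
    ([average_le_medians]).  In Y the coefficients enter as theta^(-k m), up to
    a square root that absorbs the summation, and this beats A^k once m is
    large: M is bounded on Y ([maximal_of_median]), hence on Y' by hypothesis.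

    A_1 weights.  Let g be in the unit ball of X'.  The Rubio de Francia series
    of g^(1/m) is an A_1 weight w with g <= w^m and w^m in a fixed ball of X'
    ([a1_majorant]).  If f is in the unit ball of X then f w^(m-1) is in a fixed
    ball of Y' ([pow_dual_norm_weight]), where M is bounded.  Therefore
    F = M(f w^(m-1)) / w^(m-1) satisfies int F g <= int M(f w^(m-1)) w <= C0.
    Since w is on P at least a multiple of its mean, and on most of P at most a
    multiple of it, F is at least c <f>_P on most of P, for every cube P at once
    ([good_majorant]).

    Minimax.  This F depends on g; an element of X is wanted instead.  Fix
    finitely many cubes and a bounded f.  The functions that are large on most
    of each cube form a convex set, provided that most is measured by the
    integral of a convex function, and so does the ball of radius C0 in X.  If
    the two sets were at positive L^2 distance, the difference of their nearest
    points would separate them, and its positive part, normalized in X', would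
    be a g for which the previous paragraph fails ([separation], [minimax]).
    Hence some b in the ball is so close to such an F that b is itself at least
    a multiple of <f>_P on a proportion larger than lambda of each of the cubes;
    there m_lambda b is at least a multiple of <f>_P on all of P.  As m_lambda
    is bounded on X, the supremum of the finitely many averages has norm bounded
    by a constant that does not depend on the cubes ([finite_majorant]).  The
    Fatou property along the rational cubes and the truncations of f gives the
    bound for M f ([maximal_bounded]).

    The geometry of R^n enters only through [growth] and the countable basis of
    rational cubes [ccube_rat_basis]; the rest holds for an arbitrary family of
    sets with these two properties. *)

Set Implicit Arguments.
Unset Strict Implicit.
Unset Printing Implicit Defensive.
Import Order.TTheory GRing.Theory Num.Theory.
Import numFieldNormedType.Exports.
Local Open Scope classical_set_scope.
Local Open Scope ring_scope.

(** * Lebesgue measure of boxes and cubes *)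

Section boxes.
Variable R : realType.

Definition box n (I : 'I_n -> set (measurableTypeR R)) :
  set (n.-tuple (measurableTypeR R)) := [set y | forall i, I i (tnth y i)].

Lemma measurable_box n (I : 'I_n -> set (measurableTypeR R)) :
  (forall i, measurable (I i)) -> measurable (box I).
Proof.
move=> mI; rewrite (_ : box I = \bigcap_i (@tnth _ _ ^~ i @^-1` I i)); last first.
  by apply/seteqP; split=> [y yI i _|y yI i]; [exact: yI|exact: (yI i)].
apply: fin_bigcap_measurable; first exact: finite_finset.
by move=> i _; rewrite -[X in measurable X]setTI; apply: measurable_tnth.
Qed.

Lemma borel_lebesgue_box n (I : 'I_n -> set (measurableTypeR R)) :
  (forall i, measurable (I i)) ->
  borel_lebesgue R n (box I) = (\prod_(i < n) lebesgue_measure (I i))%E.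
Proof.
elim: n I => [|n IH] I mI.
  rewrite big_ord0 /= diracE (_ : [tuple] \in box I) //.
  by rewrite inE => -[].
rewrite big_ord_recl /=.
rewrite /lebesgue_cons /pushforward.
rewrite (_ : _ @^-1` _ = box (fun i => I (lift ord0 i)) `*` I ord0); last first.
  apply/seteqP; split=> [[x y] xy|[x y] [/= hx hy] i] /=.
    split=> [i|] /=; last by have := xy ord0; rewrite (tnth_nth 0).
    by have := xy (lift ord0 i); rewrite tnthS.
  have [->|i0] := eqVneq i ord0; first by rewrite (tnth_nth 0).
  case: (unliftP ord0 i) i0 => [j ->|->]; last by rewrite eqxx.
  by move=> _; rewrite tnthS; exact: hx.
rewrite product_measure1E; last 2 first.
- by apply: measurable_box => i; exact: mI.
- exact: mI.
by rewrite IH // muleC.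
Qed.

End boxes.

Section cubes.
Variables (R : realType) (n : nat).
Local Notation T := (Rn R n).
Local Notation mu := (leb R n).
Implicit Types (a : T) (l : R) (E : set T).

Lemma measurable_borel E :
  measurable (E : set (n.-tuple (measurableTypeR R))) -> measurable E.
Proof. exact: caratheodory_measurable_mu_ext. Qed.

Lemma leb_borel E :
  measurable (E : set (n.-tuple (measurableTypeR R))) ->
  mu E = borel_lebesgue R n E.
Proof. exact: measurable_mu_extE. Qed.

Lemma measurable_coord (i : 'I_n) : measurable_fun [set: T] (fun x : T => tnth x i : R).
Proof.
move=> _ Y mY; apply: measurable_borel.
exact: (@measurable_tnth _ _ n i measurableT Y mY).
Qed.

Definition hcube a l : set T :=
  [set y | forall i : 'I_n, tnth a i <= tnth y i < tnth a i + l].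

Lemma cube_box a l :
  cube a l = box (fun i => `[tnth a i, tnth a i + l]%classic : set (measurableTypeR R)).
Proof. by apply/seteqP; split=> y h i; have := h i; rewrite /= in_itv. Qed.

Lemma hcube_box a l :
  hcube a l = box (fun i => `[tnth a i, tnth a i + l[%classic : set (measurableTypeR R)).
Proof. by apply/seteqP; split=> y h i; have := h i; rewrite /= in_itv. Qed.

Lemma measurable_cube a l : measurable (cube a l).
Proof.
apply: measurable_borel; rewrite cube_box; apply: measurable_box => i.
exact: measurable_itv.
Qed.

Lemma leb_cube a l : 0 < l -> mu (cube a l) = (l ^+ n)%:E.
Proof.
move=> l0; rewrite leb_borel cube_box; last first.
  by apply: measurable_box => i; exact: measurable_itv.
rewrite borel_lebesgue_box; last by move=> i; exact: measurable_itv.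
under eq_bigr do rewrite lebesgue_measure_itv /= lte_fin ltrDl l0 -EFinB addrAC subrr add0r.
by rewrite big_const_ord iter_mule mule1 EFin_expe.
Qed.

Lemma leb_hcube a l : 0 < l -> mu (hcube a l) = (l ^+ n)%:E.
Proof.
move=> l0; rewrite leb_borel hcube_box; last first.
  by apply: measurable_box => i; exact: measurable_itv.
rewrite borel_lebesgue_box; last by move=> i; exact: measurable_itv.
under eq_bigr do rewrite lebesgue_measure_itv /= lte_fin ltrDl l0 -EFinB addrAC subrr add0r.
by rewrite big_const_ord iter_mule mule1 EFin_expe.
Qed.

(** The half-spaces [x_i < c] generate the Borel sets, since each coordinate pulls
    back the generators of the Borel sets of the line to them. *)
Lemma borel_sub_sigma (S : set (set T)) : sigma_algebra setT S ->
  (forall (i : 'I_n) c, S [set x | tnth x i < c]) ->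
  forall E, measurable (E : set (n.-tuple (measurableTypeR R))) -> S E.
Proof.
move=> sS hS; apply: smallest_sub => //.
move: (@big_ind _ (fun C : set (set (n.-tuple (measurableTypeR R))) => C `<=` S)).
apply=> [//|C D CS DS A [/CS|/DS]//|i _ _ [Y mY <-]].
rewrite setTI.
suff: @measurable _ (measurableTypeR R) `<=` image_set_system setT (fun x : T => tnth x i : R) S.
  by move=> /(_ Y mY); rewrite /image_set_system /= setTI.
have -> : @measurable _ (measurableTypeR R) = (@measurable_realfun.RGenInftyO.G R).-sigma.-measurable.
  exact: measurable_realfun.RGenInftyO.measurableE.
apply: smallest_sub; first exact: sigma_algebra_image.
move=> _ [c ->]; rewrite /image_set_system /= setTI.
rewrite (_ : _ @^-1` _ = [set x : T | tnth x i < c]); first exact: hS.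
by apply/seteqP; split=> x /=; rewrite in_itv.
Qed.

(** The completed measure is an outer measure built from countable covers by Borel
    sets, and the union of such a cover is still in S.  The sigma-algebra S is
    left open because [approximable_all] uses the sets that are approximable by
    dyadic cells, which are not known beforehand to include the Borel sets. *)
Lemma leb_outer_regular (S : set (set T)) : sigma_algebra setT S ->
  (forall (i : 'I_n) c, S [set x | tnth x i < c]) ->
  forall E (e : R), (mu E < +oo)%E -> 0 < e ->
  exists B, [/\ S B, measurable B, E `<=` B & (mu B <= mu E + e%:E)%E].
Proof.
move=> sS hS E e Efin e0.
have Efn : (mu E) \is a fin_num.
  by rewrite ge0_fin_numE //; exact: mu_ext_ge0.
have : (mu E < mu E + e%:E)%E by rewrite lteDl // lte_fin.
rewrite {1}/mu /= /completed_measure_extension => /ereal_inf_lt [_ [F [mF EF] <-] FE].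
exists (\bigcup_k F k); split => //.
- have [_ _ sSU] := sS; apply: sSU => k.
  by apply: borel_sub_sigma => //; exact: mF.
- apply: measurable_borel; exact: bigcup_measurable.
- apply: (@le_trans _ _ (borel_lebesgue R n (\bigcup_k F k))).
    by rewrite le_eqVlt; apply/orP; left; apply/eqP/leb_borel; exact: bigcup_measurable.
  apply: (le_trans _ (ltW FE)).
  by apply: measure_sigma_subadditive => //; exact: bigcup_measurable.
Qed.

End cubes.

(** * Dyadic cells and the density of a set *)

Section measure_facts.
Context d (T : measurableType d) (R : realType) (mu : {measure set T -> \bar R}).
Implicit Types A B : set T.

Lemma mu_setD A B : measurable A -> measurable B -> (mu A < +oo)%E -> B `<=` A ->
  mu (A `\` B) = (mu A - mu B)%E.
Proof. by move=> mA mB fA BA; rewrite measureD // setIidr. Qed.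

Lemma mu_leU A B : measurable A -> measurable B -> (mu (A `|` B) <= mu A + mu B)%E.
Proof. exact: measureU2. Qed.

Lemma mu_le A B : measurable A -> measurable B -> A `<=` B -> (mu A <= mu B)%E.
Proof. by move=> mA mB AB; apply: le_measure; rewrite ?inE. Qed.

Lemma mu_setU A B : measurable A -> measurable B -> A `&` B = set0 ->
  mu (A `|` B) = (mu A + mu B)%E.
Proof. exact: measureU. Qed.

Lemma measurable_above (f : T -> R) a : measurable_fun [set: T] f ->
  measurable [set x | a < f x].
Proof.
move=> mf; have -> : [set x | a < f x] = f @^-1` `]a, +oo[%classic.
  by apply/seteqP; split=> x; rewrite /= in_itv /= andbT.
by rewrite -[X in measurable X]setTI; exact: mf.
Qed.

Lemma measurable_below (f : T -> R) a : measurable_fun [set: T] f ->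
  measurable [set x | f x < a].
Proof.
move=> mf; have -> : [set x | f x < a] = f @^-1` `]-oo, a[%classic.
  by apply/seteqP; split=> x; rewrite /= in_itv.
by rewrite -[X in measurable X]setTI; exact: mf.
Qed.

End measure_facts.

Section coordinates.
Variables (R : realType) (n : nat) (d : measure_display) (T : measurableType d).
Variables (mu : {measure set T -> \bar R}) (co : T -> 'I_n -> R).
Implicit Types (a : 'I_n -> R) (l : R) (E G A B S : set T) (N : nat).

Definition ccube a l : set T := [set y | forall i, a i <= co y i <= a i + l].
Definition ocube a l : set T := [set y | forall i, a i <= co y i < a i + l].

Hypothesis mco : forall i, measurable_fun [set: T] (co ^~ i).
Hypothesis mu_ccube : forall a l, 0 < l -> mu (ccube a l) = (l ^+ n)%:E.
Hypothesis mu_ocube : forall a l, 0 < l -> mu (ocube a l) = (l ^+ n)%:E.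
Hypothesis outer_regular : forall S : set (set T), sigma_algebra setT S ->
  (forall i c, S [set x | co x i < c]) ->
  forall E (e : R), (mu E < +oo)%E -> 0 < e ->
  exists B, [/\ S B, measurable B, E `<=` B & (mu B <= mu E + e%:E)%E].

Lemma measurable_coord_itv i (I : interval R) : measurable [set y : T | co y i \in I].
Proof.
rewrite -[X in measurable X]setTI.
exact: (@mco i measurableT [set` I] (measurable_itv I)).
Qed.

Lemma measurable_ccube a l : measurable (ccube a l).
Proof.
rewrite (_ : ccube a l = \bigcap_i [set y : T | co y i \in `[a i, a i + l]]).
  apply: fin_bigcap_measurable; first exact: finite_finset.
  by move=> i _; exact: measurable_coord_itv.
apply/seteqP; split=> [y yI i _|y yI i].
  by rewrite /= in_itv /=; exact: yI.
by have := yI i I; rewrite /= in_itv.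
Qed.

Lemma measurable_ocube a l : measurable (ocube a l).
Proof.
rewrite (_ : ocube a l = \bigcap_i [set y : T | co y i \in `[a i, a i + l[]).
  apply: fin_bigcap_measurable; first exact: finite_finset.
  by move=> i _; exact: measurable_coord_itv.
apply/seteqP; split=> [y yI i _|y yI i].
  by rewrite /= in_itv /=; exact: yI.
by have := yI i I; rewrite /= in_itv.
Qed.

Hint Resolve measurable_ccube measurable_ocube : core.

Lemma ocube_sub_ccube a l : ocube a l `<=` ccube a l.
Proof. by move=> y h i; have /andP[-> /ltW ->] := h i. Qed.

Lemma mu_ccube_fin a l : 0 < l -> (mu (ccube a l) < +oo)%E.
Proof. by move=> l0; rewrite mu_ccube // ltry. Qed.

Lemma mu_ocube_fin a l : 0 < l -> (mu (ocube a l) < +oo)%E.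
Proof. by move=> l0; rewrite mu_ocube // ltry. Qed.

Lemma mu_ccubeI a l E : 0 < l -> measurable E ->
  mu (E `&` ccube a l) = mu (E `&` ocube a l).
Proof.
move=> l0 mE; apply/eqP; rewrite eq_le; apply/andP; split; last first.
  apply: le_measure; rewrite ?inE; [exact: measurableI|exact: measurableI|].
  by apply: setIS; exact: ocube_sub_ccube.
have N0 : mu (ccube a l `\` ocube a l) = 0%E.
  rewrite mu_setD //; [|exact: mu_ccube_fin|exact: ocube_sub_ccube].
  by rewrite mu_ccube // mu_ocube // subee.
have mD : measurable (ccube a l `\` ocube a l) by exact: measurableD.
apply: (@le_trans _ _ (mu ((E `&` ocube a l) `|` (ccube a l `\` ocube a l)))).
  apply: le_measure; rewrite ?inE; [exact: measurableI| |].
    by apply: measurableU => //; exact: measurableI.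
  by move=> x [Ex Qx]; have [hx|hx] := pselect (ocube a l x); [left|right].
apply: (le_trans (mu_leU _ _ _)) => //; first exact: measurableI.
by rewrite N0 adde0.
Qed.

(** The integer coordinates of the cell of x in the grid of mesh l / N with origin
    a.  Grids are compared through these coordinates, so that a set is a union of
    cells when membership depends on the coordinates only ([adapted]). *)
Definition level a l N (x : T) (i : 'I_n) : int :=
  Num.floor (N%:R * (co x i - a i) / l).

Definition cell a l N (x : T) : set T := [set y | forall i, level a l N y i = level a l N x i].

Definition adapted a l N A := forall x y,
  (forall i, level a l N x i = level a l N y i) -> A x -> A y.

Lemma level_eq a l N (k : int) i x : 0 < l -> (0 < N)%N ->
  (level a l N x i == k) =
  (a i + l / N%:R * k%:~R <= co x i < a i + l / N%:R * k%:~R + l / N%:R).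
Proof.
move=> l0 N0; have N0' : (0 : R) < N%:R by rewrite ltr0n.
rewrite /level floor_eq.
have -> : N%:R * (co x i - a i) / l = (co x i - a i) / (l / N%:R).
  by field; rewrite !gt_eqF.
have h0 : 0 < l / N%:R by exact: divr_gt0.
rewrite ler_pdivlMr // ltr_pdivrMr // intrD mulrDl mul1r.
congr (_ && _); first by rewrite -lerBrDl mulrC.
by rewrite ltrBlDl addrA (mulrC k%:~R).
Qed.

Lemma cellE a l N x : 0 < l -> (0 < N)%N ->
  cell a l N x = ocube (fun i => a i + l / N%:R * (level a l N x i)%:~R) (l / N%:R).
Proof.
move=> l0 N0; apply/seteqP; split=> y h i; have := h i.
  by move/eqP; rewrite level_eq.
by rewrite -level_eq // => /eqP.
Qed.

Lemma measurable_adapted a l N A : 0 < l -> (0 < N)%N -> adapted a l N A -> measurable A.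
Proof.
move=> l0 N0 adA.
pose F (k : {ffun 'I_n -> int}) : set T :=
  [set y | A y /\ forall i, level a l N y i = k i].
have -> : A = \bigcup_k F k.
  apply/seteqP; split=> [x Ax|x [k _ []]//].
  by exists [ffun i => level a l N x i] => //; split=> // i; rewrite ffunE.
apply: countable_bigcupT_measurable; first exact: countableP.
move=> k; have [[x [Ax xk]]|nA] := pselect (exists x, F k x).
  have -> : F k = cell a l N x.
    apply/seteqP; split=> [y [Ay yk] i|y yx]; first by rewrite yk xk.
    split=> [|i]; last by rewrite yx xk.
    by apply: adA Ax => i; rewrite yx.
  by rewrite cellE.
rewrite (_ : F k = set0) //.
by rewrite -subset0 => x Fx; apply: nA; exists x.
Qed.

Lemma level1 a l x : 0 < l -> ocube a l x <-> forall i, level a l 1 x i = 0.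
Proof.
move=> l0; split=> h i; have := h i.
  by move=> hi; apply/eqP; rewrite level_eq // divr1 mulr0 addr0.
by move/eqP; rewrite level_eq // divr1 mulr0 addr0.
Qed.

Lemma level_double a l N x i : 0 < l ->
  level a l N x i = (level a l N.*2 x i %/ 2)%Z.
Proof.
move=> l0; rewrite /level -muln2 natrM.
set t := (N%:R * _ / l).
have -> : N%:R * 2 * (co x i - a i) / l = t * 2 by rewrite /t; ring.
set k := Num.floor (t * 2).
apply: floor_def.
have /andP[k1 k2] := floor_itv (t * 2); rewrite -/k in k1 k2.
have kE : k%:~R = ((k %/ 2)%Z)%:~R * 2 + (k %% 2)%Z%:~R :> R.
  by rewrite {1}(divz_eq k 2) intrD intrM.
have m0 : 0 <= ((k %% 2)%Z)%:~R :> R by rewrite ler0z modz_ge0.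
have m1 : ((k %% 2)%Z)%:~R <= 1 :> R.
  by rewrite -[1]/(1%:~R) ler_int -ltzD1; exact: ltz_pmod.
move: k2; rewrite !intrD !mulr1z => k2.
by apply/andP; split; lra.
Qed.

Lemma adapted_double a l N A : 0 < l -> adapted a l N A -> adapted a l N.*2 A.
Proof.
move=> l0 adA x y xy; apply: adA => i.
by rewrite [LHS]level_double // [RHS]level_double // xy.
Qed.

Lemma adapted_exp a l m p A : 0 < l -> (m <= p)%N -> adapted a l (2 ^ m) A -> adapted a l (2 ^ p) A.
Proof.
move=> l0; elim: p => [|p IH]; first by rewrite leqn0 => /eqP ->.
rewrite leq_eqVlt => /predU1P[->//|]; rewrite ltnS => /IH h /h.
by rewrite expnS mul2n; exact: adapted_double.
Qed.

Definition symdiff Q A B : set T := Q `&` ((A `\` B) `|` (B `\` A)).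

(** Approximation inside the cube [ocube a l], in measure, by unions of dyadic
    cells of this cube. *)
Definition approximable a l B := measurable B /\ forall e : R, 0 < e -> exists m A,
  adapted a l (2 ^ m) A /\ (mu (symdiff (ocube a l) A B) <= e%:E)%E.

(** For a union, finitely many terms carry all but e / 2 of the measure of the
    union in the cube, and they are approximated on a common finer grid within
    e / 2 in total. *)
Lemma sigma_algebra_approximable a l : 0 < l ->
  sigma_algebra setT (approximable a l).
Proof.
move=> l0; split.
- split=> // e e0; exists 0%N, set0; split=> //.
  by rewrite /symdiff !set0D setU0 setI0 measure0 lee_fin ltW.
- move=> B [mB hB]; split; first by rewrite setTD; exact: measurableC.
  move=> e /hB [m [A [adA muA]]]; exists m, (~` A); split.
    by move=> x y xy nAx Ay; apply: nAx; apply: adA Ay => i; rewrite xy.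
  by rewrite /symdiff setTD !setDE !setCK setUC [~` B `&` _]setIC [~` A `&` _]setIC in muA *.
- move=> F hF.
  have mF k : measurable (F k) by have [] := hF k.
  have mU : measurable (\bigcup_k F k) by exact: bigcup_measurable.
  split=> // e e0.
  have e20 : 0 < e / 2 by rewrite divr_gt0.
  have /choice[h hh] : forall k, exists mA : nat * set T,
      adapted a l (2 ^ mA.1) mA.2 /\
      (mu (symdiff (ocube a l) mA.2 (F k)) <= (e / 2 / (2 ^ k.+1)%:R)%:E)%E.
    move=> k; have [_ /(_ (e / 2 / (2 ^ k.+1)%:R))] := hF k.
    rewrite divr_gt0 // ?ltr0n ?expn_gt0 // => /(_ isT) [m [A mA]].
    by exists (m, A).
  pose Q := ocube a l.
  have [K hK] : exists K, (mu (Q `&` (\bigcup_k F k `\` \bigcup_(k < K) F k)) <= (e / 2)%:E)%E.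
    pose Z K := Q `&` (\bigcup_k F k `\` \bigcup_(k < K) F k).
    have mZ K : measurable (Z K).
      apply: measurableI; first exact: measurable_ocube.
      by apply: measurableD => //; apply: bigcup_measurable.
    have Z0 : \bigcap_k Z k = set0.
      rewrite -subset0 => x hx; have [_ [[k _ Fkx] _]] := hx 0%N I.
      by have [_ [_]] := hx k.+1 I; apply; exists k => /=.
    have := @nonincreasing_cvg_mu _ _ _ mu Z.
    rewrite Z0 measure0 => /(_ _ mZ measurable0).
    have Z0fin : (mu (Z 0%N) < +oo)%E.
      apply: (@le_lt_trans _ _ (mu Q)); last exact: mu_ocube_fin.
      by apply: (mu_le _ (mZ 0%N)); [exact: measurable_ocube|exact: subIsetl].
    move=> /(_ Z0fin) cZ.
    have nd : {homo Z : n m / (n <= m)%N >-> (m <= n)%O}.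
      move=> p q pq; apply/subsetPset => x [Qx [Fx nFx]]; split=> //; split=> //.
      by move=> [k /= kp Fk]; apply: nFx; exists k => //=; exact: leq_trans kp pq.
    have nb : nbhs (0 : \bar R)%E [set y : \bar R | (y < (e / 2)%:E)%E].
      exact: (@nbhs_open_ereal_lt R 0 (fun=> e / 2)).
    have [K _ /(_ K (leqnn K)) hK] := cZ nd _ nb.
    by exists K; exact: ltW.
  pose A := \bigcup_(k < K) (h k).2.
  have adA k : adapted a l (2 ^ (h k).1) (h k).2 by have [] := hh k.
  have adA' : adapted a l (2 ^ \max_(k < K) (h k).1) A.
    move=> x y xy [k /= kK Akx]; exists k => //=.
    have /adapted_exp : ((h k).1 <= \max_(k < K) (h k).1)%N.
      exact: (@leq_bigmax _ (fun i : 'I_K => (h i).1) (Ordinal kK)).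
    by move=> /(_ _ _ _ l0 (adA k)); apply; [exact: xy|exact: Akx].
  exists (\max_(k < K) (h k).1), A; split=> //.
  have N0 m : (0 < 2 ^ m)%N by rewrite expn_gt0.
  have mA k : measurable (h k).2 := measurable_adapted l0 (N0 _) (adA k).
  have mAA : measurable A := measurable_adapted l0 (N0 _) adA'.
  have mS (B C : set T) : measurable B -> measurable C -> measurable (symdiff Q B C).
    move=> mB mC; apply: measurableI; first exact: measurable_ocube.
    by apply: measurableU; exact: measurableD.
  pose Z := Q `&` (\bigcup_k F k `\` \bigcup_(k < K) F k).
  have mZ : measurable Z.
    apply: measurableI; first exact: measurable_ocube.
    by apply: measurableD => //; apply: bigcup_measurable.
  pose Y := \bigcup_k symdiff Q (h k).2 (F k).
  have mY : measurable Y by apply: bigcupT_measurable => k; exact: mS.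
  apply: (@le_trans _ _ (mu (Z `|` Y))).
    apply: mu_le; [exact: mS|exact: measurableU|].
    move=> x [Qx [[[k /= kK Ax] nF]|[[k _ Fx] nA]]].
      right; exists k => //; split=> //; left; split=> // Fx.
      by apply: nF; exists k.
    have [[j /= jK Fjx]|nFK] := pselect ((\bigcup_(k < K) F k) x).
      right; exists j => //; split=> //; right; split=> // Ax.
      by apply: nA; exists j.
    by left; split=> //; split=> //; exists k.
  apply: (le_trans (mu_leU _ mZ mY)).
  rewrite [e]splitr EFinD leeD //.
  apply: le_trans (epsilon_trick0 xpredT (ltW e20)).
  apply: le_trans (measure_sigma_subadditive mu (fun k => mS _ _ (mA k) (mF k)) mY (@subset_refl _ _)) _.
  by apply: lee_nneseries => // k _; have [] := hh k.
Qed.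

(** A half-space [x_i < c] is the union over m of the cells of mesh l / 2^m that
    it contains, hence it is approximable.  So every measurable set is contained
    in an approximable set of almost the same measure. *)
Lemma approximable_all a l E : 0 < l -> measurable E -> approximable a l E.
Proof.
move=> l0 mE; split=> // e e0.
have e20 : 0 < e / 2 by rewrite divr_gt0.
pose Q := ocube a l.
have mQ : measurable Q by exact: measurable_ocube.
have mEQ : measurable (E `&` Q) by exact: measurableI.
have fEQ : (mu (E `&` Q) < +oo)%E.
  by apply: le_lt_trans (mu_ocube_fin a l0); apply: mu_le => //; exact: subIsetr.
have half i c : approximable a l [set x | co x i < c].
  rewrite (_ : [set x | co x i < c] = \bigcup_m
      [set x | a i + l / (2 ^ m)%:R * (level a l (2 ^ m) x i + 1)%:~R <= c]).
    have [_ _ sU] := sigma_algebra_approximable a l0.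
    apply: sU => m.
    have ad : adapted a l (2 ^ m) [set x | a i + l / (2 ^ m)%:R * (level a l (2 ^ m) x i + 1)%:~R <= c].
      by move=> x y xy /=; rewrite xy.
    split; first by apply: measurable_adapted ad; rewrite ?expn_gt0.
    move=> e' e'0; exists m; eexists; split; first exact: ad.
    by rewrite /symdiff setDv setU0 setI0 measure0 lee_fin ltW.
  apply/seteqP; split=> [x /= xc|x [m _ /=]].
    have dc : 0 < (c - co x i) / l by rewrite divr_gt0 // subr_gt0.
    have [m hm] : exists m, ((c - co x i) / l)^-1 < (2 ^ m)%:R.
      exists (Num.bound ((c - co x i) / l)^-1).
      apply: lt_trans (archi_boundP _) _; first by rewrite invr_ge0 ltW.
      by rewrite ltr_nat ltn_expl.
    exists m => //=.
    have N0 : (0 < 2 ^ m)%N by rewrite expn_gt0.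
    have N0' : (0 : R) < (2 ^ m)%:R by rewrite ltr0n.
    have := level_eq a (level a l (2 ^ m) x i) i x l0 N0.
    rewrite eqxx => /esym/andP[h1 h2].
    rewrite intrD mulr1z mulrDr mulr1 addrA.
    apply: le_trans (_ : co x i + l / (2 ^ m)%:R <= _); first by rewrite lerD2r.
    rewrite -lerBrDl ler_pdivrMr // mulrC -ler_pdivrMr ?subr_gt0 //.
    by move: hm; rewrite invf_div => /ltW.
  apply: lt_le_trans.
  have N0 : (0 < 2 ^ m)%N by rewrite expn_gt0.
  have := level_eq a (level a l (2 ^ m) x i) i x l0 N0.
  rewrite eqxx => /esym/andP[h1 h2].
  by rewrite intrD mulr1z mulrDr mulr1 addrA.
have [B [[mB hB] _ EB muB]] := outer_regular (sigma_algebra_approximable a l0) half fEQ e20.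
have [m [A [adA muA]]] := hB _ e20.
exists m, A; split=> //.
have mA : measurable A by apply: measurable_adapted adA; rewrite ?expn_gt0.
have mS (C D : set T) : measurable C -> measurable D -> measurable (symdiff Q C D).
  move=> mC mD; apply: measurableI; first exact: measurable_ocube.
  by apply: measurableU; exact: measurableD.
have mBE : measurable (B `\` (E `&` Q)) by exact: measurableD.
apply: (@le_trans _ _ (mu ((B `\` (E `&` Q)) `|` symdiff Q A B))).
  apply: mu_le; [exact: mS|by apply: measurableU => //; exact: mS|].
  move=> x [Qx [[Ax nEx]|[Ex nAx]]].
    have [Bx|nBx] := pselect (B x); first by left; split=> // -[].
    by right; split=> //; left.
  by right; split=> //; right; split=> //; exact: EB.
apply: le_trans (mu_leU _ mBE (mS _ _ mA mB)) _.
rewrite [e]splitr EFinD leeD //.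
rewrite mu_setD //; last first.
  by apply: le_lt_trans muB _; rewrite lte_add_pinfty // ltry.
by rewrite leeBlDl // ge0_fin_numE.
Qed.

(** The cells that tile [ocube a l], indexed by the finite type of their integer
    coordinates in order to sum over them. *)
Definition icell a l N (k : {ffun 'I_n -> 'I_N}) : set T :=
  [set x | forall i, level a l N x i = Posz (k i)].

Lemma level_bounds a l N x : 0 < l -> (0 < N)%N ->
  ocube a l x <-> forall i, 0 <= level a l N x i < Posz N.
Proof.
move=> l0 N0; have N0' : (0 : R) < N%:R by rewrite ltr0n.
have key i : (0 <= level a l N x i < Posz N) = (a i <= co x i < a i + l).
  rewrite /level floor_ge0 floor_lt_int.
  rewrite pmulr_lge0 ?invr_gt0 // pmulr_rge0 // subr_ge0.
  by rewrite -pmulrn ltr_pdivrMr // ltr_pM2l // ltrBlDl.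
by split=> h i; have := h i; rewrite key.
Qed.

Lemma icell_cell a l N (k : {ffun 'I_n -> 'I_N}) x : icell a l k x -> icell a l k = cell a l N x.
Proof.
move=> kx; apply/seteqP; split=> y h i; first by rewrite h kx.
by rewrite h kx.
Qed.

Lemma measurable_icell a l N (k : {ffun 'I_n -> 'I_N}) : 0 < l -> (0 < N)%N ->
  measurable (icell a l k).
Proof.
move=> l0 N0; apply: (@measurable_adapted a l N) => //.
by move=> x y xy kx i; rewrite -xy.
Qed.

Lemma mu_ocube_icell a l N S : 0 < l -> (0 < N)%N -> measurable S ->
  mu (S `&` ocube a l) =
  (\sum_(k \in [set: {ffun 'I_n -> 'I_N}]) mu (S `&` icell a l k))%E.
Proof.
move=> l0 N0 mS; rewrite -measure_fin_bigcup; last 3 first.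
- exact: finite_finset.
- apply/trivIsetP => j k _ _ jk; rewrite -subset0 => x [[_ xj] [_ xk]].
  move/eqP: jk; apply; apply/ffunP => i; apply/val_inj => /=.
  by have := xj i; rewrite xk => -[].
- by move=> k _; apply: measurableI => //; exact: measurable_icell.
congr (mu _); apply/seteqP; split=> [x [Sx /(level_bounds a x l0 N0) Qx]|x [k _ [Sx xk]]].
  have Pi i : exists p : 'I_N, level a l N x i = Posz p.
    have := Qx i; case: (level a l N x i) => // p /andP[_].
    by rewrite ltz_nat => pN; exists (Ordinal pN).
  have [p hp] := choice Pi.
  by exists [ffun i => p i] => //; split=> // i; rewrite ffunE.
split=> //; apply/(level_bounds a x l0 N0) => i.
by rewrite xk /= ltz_nat ltn_ord.
Qed.

(** Otherwise E has density at most k in each dyadic cell of the cube, hence also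
    in each union A of cells; but A can be chosen so close to E that its measure
    is almost that of E and of E `&` A, which forces 1 <= k.  This replaces the
    Lebesgue differentiation theorem. *)
Lemma density a l E (k : R) : 0 < l -> 0 <= k < 1 -> measurable E ->
  E `<=` ocube a l -> (0 < mu E)%E ->
  exists m x, ocube a l x /\
    (k%:E * mu (cell a l (2 ^ m) x) < mu (E `&` cell a l (2 ^ m) x))%E.
Proof.
move=> l0 /andP[k0 k1] mE EQ E0; apply: contrapT => nd.
have low m x : ocube a l x ->
    (mu (E `&` cell a l (2 ^ m) x) <= k%:E * mu (cell a l (2 ^ m) x))%E.
  by move=> Qx; rewrite leNgt; apply/negP => ?; apply: nd; exists m, x.
have fQ := mu_ocube_fin a l0.
have mQ := measurable_ocube a l.
have fE : (mu E < +oo)%E by apply: le_lt_trans fQ; exact: mu_le.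
have [t tE] : exists t, mu E = t%:E.
  by exists (fine (mu E)); rewrite fineK // ge0_fin_numE.
have t0 : 0 < t by move: E0; rewrite tE lte_fin.
(* The errors below add up to (1 + k) e < 2 e, less than the gap (1 - k) mu E. *)
pose e := (1 - k) * t / 4.
have e0 : 0 < e by rewrite /e divr_gt0 // mulr_gt0 // subr_gt0.
have [_ /(_ e e0) [m [A [adA muA]]]] := approximable_all a l0 mE.
have N0 : (0 < 2 ^ m)%N by rewrite expn_gt0.
have mA : measurable A := measurable_adapted l0 N0 adA.
have mEA : measurable (E `&` A) by exact: measurableI.
have mAQ : measurable (A `&` ocube a l) by exact: measurableI.
have mS : measurable (symdiff (ocube a l) A E).
  by apply: measurableI => //; apply: measurableU; exact: measurableD.
have h1 : (mu (E `&` A `&` ocube a l) <= k%:E * mu (A `&` ocube a l))%E.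
  rewrite (mu_ocube_icell a l0 N0) // (mu_ocube_icell a l0 N0) //.
  rewrite ge0_mule_fsumr; last by move=> ?.
  apply: lee_fsum; first exact: finite_finset.
  move=> j _; have [[x [Ax xj]]|nA] := pselect (exists x, (A `&` icell a l j) x).
    have -> : A `&` icell a l j = icell a l j.
      apply/setIidr => y yj; apply: adA Ax => i; by rewrite xj yj.
    rewrite -setIA.
    have -> : A `&` icell a l j = icell a l j.
      apply/setIidr => y yj; apply: adA Ax => i; by rewrite xj yj.
    rewrite (icell_cell xj); apply: low.
    by apply/(level_bounds a x l0 N0) => i; rewrite xj /= ltz_nat ltn_ord.
  have A0 : A `&` icell a l j = set0.
    by rewrite -subset0 => x Ax; apply: nA; exists x.
  by rewrite -setIA A0 setI0 measure0 mule0.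
have h2 : (mu E <= mu (E `&` A `&` ocube a l) + e%:E)%E.
  apply: (@le_trans _ _ (mu ((E `&` A `&` ocube a l) `|` symdiff (ocube a l) A E))).
    apply: mu_le => //; first by apply: measurableU => //; exact: measurableI.
    move=> x Ex; have Qx := EQ _ Ex.
    by have [Ax|nAx] := pselect (A x); [left|right; split=> //; right].
  apply: (le_trans (mu_leU _ _ _)) => //; first exact: measurableI.
  by rewrite leeD2l.
have h3 : (mu (A `&` ocube a l) <= mu E + e%:E)%E.
  apply: (@le_trans _ _ (mu (E `|` symdiff (ocube a l) A E))).
    apply: mu_le => //; first exact: measurableU.
    move=> x [Ax Qx].
    by have [Ex|nEx] := pselect (E x); [left|right; split=> //; left].
  apply: (le_trans (mu_leU _ _ _)) => //.
  by rewrite leeD2l.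
have : (mu E <= k%:E * (mu E + e%:E) + e%:E)%E.
  apply: (le_trans h2); rewrite leeD2r //; apply: (le_trans h1).
  by rewrite lee_wpmul2l // lee_fin.
rewrite tE -(EFinD t e) -EFinM -EFinD lee_fin /e.
have s0 : 0 < (1 - k) * t by rewrite mulr_gt0 // subr_gt0.
have s1 : k * ((1 - k) * t) <= (1 - k) * t by rewrite ler_piMl // ltW.
by move=> h; lra.
Qed.

(** * Growth of level sets inside a cube *)

Lemma expr_near1 (p : nat) (c : R) : 1 < c -> exists2 e : R, 0 < e & (1 + e) ^+ p <= c.
Proof.
elim: p c => [|p IH] c c1; first by exists 1; rewrite // expr0 ltW.
have [e e0 he] : exists2 e : R, 0 < e & (1 + e) ^+ p <= (1 + c) / 2 by apply: IH; lra.
pose f := Num.min e ((c - 1) / (c + 1)).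
have f0 : 0 < f by rewrite lt_min e0 divr_gt0 //; lra.
exists f => //; rewrite exprS.
have h1 : 1 + f <= 2 * c / (c + 1).
  have : f <= (c - 1) / (c + 1) by rewrite ge_min lexx orbT.
  suff -> : 2 * c / (c + 1) = 1 + (c - 1) / (c + 1) by rewrite lerD2l.
  by field; lra.
have h2 : (1 + f) ^+ p <= (1 + c) / 2.
  apply: le_trans he; apply: lerXn2r; rewrite ?nnegrE; [lra|lra|].
  by rewrite lerD2l ge_min lexx.
apply: (@le_trans _ _ ((2 * c / (c + 1)) * ((1 + c) / 2))).
  by apply: ler_pM => //; [lra|apply: exprn_ge0; lra].
rewrite le_eqVlt; apply/orP; left; apply/eqP; field; lra.
Qed.

Lemma ccube_sub a l b r : (forall i, b i <= a i /\ a i + l <= b i + r) ->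
  ccube a l `<=` ccube b r.
Proof.
move=> h y hy i; have [h1 h2] := h i; have /andP[h3 h4] := hy i.
by rewrite (le_trans h1 h3) (le_trans h4 h2).
Qed.

(** The inner cube is deformed into the outer one through N nested cubes whose
    sides grow so slowly that the measure is multiplied by at most v / u at each
    step.  The first of these cubes in which E has density at most v keeps the
    mass of the previous one, so that its density is still above u. *)
Lemma interpolate a l a' l' E (u v : R) : 0 < l' -> l' <= l ->
  (forall i, a i <= a' i /\ a' i + l' <= a i + l) -> measurable E ->
  0 < u < v ->
  (v%:E * mu (ccube a' l') < mu (E `&` ccube a' l'))%E ->
  (mu (E `&` ccube a l) <= v%:E * mu (ccube a l))%E ->
  exists b r, [/\ 0 < r, ccube a' l' `<=` ccube b r, ccube b r `<=` ccube a l,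
   (u%:E * mu (ccube b r) < mu (E `&` ccube b r))%E &
   (mu (E `&` ccube b r) <= v%:E * mu (ccube b r))%E].
Proof.
move=> l'0 ll aa mE /andP[u0 uv] hi0 low1.
have v0 : 0 < v by exact: lt_trans uv.
have [e e0 he] : exists2 e : R, 0 < e & (1 + e) ^+ n <= v / u.
  by apply: expr_near1; rewrite ltr_pdivlMr // mul1r.
pose N := (Num.bound ((l - l') / l' / e)).+1.
have N0 : (0 : R) < N%:R by rewrite ltr0n.
have hN : (l - l') / N%:R <= e * l'.
  have : (l - l') / l' / e <= N%:R.
    rewrite ltW //; apply: lt_le_trans (archi_boundP _) _.
      by rewrite divr_ge0 ?(ltW e0) // divr_ge0 ?(ltW l'0) // subr_ge0.
    by rewrite ler_nat.
  by rewrite !ler_pdivrMr // => h; rewrite mulrAC (mulrC e).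
pose b k i := a' i + k%:R / N%:R * (a i - a' i).
pose r k := l' + k%:R / N%:R * (l - l').
have r0 k : 0 < r k by rewrite ltr_pwDl // mulr_ge0 ?divr_ge0 // subr_ge0.
have b0 : b 0%N = a' by apply/funext => i; rewrite /b mul0r mul0r addr0.
have rr0 : r 0%N = l' by rewrite /r mul0r mul0r addr0.
have bN : b N = a by apply/funext => i; rewrite /b divff ?gt_eqF // mul1r addrC subrK.
have rN : r N = l by rewrite /r divff ?gt_eqF // mul1r addrC subrK.
have nest j k : (j <= k)%N -> ccube (b j) (r j) `<=` ccube (b k) (r k).
  move=> jk; apply: ccube_sub => i; have [a1 a2] := aa i.
  have h : j%:R / N%:R <= k%:R / N%:R :> R by rewrite ler_pM2r ?invr_gt0 // ler_nat.
  by rewrite /b /r; split; nra.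
pose hi k := (v%:E * mu (ccube (b k) (r k)) < mu (E `&` ccube (b k) (r k)))%E.
have [k [kN' hk hk1]] : exists k, [/\ (k < N)%N, hi k & ~~ hi k.+1].
  apply: contrapT => hn.
  have : forall k, (k <= N)%N -> hi k.
    elim=> [_|k IH kN']; first by rewrite /hi b0 rr0.
    apply: contrapT => /negP nh; apply: hn; exists k; split=> //.
    by apply: IH; exact: ltnW.
  by move=> /(_ N (leqnn N)); rewrite /hi bN rN ltNge low1.
exists (b k.+1), (r k.+1); split.
- exact: r0.
- by rewrite -b0 -rr0; exact: nest.
- by rewrite -bN -rN; exact: nest.
- apply: (@le_lt_trans _ _ (v%:E * mu (ccube (b k) (r k)))%E).
    rewrite !mu_ccube // -!EFinM lee_fin.
    apply: (@le_trans _ _ (u * (v / u * r k ^+ n))); last first.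
      by rewrite mulrA mulrCA divff ?gt_eqF // mulr1.
    rewrite ler_pM2l //.
    apply: le_trans (_ : ((1 + e) * r k) ^+ n <= _); last first.
      by rewrite exprMn ler_wpM2r // exprn_ge0 // ltW.
    apply: lerXn2r; rewrite ?nnegrE; [exact: ltW|by rewrite mulr_ge0 // ltW // addr_gt0|].
    have -> : r k.+1 = r k + (l - l') / N%:R.
      by rewrite /r -natr1; field; rewrite gt_eqF.
    rewrite [leRHS]mulrDl mul1r lerD2l; apply: (le_trans hN).
    rewrite ler_pM2l // /r lerDl mulr_ge0 ?divr_ge0 // subr_ge0 //.
  apply: (lt_le_trans hk); apply: mu_le; [exact: measurableI|exact: measurableI|].
  by apply: setIS; exact: nest.
- by rewrite leNgt.
Qed.

(** The origins of the 2^n cubes obtained by halving the sides of a cube. *)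
Definition corner a l (k : {ffun 'I_n -> 'I_2}) : 'I_n -> R :=
  fun i => a i + l / 2 * (k i)%:R.

Lemma icell_ocube a l (k : {ffun 'I_n -> 'I_2}) : 0 < l ->
  icell a l k = ocube (corner a l k) (l / 2).
Proof.
move=> l0; apply/seteqP; split=> x h i; have := h i.
  by move/eqP; rewrite level_eq.
by move=> hi; apply/eqP; rewrite level_eq.
Qed.

Lemma level_corner a l (k : {ffun 'I_n -> 'I_2}) N x i : 0 < l ->
  level (corner a l k) (l / 2) N x i = level a l N.*2 x i - Posz (N * k i)%N.
Proof.
move=> l0; rewrite /level /corner.
rewrite [X in Num.floor X](_ : _ = N.*2%:R * (co x i - a i) / l + (- Posz (N * k i)%N)%:~R); last first.
  by rewrite mulrNz -pmulrn natrM -muln2 natrM; field; rewrite gt_eqF.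
by rewrite floorDrz ?intr_int // intrKfloor.
Qed.

Lemma cell_corner a l (k : {ffun 'I_n -> 'I_2}) N x : 0 < l ->
  cell (corner a l k) (l / 2) N x = cell a l N.*2 x.
Proof.
move=> l0; apply/seteqP; split=> y h i; have := h i; rewrite !level_corner //.
  by move/addIr.
by move=> ->.
Qed.

Lemma corner_sub a l (k : {ffun 'I_n -> 'I_2}) i : 0 < l ->
  a i <= corner a l k i /\ corner a l k i + l / 2 <= a i + l.
Proof.
move=> l0; rewrite /corner; have : (k i : nat)%:R <= 1 :> R.
  by rewrite -[1]/(1%:R) ler_nat -ltnS ltn_ord.
have : 0 <= (k i : nat)%:R :> R by [].
by move=> h1 h2; split; nra.
Qed.

Lemma cell1 a l x : 0 < l -> ocube a l x -> cell a l 1 x = ocube a l.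
Proof.
move=> l0 /(level1 a x l0) Qx; apply/seteqP; split=> y.
  by move=> h; apply/(level1 a y l0) => i; rewrite h Qx.
by move=> /(level1 a y l0) h i; rewrite h Qx.
Qed.

Section growth.
Variables (E G : set T) (u v : R).
Hypotheses (mE : measurable E) (mG : measurable G) (uv : 0 < u < v) (v1 : v < 1).
Hypothesis hG : forall a l, 0 < l ->
  (u%:E * mu (ccube a l) < mu (E `&` ccube a l))%E -> mu (ccube a l `\` G) = 0%E.

Let v0 : 0 < v. Proof. by case/andP: uv; exact: lt_trans. Qed.

(* The inequality of [growth] is first proved for the part of E in the
   cells of density above v of the first m dyadic levels; by [density] these
   cells exhaust E up to a null set as m grows. *)
Let dense a l N x := (v%:E * mu (cell a l N x) < mu (E `&` cell a l N x))%E.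

Let dense_union a l m : set T := ocube a l `&`
  [set x | exists2 j, (j <= m)%N & dense a l (2 ^ j) x].

Let cell_eq a l N x y : cell a l N x y -> cell a l N y = cell a l N x.
Proof. by move=> xy; apply/seteqP; split=> z h i; rewrite h xy. Qed.

Let measurable_dense_union a l m : 0 < l -> measurable (dense_union a l m).
Proof.
move=> l0; apply: measurableI => //.
rewrite (_ : [set x | _] = \bigcup_(j in [set j | (j <= m)%N]) [set x | dense a l (2 ^ j) x]).
  apply: bigcup_measurable => j _.
  apply: (@measurable_adapted a l (2 ^ j)); rewrite ?expn_gt0 // => x y xy.
  by rewrite /= /dense (@cell_eq a l _ x y).
by apply/seteqP; split=> x [j]; exists j.
Qed.

(** By induction on m.  If E has density above v in one of the 2^n halves of the
    cube, [interpolate] gives a cube between this half and the whole, of density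
    between u and v: up to a null set it is contained in G, and it has at least
    the fraction 1 - v of its measure, itself at least 2^(-n) times that of the
    whole cube, outside E.  If there is no such half, the induction hypothesis
    applies to each of them. *)
Let growth_dense m a l : 0 < l ->
  (mu (E `&` ccube a l) <= v%:E * mu (ccube a l))%E ->
  (((1 - v) / 2 ^+ n)%:E * mu (E `&` dense_union a l m) <= mu ((G `\` E) `&` ocube a l))%E.
Proof.
have c0 : 0 <= (1 - v) / 2 ^+ n.
  by rewrite divr_ge0 ?exprn_ge0 // subr_ge0 ltW.
elim: m a l => [|m IH] a l l0 low.
  rewrite (_ : _ `&` _ = set0) ?measure0 ?mule0 //.
  rewrite -subset0 => x [_ [Qx [j]]]; rewrite leqn0 => /eqP ->.
  rewrite /dense expn0.
  by rewrite cell1 // -mu_ccubeI // ltNge mu_ocube // -(mu_ccube a l0) low.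
have mGE : measurable (G `\` E) by exact: measurableD.
have mH := measurable_dense_union a m.+1 l0.
have l20 : 0 < l / 2 by rewrite divr_gt0.
have [[k hk]|nk] := pselect (exists k : {ffun 'I_n -> 'I_2},
   (v%:E * mu (ccube (corner a l k) (l / 2)) < mu (E `&` ccube (corner a l k) (l / 2)))%E).
  have l2 : l / 2 <= l by lra.
  have [b [r [r0 kR Ra dR lowR]]] := interpolate l20 l2
     (fun i => corner_sub a k i l0) mE uv hk low.
  have GR := hG r0 dR.
  rewrite -mu_ccubeI //.
  apply: (@le_trans _ _ (mu (ccube b r `\` E))); last first.
    apply: (@le_trans _ _ (mu (((G `\` E) `&` ccube a l) `|` (ccube b r `\` G)))).
      apply: mu_le; [exact: measurableD| |].
        by apply: measurableU; [exact: measurableI|exact: measurableD].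
      move=> x [bx nEx]; have [Gx|nGx] := pselect (G x); last by right.
      by left; split=> //; exact: Ra.
    apply: (le_trans (mu_leU _ _ _)); [exact: measurableI|exact: measurableD|].
    by rewrite GR adde0.
  have fR := mu_ccube_fin b r0.
  have mER : measurable (E `&` ccube b r) by exact: measurableI.
  rewrite (_ : _ `\` _ = ccube b r `\` (E `&` ccube b r)); last first.
    by rewrite setDIr setDv setU0.
  rewrite mu_setD //.
  apply: (@le_trans _ _ ((1 - v)%:E * mu (ccube b r))%E); last first.
    rewrite EFinB muleBl ?fin_num_adde_defr //; last by rewrite mu_ccube.
    by rewrite mul1e leeB.
  apply: (@le_trans _ _ (((1 - v) / 2 ^+ n)%:E * mu (ocube a l))%E).
    rewrite lee_wpmul2l ?lee_fin //; apply: mu_le => //; first exact: measurableI.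
    by move=> x [_ []].
  apply: (@le_trans _ _ ((1 - v)%:E * mu (ccube (corner a l k) (l / 2)))%E).
    rewrite mu_ccube // mu_ocube // -!EFinM lee_fin expr_div_n.
    by rewrite mulrAC mulrA.
  by rewrite lee_wpmul2l ?lee_fin ?subr_ge0 ?(ltW v1) //; apply: mu_le.
rewrite (_ : _ `&` _ = (E `&` dense_union a l m.+1) `&` ocube a l); last first.
  by apply/esym/setIidl => x [_ []].
rewrite (mu_ocube_icell a l0 (ltn0Sn 1)) //; last exact: measurableI.
rewrite (mu_ocube_icell a l0 (ltn0Sn 1)) //.
rewrite ge0_mule_fsumr; last by move=> ?.
apply: lee_fsum; first exact: finite_finset.
move=> k _; rewrite icell_ocube //.
have lowk : (mu (E `&` ccube (corner a l k) (l / 2)) <= v%:E * mu (ccube (corner a l k) (l / 2)))%E.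
  by rewrite leNgt; apply/negP => ?; apply: nk; exists k.
apply: le_trans (IH _ _ l20 lowk).
rewrite lee_wpmul2l ?lee_fin //; apply: mu_le.
- by apply: measurableI => //; exact: measurableI.
- by apply: measurableI => //; exact: measurable_dense_union.
move=> x [[Ex [Qx [[|j] jm dj]]] kx]; split=> //; split=> //.
  exfalso; move: dj; rewrite /dense expn0 cell1 //.
  by rewrite -mu_ccubeI // ltNge mu_ocube // -(mu_ccube a l0) low.
by exists j => //; rewrite /dense cell_corner // -mul2n -expnS.
Qed.

(** Almost all of E in the cube lies in G, by [density] applied to the part
    outside G, and [growth_dense] provides in G a further set disjoint from E. *)
Lemma growth a l : 0 < l ->
  (mu (E `&` ccube a l) <= v%:E * mu (ccube a l))%E ->
  ((1 + (1 - v) / 2 ^+ n)%:E * mu (E `&` ccube a l) <= mu (G `&` ccube a l))%E.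
Proof.
move=> l0 low.
have c0 : 0 < (1 - v) / 2 ^+ n.
  by rewrite divr_gt0 ?exprn_gt0 // subr_gt0.
set c := (1 - v) / 2 ^+ n in c0 *.
have fQ := mu_ocube_fin a l0.
have mGE : measurable (G `\` E) by exact: measurableD.
have mH m := measurable_dense_union a m l0.
have mHU : measurable (\bigcup_m dense_union a l m) by exact: bigcup_measurable.
have mEQ : measurable (E `&` ocube a l) by exact: measurableI.
have N0 m : (0 < 2 ^ m)%N by rewrite expn_gt0.
have u0 : 0 < u by case/andP: uv.
have uv' : u < v by case/andP: uv.
have E2 : mu ((E `&` ocube a l) `\` \bigcup_m dense_union a l m) = 0%E.
  apply/eqP; rewrite -measure_le0 leNgt; apply/negP => pos.
  have vv : 0 <= v < 1 by rewrite ltW.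
  have E2Q : (E `&` ocube a l) `\` \bigcup_m dense_union a l m `<=` ocube a l.
    by move=> x [[]].
  have mE2 : measurable ((E `&` ocube a l) `\` \bigcup_m dense_union a l m).
    exact: measurableD.
  have [m [x [Qx dx]]] := density l0 vv mE2 E2Q pos.
  have mc : measurable (cell a l (2 ^ m) x) by rewrite cellE.
  have dx' : dense a l (2 ^ m) x.
    apply: (lt_le_trans dx); apply: mu_le; [exact: measurableI|exact: measurableI|].
    by apply: setSI => y [[]].
  move: dx; rewrite ltNge => /negP; apply.
  rewrite (_ : _ `&` _ = set0) ?measure0 ?mule_ge0 ?lee_fin ?(ltW v0) //.
  rewrite -subset0 => y [[[Ey Qy] nH] xy]; apply: nH; exists m => //; split=> //.
  by exists m => //; rewrite /dense (cell_eq xy).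
have E1 : mu ((E `&` ocube a l) `\` G) = 0%E.
  apply/eqP; rewrite -measure_le0 leNgt; apply/negP => pos.
  have uu : 0 <= u < 1 by rewrite ltW //= (lt_trans uv').
  have mE1 : measurable ((E `&` ocube a l) `\` G) by exact: measurableD.
  have E1Q : (E `&` ocube a l) `\` G `<=` ocube a l by move=> x [[]].
  have [m [x [Qx]]] := density l0 uu mE1 E1Q pos.
  rewrite cellE //; set b := (b in ocube b _); set r := l / _.
  have r0 : 0 < r by rewrite divr_gt0 // ltr0n.
  move=> dx; move: (dx); rewrite ltNge => /negP; apply.
  suff -> : mu (((E `&` ocube a l) `\` G) `&` ocube b r) = 0%E.
    by rewrite mule_ge0 // lee_fin ltW.
  have hb : (u%:E * mu (ccube b r) < mu (E `&` ccube b r))%E -> (mu (((E `&` ocube a l) `\` G) `&` ocube b r) <= 0)%E.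
    move=> /(hG r0) <-; apply: mu_le; [exact: measurableI|exact: measurableD|].
    by move=> y [[_ nGy] by_]; split=> //; exact: ocube_sub_ccube.
  apply/eqP; rewrite -measure_le0; apply: hb.
  rewrite mu_ccubeI // mu_ccube // -(mu_ocube b r0); apply: (lt_le_trans dx).
  apply: mu_le; [exact: measurableI|exact: measurableI|].
  by apply: setSI => y [[]].
have lim : (c%:E * mu (E `&` ocube a l) <= mu ((G `\` E) `&` ocube a l))%E.
  have -> : mu (E `&` ocube a l) = mu (E `&` \bigcup_m dense_union a l m).
    apply/eqP; rewrite eq_le; apply/andP; split; last first.
      apply: mu_le => //; first exact: measurableI.
      by move=> x [Ex [m _ [Qx _]]].
    apply: (@le_trans _ _ (mu ((E `&` \bigcup_m dense_union a l m) `|`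
        ((E `&` ocube a l) `\` \bigcup_m dense_union a l m)))).
      apply: mu_le => //.
        by apply: measurableU; [exact: measurableI|exact: measurableD].
      move=> x [Ex Qx]; have [?|?] := pselect ((\bigcup_m dense_union a l m) x).
        by left.
      by right.
    apply: (le_trans (mu_leU _ _ _)); [exact: measurableI|exact: measurableD|].
    by rewrite E2 adde0.
  rewrite setI_bigcupr muleC -lee_pdivlMr //.
  have cv : (mu \o (fun m => E `&` dense_union a l m)) @ \oo -->
      mu (\bigcup_m (E `&` dense_union a l m)).
    apply: nondecreasing_cvg_mu.
    - by move=> m; exact: measurableI.
    - by apply: bigcup_measurable => m _; exact: measurableI.
    - move=> p q pq; apply/subsetPset => x [Ex [Qx [j jp dj]]]; split=> //; split=> //.
      by exists j => //; exact: leq_trans pq.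
  rewrite -(cvg_lim _ cv) //; apply: lime_le; first exact: (cvgP _ cv).
  apply: nearW => m /=; rewrite lee_pdivlMr // muleC; exact: growth_dense.
have mGQ : measurable ((G `\` E) `&` ocube a l) by exact: measurableI.
have mEGQ : measurable (E `&` ocube a l `&` G) by exact: measurableI.
rewrite mu_ccubeI // mu_ccubeI //.
have EGE : mu (E `&` ocube a l) = mu (E `&` ocube a l `&` G).
  apply/eqP; rewrite eq_le; apply/andP; split; last first.
    by apply: mu_le => //; exact: subIsetl.
  apply: (@le_trans _ _ (mu ((E `&` ocube a l `&` G) `|` ((E `&` ocube a l) `\` G)))).
    apply: mu_le => //; first by apply: measurableU => //; exact: measurableD.
    by move=> x Ex; have [?|?] := pselect (G x); [left|right].
  apply: (le_trans (mu_leU _ _ _)) => //; first exact: measurableD.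
  by rewrite E1 adde0.
rewrite EFinD muleDl ?ge0_adde_def ?inE ?lee_fin ?(ltW c0) //.
rewrite mul1e addeC.
apply: (@le_trans _ _ (mu ((G `\` E) `&` ocube a l) + mu (E `&` ocube a l `&` G))%E).
  by apply: leeD; [exact: lim|rewrite -EGE].
rewrite -mu_setU //; last first.
  by rewrite -subset0 => x [[[_ nE] _] [[]]].
apply: mu_le; [exact: measurableU|exact: measurableI|].
  by move=> x [[[Gx _] Qx]|[[_ Qx] Gx]].
rewrite ge0_fin_numE //; apply: le_lt_trans fQ; exact: mu_le.
Qed.

End growth.

(** Enlarging a cube slightly makes its corner and side rational; measurability of
    the maximal function and the final passage to the limit rest on this. *)
Lemma ccube_rat_basis : exists q : nat -> set T,
  (forall j, exists a l, 0 < l /\ q j = ccube a l) /\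
  forall a l (c : R), 0 < l -> 1 < c -> exists j,
    ccube a l `<=` q j /\ (mu (q j) <= c%:E * mu (ccube a l))%E.
Proof.
pose I : countType := ({ffun 'I_n -> rat} * rat)%type.
pose q (j : nat) : set T := if @unpickle I j is Some p then
   if 0 < p.2 then ccube (fun i => ratr (p.1 i)) (ratr p.2) else ccube (cst 0) 1
   else ccube (cst 0) 1.
exists q; split.
  move=> j; rewrite /q; case: unpickle => [[p r] /=|]; last by exists (cst 0), 1.
  case: ifPn => [r0|_]; last by exists (cst 0), 1.
  by exists (fun i => ratr (p i)), (ratr r); rewrite ltr0q.
move=> a l c l0 c1.
have [e e0 he] := expr_near1 n c1.
have [r rP] : exists r : rat, ratr r \in `](l * (1 + e / 2)), (l * (1 + e))[.
  have : l * (1 + e / 2) < l * (1 + e) by rewrite ltr_pM2l // ltrD2l; lra.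
  by move=> /rat_in_itvoo [r hr]; exists r.
have /choice[p pP] : forall i : 'I_n, exists p : rat, ratr p \in `](a i - l * (e / 2)), (a i)[.
  move=> i; have : a i - l * (e / 2) < a i by rewrite gtrBl mulr_gt0 // divr_gt0.
  by move=> /rat_in_itvoo [r' hr]; exists r'.
move: rP; rewrite in_itv /= => /andP[r1 r2].
have r0 : 0 < ratr r :> R by apply: lt_trans r1; rewrite mulr_gt0 // addr_gt0 // divr_gt0.
exists (@pickle I ([ffun i => p i], r)); rewrite /q pickleK /= -(ltr0q R) r0; split.
  apply: ccube_sub => i; rewrite ffunE; have := pP i; rewrite in_itv /= => /andP[h1 h2].
  split; first exact: ltW.
  by move: r1 h1; rewrite mulrDr mulr1 => r1 h1; lra.
rewrite !mu_ccube // -EFinM lee_fin.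
apply: (@le_trans _ _ ((l * (1 + e)) ^+ n)).
  by apply: lerXn2r; rewrite ?nnegrE ltW // mulr_gt0 // addr_gt0.
by rewrite exprMn mulrC ler_wpM2r // exprn_ge0 // ltW.
Qed.

End coordinates.

(** * Maximal operators over a basis of sets *)

Lemma measurable_ereal_sup (R : realType) d (T : measurableType d) (h : nat -> T -> \bar R) :
  (forall j, measurable_fun [set: T] (h j)) ->
  measurable_fun [set: T] (fun x => ereal_sup (range (h ^~ x))).
Proof.
move=> mh; rewrite (_ : (fun x => _) = fun x => esups (h ^~ x) 0).
  exact: measurable_fun_esups.
apply/funext => x; rewrite /esups /sdrop; congr ereal_sup.
by apply/seteqP; split=> _ [j _ <-]; exists j.
Qed.

Section basis.
Variables (R : realType) (d : measure_display) (T : measurableType d).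
Variables (mu : {measure set T -> \bar R}) (Q : set (set T)).

Implicit Types (f g : T -> R) (P : set T) (x : T).

Definition average (f : T -> R) (P : set T) : \bar R :=
  ((fine (mu P))^-1%:E * \int[mu]_(y in P) `|f y|%:E)%E.

Definition gmaximal (f : T -> R) (x : T) : \bar R :=
  ereal_sup [set average f P | P in [set P | Q P /\ P x]].

Definition grearr (f : T -> R) (t : \bar R) : \bar R :=
  ereal_inf [set alpha%:E | alpha in
    [set alpha : R | 0 < alpha /\ (mu [set x | (alpha < `|f x|)%R] <= t)%E]].

Definition gmedian (lambda : R) (f : T -> R) (x : T) : \bar R :=
  ereal_sup [set grearr (f \* \1_P) (lambda%:E * mu P)%E
    | P in [set P | Q P /\ P x]].

(** What the maximal operators use of the family of cubes; the last clause lets the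
    supremum over all cubes be computed on a sequence of them. *)
Record cube_basis : Prop := CubeBasis {
  basis_measurable : forall P, Q P -> measurable P ;
  basis_mu_gt0 : forall P, Q P -> (0 < mu P)%E ;
  basis_mu_lty : forall P, Q P -> (mu P < +oo)%E ;
  basis_cover : forall x, exists2 P, Q P & P x ;
  basis_countable : exists2 q : nat -> set T, (forall j, Q (q j)) &
    forall P (c : R), Q P -> 1 < c -> exists j,
      P `<=` q j /\ (mu (q j) <= c%:E * mu P)%E }.

Hypothesis hQ : cube_basis.

Lemma mu_fineK P : Q P -> mu P = (fine (mu P))%:E.
Proof. by move=> QP; rewrite fineK // ge0_fin_numE //; exact: basis_mu_lty. Qed.

Lemma fine_mu_gt0 P : Q P -> 0 < fine (mu P).
Proof. by move=> QP; rewrite -lte_fin -mu_fineK //; exact: basis_mu_gt0. Qed.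

Lemma measurable_abs (f : T -> R) D : measurable_fun D f ->
  measurable_fun D (fun x => `|f x|%:E : \bar R).
Proof. by move=> mf; apply/measurable_EFinP; exact: measurableT_comp. Qed.

Lemma average_ge0 f P : (0 <= average f P)%E.
Proof. by rewrite mule_ge0 ?lee_fin ?invr_ge0 ?fine_ge0 // integral_ge0. Qed.

Lemma le_average f g P : Q P -> measurable_fun [set: T] f -> measurable_fun [set: T] g ->
  (forall x, P x -> `|f x| <= `|g x|) -> (average f P <= average g P)%E.
Proof.
move=> QP mf mg fg; rewrite lee_wpmul2l ?lee_fin ?invr_ge0 ?fine_ge0 //.
apply: ge0_le_integral => //; first exact: basis_measurable.
- by apply: measurable_abs; exact: measurable_funTS.
- by apply: measurable_abs; exact: measurable_funTS.
Qed.

Lemma average_le_max f P x : Q P -> P x -> (average f P <= gmaximal f x)%E.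
Proof. by move=> QP Px; apply: ereal_sup_ubound; exists P. Qed.

Lemma gmaximal_ge0 f x : (0 <= gmaximal f x)%E.
Proof.
have [P QP Px] := basis_cover hQ x.
exact: le_trans (average_ge0 f P) (average_le_max _ QP Px).
Qed.

Lemma gmaximal_le f x (c : \bar R) : (forall P, Q P -> P x -> (average f P <= c)%E) ->
  (gmaximal f x <= c)%E.
Proof. by move=> h; apply: ge_ereal_sup => _ [P [QP Px] <-]; exact: h. Qed.

Lemma le_of_le_mul_gt1 (a s : \bar R) : (0 <= s)%E -> (0 <= a)%E ->
  (forall c : R, 1 < c -> (a <= c%:E * s)%E) -> (a <= s)%E.
Proof.
case: s => [s||] // s0; last by rewrite leey.
case: a => [a||] // a0 h; last by have := h 2 (ltr1n _ 2); rewrite leye_eq.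
rewrite lee_fin leNgt; apply/negP => sa.
have s0' : 0 <= s by [].
have hh c : 1 < c -> a <= c * s by move=> /h; rewrite -EFinM lee_fin.
have [s00|s00] := eqVneq s 0.
  have := hh 2 (ltr1n _ 2); rewrite s00 mulr0 => a0'.
  by move: sa; rewrite s00 ltNge a0'.
have sp : 0 < s by rewrite lt_neqAle eq_sym s00.
have := hh ((a + s) / (2 * s)).
rewrite ltr_pdivlMr ?mulr_gt0 // mul1r.
have -> : (a + s) / (2 * s) * s = (a + s) / 2 by field.
by move=> h1; suff : a <= (a + s) / 2; [lra|apply: h1; lra].
Qed.

(** Replacing P by a slightly larger member of the sequence loses only the factor
    c in the average, and c is arbitrarily close to 1. *)
Lemma gmaximalE (q : nat -> set T) f x : measurable_fun [set: T] f ->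
  (forall j, Q (q j)) ->
  (forall P (c : R), Q P -> 1 < c -> exists j,
      P `<=` q j /\ (mu (q j) <= c%:E * mu P)%E) ->
  gmaximal f x = ereal_sup (range (fun j => average f (q j) * (\1_(q j) x)%:E)%E).
Proof.
move=> mf Qq hq; apply/eqP; rewrite eq_le; apply/andP; split; last first.
  apply: ge_ereal_sup => _ [j _ <-]; rewrite indicE.
  have [/set_mem qx|_] := boolP (x \in q j); last by rewrite mule0 gmaximal_ge0.
  by rewrite mule1 average_le_max.
set S := ereal_sup _.
have S0 : (0 <= S)%E.
  apply: le_trans (_ : (average f (q 0%N) * (\1_(q 0%N) x)%:E <= _)%E).
    by rewrite mule_ge0 ?average_ge0 // lee_fin.
  by apply: ereal_sup_ubound; exists 0%N.
apply: gmaximal_le => P QP Px; apply: le_of_le_mul_gt1 => //; first exact: average_ge0.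
move=> c c1; have [j [Pq muq]] := hq P c QP c1.
apply: (@le_trans _ _ (c%:E * average f (q j))%E); last first.
  rewrite lee_wpmul2l //; first by rewrite lee_fin ltW // (lt_trans _ c1).
  by apply: ereal_sup_ubound; exists j => //; rewrite indicE mem_set ?mule1 //; exact: Pq.
rewrite /average muleA -EFinM; apply: lee_pmul.
- by rewrite lee_fin invr_ge0 fine_ge0.
- exact: integral_ge0.
- rewrite lee_fin; have p0 := fine_mu_gt0 QP; have q0 := fine_mu_gt0 (Qq j).
  move: muq; rewrite (mu_fineK (Qq j)) (mu_fineK QP) -EFinM lee_fin => h.
  by rewrite ler_pdivlMr // mulrC ler_pdivrMr.
- apply: ge0_subset_integral => //; [exact: basis_measurable|exact: basis_measurable|].
  by apply: measurable_abs; exact: measurable_funTS.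
Qed.

Lemma measurable_gmaximal f : measurable_fun [set: T] f ->
  measurable_fun [set: T] (gmaximal f).
Proof.
move=> mf; have [q Qq hq] := basis_countable hQ.
rewrite (_ : gmaximal f = fun x => ereal_sup (range (fun j => average f (q j) * (\1_(q j) x)%:E)%E)); last first.
  by apply/funext => x; exact: gmaximalE.
apply: measurable_ereal_sup => j.
apply: emeasurable_funM; first exact: measurable_cst.
by apply/measurable_EFinP; apply: measurable_indic; exact: basis_measurable.
Qed.

End basis.

(** * Function spaces and their dual norm *)

Section function_space.
Variables (R : realType) (d : measure_display) (T : measurableType d).
Variables (mu : {measure set T -> \bar R}) (C : set (T -> R)) (N : (T -> R) -> R).
Implicit Types (f g b : T -> R) (h : T -> \bar R).

(** The axioms of a Banach function space over an arbitrary measure space, with the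
    carrier C and the norm N as separate parameters. *)
Record function_space : Prop := FunctionSpace {
  fs_measurable : forall f, C f -> measurable_fun [set: T] f ;
  fs0 : C (cst 0) ;
  fsD : forall f g, C f -> C g -> C (f \+ g) ;
  fsZ : forall (a : R) f, C f -> C (a \*: f) ;
  fs_ge0 : forall f, C f -> 0 <= N f ;
  fs_eq0 : forall f, C f -> N f = 0 -> {ae mu, forall x, f x = 0} ;
  fs_normZ : forall (a : R) f, C f -> N (a \*: f) = `|a| * N f ;
  fs_normD : forall f g, C f -> C g -> N (f \+ g) <= N f + N g ;
  fs_ideal : forall f g, C f -> measurable_fun [set: T] g ->
    {ae mu, forall x, `|g x| <= `|f x|} -> C g /\ N g <= N f ;
  fs_fatou : forall (u : (T -> R)^nat) f,
    (forall j, C (u j)) -> measurable_fun [set: T] f ->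
    {ae mu, forall x, (forall j, 0 <= u j x) /\
      nondecreasing_seq (u ^~ x) /\ u ^~ x @ \oo --> f x} ->
    has_ubound (range (fun j => N (u j))) ->
    C f /\ N f = sup (range (fun j => N (u j))) ;
  fs_saturation : forall E : set T, measurable E -> (0 < mu E)%E ->
    exists F : set T, [/\ measurable F, F `<=` E, (0 < mu F)%E &
      C (\1_F : T -> R)] }.

Hypothesis hX : function_space.

Definition unit_ball : set (T -> R) := [set b | C b /\ N b <= 1].

(** The norm of the associate space, extended to nonnegative functions with
    values in [0, +oo] so that it is countably subadditive for arbitrary series
    ([dual_norm_sum]). *)
Definition dual_norm h : \bar R :=
  ereal_sup [set (\int[mu]_x (h x * `|b x|%:E))%E | b in unit_ball].

Lemma norm0 : N (cst 0) = 0.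
Proof.
have -> : cst 0 = 0 \*: cst 0 :> (T -> R) by apply/funext => x /=; rewrite scaler0.
by rewrite fs_normZ // ?normr0 ?mul0r //; exact: fs0.
Qed.

Lemma unit_ball0 : unit_ball (cst 0).
Proof. by split; [exact: fs0|rewrite norm0]. Qed.

Lemma unit_ball_measurable b : unit_ball b -> measurable_fun [set: T] b.
Proof. by move=> [Cb _]; exact: (fs_measurable hX). Qed.

Lemma integral_le_dual_norm h b : unit_ball b ->
  (\int[mu]_x (h x * `|b x|%:E) <= dual_norm h)%E.
Proof. by move=> hb; apply: ereal_sup_ubound; exists b. Qed.

Lemma dual_norm_le h (c : \bar R) :
  (forall b, unit_ball b -> (\int[mu]_x (h x * `|b x|%:E) <= c)%E) -> (dual_norm h <= c)%E.
Proof. by move=> H; apply: ge_ereal_sup => _ [b hb <-]; exact: H. Qed.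

Lemma dual_norm_ge0 h : (0 <= dual_norm h)%E.
Proof.
apply: le_trans (integral_le_dual_norm h unit_ball0).
by rewrite integral0_eq // => x _; rewrite normr0 mule0.
Qed.

Lemma measurable_pairing h b : measurable_fun [set: T] h -> measurable_fun [set: T] b ->
  measurable_fun [set: T] (fun x => h x * `|b x|%:E)%E.
Proof. by move=> mh mb; apply: emeasurable_funM => //; exact: measurable_abs. Qed.

Lemma dual_norm_ae h1 h2 : measurable_fun [set: T] h1 -> measurable_fun [set: T] h2 ->
  (forall x, 0 <= h1 x)%E -> (forall x, 0 <= h2 x)%E ->
  {ae mu, forall x, (h1 x <= h2 x)%E} -> (dual_norm h1 <= dual_norm h2)%E.
Proof.
move=> m1 m2 h10 h20 h12; apply: dual_norm_le => b hb.
apply: le_trans (integral_le_dual_norm h2 hb).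
have mb := unit_ball_measurable hb.
apply: ae_ge0_le_integral => //.
- by move=> x _; rewrite mule_ge0.
- exact: measurable_pairing.
- by move=> x _; rewrite mule_ge0.
- exact: measurable_pairing.
by apply: filterS h12 => x hx _; rewrite lee_wpmul2r.
Qed.

Lemma dual_norm_sum (h : nat -> T -> \bar R) : (forall k, measurable_fun [set: T] (h k)) ->
  (forall k x, 0 <= h k x)%E ->
  (dual_norm (fun x => \sum_(0 <= k <oo) h k x) <= \sum_(0 <= k <oo) dual_norm (h k))%E.
Proof.
move=> mh h0; apply: dual_norm_le => b hb; have mb := unit_ball_measurable hb.
rewrite (eq_integral (fun x => \sum_(0 <= k <oo) (h k x * `|b x|%:E)))%E; last first.
  move=> x _; rewrite muleC -nneseriesZl //; apply: eq_eseriesr => k _.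
  by rewrite muleC.
rewrite integral_nneseries //.
- apply: lee_nneseries; first by move=> k _ _; apply: integral_ge0 => x _; rewrite mule_ge0.
  by move=> k _; exact: integral_le_dual_norm.
- by move=> k; exact: measurable_pairing.
- by move=> k x _; rewrite mule_ge0.
Qed.

Lemma dual_normZ h (c : R) : measurable_fun [set: T] h -> (forall x, 0 <= h x)%E -> 0 <= c ->
  (dual_norm (fun x => c%:E * h x) <= c%:E * dual_norm h)%E.
Proof.
move=> mh h0 c0; apply: dual_norm_le => b hb; have mb := unit_ball_measurable hb.
under eq_integral do rewrite -muleA.
rewrite ge0_integralZl_EFin //.
- by rewrite lee_wpmul2l ?lee_fin // integral_le_dual_norm.
- by move=> x _; rewrite mule_ge0.
- exact: measurable_pairing.
Qed.

(** If h were infinite on a set of positive measure, saturation would give a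
    multiple of an indicator in the unit ball of C supported in it, and pairing h
    with it would give +oo. *)
Lemma dual_norm_lty_ae h : measurable_fun [set: T] h -> (forall x, 0 <= h x)%E ->
  (dual_norm h < +oo)%E -> {ae mu, forall x, (h x < +oo)%E}.
Proof.
move=> mh h0 hfin; pose E := [set x | h x = +oo%E].
have mE : measurable E.
  by rewrite -[E]setTI; exact: (mh measurableT _ (emeasurable_set1 _)).
exists E; split => //; last first.
  by move=> x /= /negP; rewrite -leNgt leye_eq => /eqP.
apply/eqP; rewrite eq_le measure_ge0 andbT leNgt; apply/negP => E0.
have [F [mF FE F0 CF]] := fs_saturation hX mE E0.
pose s := (N (\1_F) + 1)^-1.
have N0 := fs_ge0 hX CF.
have s0 : 0 < s by rewrite invr_gt0 ltr_wpDl.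
pose b : T -> R := s \*: (\1_F : T -> R).
have bF : unit_ball b.
  split; first exact: fsZ.
  rewrite fs_normZ // gtr0_norm // mulrC ler_pdivrMr ?ltr_wpDl //; lra.
have := integral_le_dual_norm h bF; apply/negP; rewrite -ltNge.
apply: lt_le_trans hfin _.
have mb := unit_ball_measurable bF.
apply: (@le_trans _ _ (\int[mu]_(x in F) (h x * `|b x|%:E))%E); last first.
  apply: ge0_subset_integral => //; first exact: measurable_pairing.
  by move=> x _; rewrite mule_ge0.
rewrite (eq_integral (cst +oo%E)); last first.
  move=> x /[dup] xF /set_mem/FE /= ->.
  by rewrite /b /= indicE xF /= [_ *: _]mulr1 gtr0_norm // gt0_mulye // lte_fin.
by rewrite integral_cst // gt0_mulye.
Qed.

End function_space.

(** * Iterated medians *)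

Lemma le_nneseries_term (R : realType) (u : nat -> \bar R) j :
  (forall k, 0 <= u k)%E -> (u j <= \sum_(0 <= k <oo) u k)%E.
Proof.
move=> u0; apply: le_trans (@nneseries_lim_ge _ u xpredT 0 j.+1 _) => //.
by rewrite big_nat_recr //= leeDr // sume_ge0.
Qed.

Section median.
Variables (R : realType) (d : measure_display) (T : measurableType d).
Variables (mu : {measure set T -> \bar R}) (Q : set (set T)).
Hypothesis hQ : cube_basis mu Q.
Implicit Types (f g b : T -> R) (P : set T) (x : T).

Definition superlevel f (a : R) : set T := [set x | a < `|f x|].

Lemma measurable_superlevel f a : measurable_fun [set: T] f -> measurable (superlevel f a).
Proof.
by move=> mf; apply: (measurable_above (f := fun x => `|f x|)); exact: measurableT_comp.
Qed.

Lemma le_superlevel f (a c : R) : a <= c -> superlevel f c `<=` superlevel f a.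
Proof. by move=> ac x; exact: le_lt_trans. Qed.

(** By continuity from below, the level set at a slightly higher level than a still
    has density above lambda in P, which makes the inequality strict. *)
Lemma median_gt lambda f P x (a : R) : measurable_fun [set: T] f -> Q P -> P x ->
  (lambda%:E * mu P < mu (superlevel f a `&` P))%E -> (a%:E < gmedian mu Q lambda f x)%E.
Proof.
move=> mf QP Px big; have mP := basis_measurable hQ QP.
pose F j := superlevel f (a + j.+1%:R^-1) `&` P.
have mF j : measurable (F j) by apply: measurableI => //; exact: measurable_superlevel.
have FU : \bigcup_j F j = superlevel f a `&` P.
  apply/seteqP; split=> [y [j _ [fy Py]]|y [fy Py]].
    by split=> //; apply: le_superlevel fy; rewrite lerDl.
  have h : 0 < `|f y| - a by rewrite subr_gt0.
  exists (Num.bound (`|f y| - a)^-1) => //; split=> //.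
  rewrite /superlevel /= -ltrBrDl -[ltRHS]invrK ltf_pV2 ?posrE ?invr_gt0 //.
  apply: lt_le_trans (archi_boundP _) _; first by rewrite invr_ge0 ltW.
  by rewrite ler_nat.
have nd : {homo F : m n / (m <= n)%N >-> (m <= n)%O}.
  move=> p q pq; apply/subsetPset => y [fy Py]; split=> //; apply: le_superlevel fy.
  by rewrite lerD2l lef_pV2 ?posrE // ler_nat ltnS.
have mU : measurable (\bigcup_j F j) by exact: bigcup_measurable.
have [j hj] : exists j, (lambda%:E * mu P < mu (F j))%E.
  apply: contrapT => nj.
  have /(cvg_lim _) cv := nondecreasing_cvg_mu (mu := mu) mF mU nd.
  move: big; apply/negP; rewrite -leNgt -FU -cv //.
  apply: lime_le; first exact: (cvgP _ (nondecreasing_cvg_mu (mu := mu) mF mU nd)).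
  apply: nearW => j; rewrite leNgt; apply/negP => hj; apply: nj; by exists j.
apply: (@lt_le_trans _ _ (a + j.+1%:R^-1)%:E); first by rewrite lte_fin ltrDl.
apply: (@le_trans _ _ (grearr mu (f \* \1_P) (lambda%:E * mu P)%E)); last first.
  by apply: ereal_sup_ubound; exists P.
apply: le_ereal_inf_tmp => _ [c [c0 cP] <-]; rewrite lee_fin leNgt; apply/negP => cj.
move: hj; apply/negP; rewrite -leNgt; apply: le_trans cP.
have mfP : measurable_fun [set: T] (f \* \1_P).
  by apply: measurable_funM => //; exact: measurable_indic.
apply: mu_le => //; first exact: (measurable_superlevel c mfP).
move=> y [fy Py] /=; rewrite indicE mem_set // mulr1.
exact: lt_trans fy.
Qed.

Section iteration.
(* [growthQ] is the conclusion of [growth] for the family Q, and h is a sequence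
   of representatives of the iterated medians of h 0. *)
Variables (lambda v theta : R).
Hypotheses (lambda_v : 0 < lambda < v) (v1 : v < 1) (theta1 : 1 < theta).
Hypothesis growthQ : forall E G, measurable E -> measurable G ->
  (forall P, Q P -> (lambda%:E * mu P < mu (E `&` P))%E -> mu (P `\` G) = 0%E) ->
  forall P, Q P -> (mu (E `&` P) <= v%:E * mu P)%E ->
  (theta%:E * mu (E `&` P) <= mu (G `&` P))%E.

Variable h : nat -> T -> R.
Hypothesis mh : forall k, measurable_fun [set: T] (h k).
Hypothesis hh : forall k, {ae mu, forall x, gmedian mu Q lambda (h k) x = (h k.+1 x)%:E}.

Lemma superlevel_absorbs k P a : Q P ->
  (lambda%:E * mu P < mu (superlevel (h k) a `&` P))%E ->
  mu (P `\` superlevel (h k.+1) a) = 0%E.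
Proof.
move=> QP big; have mP := basis_measurable hQ QP.
have mD : measurable (P `\` superlevel (h k.+1) a).
  by apply: measurableD => //; exact: measurable_superlevel.
apply/eqP; rewrite -measure_le0; have [Z [mZ Z0 hZ]] := hh k.
rewrite -Z0; apply: mu_le => // x [Px nx]; apply: hZ => /= hx; apply: nx.
have := median_gt (mh k) QP Px big; rewrite hx lte_fin => h1.
by apply: (lt_le_trans h1); exact: ler_norm.
Qed.

(** While the level set of h j has density at most v in P, its measure in P grows
    by the factor theta at each step; once the density exceeds v, it exceeds
    lambda, the next level set fills P and all later ones do so too. *)
Lemma median_iter_gt k P a x : Q P -> P x ->
  (mu P < (theta ^+ k)%:E * mu (superlevel (h 0%N) a `&` P))%E ->
  (a%:E < gmedian mu Q lambda (h k) x)%E.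
Proof.
move=> QP Px big; have mP := basis_measurable hQ QP.
have mE j : measurable (superlevel (h j) a) by exact: measurable_superlevel.
have mEP j : measurable (superlevel (h j) a `&` P) by exact: measurableI.
have P0 := fine_mu_gt0 hQ QP; have PE := mu_fineK hQ QP.
have th0 : 0 < theta by exact: lt_trans theta1.
have key j : (v%:E * mu P < mu (superlevel (h j) a `&` P))%E \/
    ((theta ^+ j)%:E * mu (superlevel (h 0%N) a `&` P) <= mu (superlevel (h j) a `&` P))%E.
  elim: j => [|j IH]; first by right; rewrite expr0 mul1e.
  have [hi|lo] := ltP (v%:E * mu P)%E (mu (superlevel (h j) a `&` P)).
    left; have lav : (lambda%:E * mu P < mu (superlevel (h j) a `&` P))%E.
      apply: le_lt_trans hi; rewrite lee_wpmul2r // lee_fin ltW //.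
      by case/andP: lambda_v.
    have := superlevel_absorbs QP lav => null.
    apply: (@lt_le_trans _ _ (mu P)); first by rewrite PE -EFinM lte_fin gtr_pMl.
    apply: (@le_trans _ _ (mu ((superlevel (h j.+1) a `&` P) `|` (P `\` superlevel (h j.+1) a)))).
      apply: mu_le => //; first by apply: measurableU => //; exact: measurableD.
      by move=> y Py; have [?|?] := pselect (superlevel (h j.+1) a y); [left|right].
    apply: (le_trans (mu_leU _ _ _)) => //; first exact: measurableD.
    by rewrite null adde0.
  right; case: IH => [hi|IH]; first by move: lo; rewrite leNgt hi.
  have gr := growthQ (mE j) (mE j.+1) (fun P QP => @superlevel_absorbs j P a QP) QP lo.
  apply: le_trans gr; rewrite exprS EFinM -muleA lee_wpmul2l // lee_fin ltW //.
apply: median_gt (mh k) QP Px _.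
have [hi|lo] := key k.
  apply: le_lt_trans hi; rewrite lee_wpmul2r // lee_fin ltW //.
  by case/andP: lambda_v.
have := lt_le_trans big lo; rewrite ltNge => /negP; case.
by apply: mu_le => //; exact: subIsetr.
Qed.

(** By [median_iter_gt] the set where |f| exceeds s k has at most the proportion
    theta^(-k) of P, where s k is the p-th root of |h k.+1| at the fixed point x.
    Outside a null set, |f y| <= s 0 or |f y| exceeds s j and is at most s j.+1
    for some j; integrating the sum of the s k.+1 over the sets where |f|
    exceeds s k gives the series. *)
Lemma average_le_medians (p : nat) f P x : (0 < p)%N -> measurable_fun [set: T] f ->
  (forall y, h 0%N y = `|f y| ^+ p) -> Q P -> P x ->
  (forall k, gmedian mu Q lambda (h k) x = (h k.+1 x)%:E) ->
  forall s : nat -> R, (forall k, 0 <= s k /\ `|h k.+1 x| = s k ^+ p) ->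
  (average mu f P <= (s 0%N)%:E + \sum_(0 <= k <oo) (theta^-1 ^+ k * s k.+1)%:E)%E.
Proof.
move=> p0 mf h0 QP Px hx s hs; have mP := basis_measurable hQ QP.
have P0 := fine_mu_gt0 hQ QP; have PE := mu_fineK hQ QP.
have th0 : 0 < theta by exact: lt_trans theta1.
have s0 k : 0 <= s k by have [] := hs k.
have mE k : measurable (superlevel f (s k)) by exact: measurable_superlevel.
have mEP k : measurable (superlevel f (s k) `&` P) by exact: measurableI.
have small k : (mu (superlevel f (s k) `&` P) <= (theta^-1 ^+ k)%:E * mu P)%E.
  have : ~~ (`|h k.+1 x|%:E < gmedian mu Q lambda (h k) x)%E.
    by rewrite hx lte_fin -leNgt ler_norm.
  have : superlevel (h 0%N) `|h k.+1 x| = superlevel f (s k).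
    have [_ ->] := hs k; apply/seteqP; split=> y; rewrite /superlevel /= h0 normrX normr_id;
    by rewrite ltr_pXn2r ?nnegrE.
  move=> EE; apply: contraNT; rewrite -ltNge => big; apply: median_iter_gt QP Px _.
  rewrite EE; have E1 : (1 = (theta ^+ k)%:E * (theta^-1 ^+ k)%:E :> \bar R)%E.
    by rewrite -EFinM -exprMn divff ?expr1n // gt_eqF.
  rewrite -[ltLHS]mul1e E1 -muleA lte_pmul2l // lte_fin exprn_gt0 //.
pose w (k : nat) (y : T) : \bar R := ((s k.+1)%:E * (\1_(superlevel f (s k)) y)%:E)%E.
have w0 k y : (0 <= w k y)%E by rewrite mule_ge0 // lee_fin.
have mw k : measurable_fun [set: T] (w k).
  apply: emeasurable_funM; first exact: measurable_cst.
  by apply/measurable_EFinP; exact: measurable_indic.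
(* The points that lie above all the s k form a null set. *)
pose Z := \bigcap_k (superlevel f (s k) `&` P).
have mZ : measurable Z by exact: bigcapT_measurable.
have Z0 : mu Z = 0%E.
  apply/eqP; rewrite -measure_le0.
  have le k : (mu Z <= (theta^-1 ^+ k)%:E * mu P)%E.
    by apply: le_trans (small k); apply: mu_le => // y; exact.
  have cv : (fun k => ((theta^-1 ^+ k)%:E * mu P)%E) @ \oo --> 0%E.
    rewrite PE; under eq_fun do rewrite -EFinM.
    apply: cvg_EFin; first exact: nearW.
    rewrite -[X in _ --> X](mul0r (fine (mu P))); apply: cvgMl.
    by apply: cvg_expr; rewrite ger0_norm ?invf_lt1 // invr_ge0 ltW.
  rewrite -(cvg_lim _ cv) //; apply: lime_ge; first exact: (cvgP _ cv).
  by apply: nearW => k; exact: le.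
have pw : {ae mu, forall y, P y -> (`|f y|%:E <= (s 0%N)%:E + \sum_(0 <= k <oo) w k y)%E}.
  exists Z; split=> // y /= hy k _; apply: contrapT => nk; apply: hy => Py.
  have nk' : exists k, ~~ (s k < `|f y|).
    by exists k; apply/negP => sk; apply: nk.
  have := ex_minnP nk' => -[[|j] nj minj].
    apply: (@le_trans _ _ (s 0%N)%:E); first by rewrite lee_fin leNgt.
    by rewrite leeDl // nneseries_ge0.
  have sj : s j < `|f y|.
    by apply: contraT => sj; have := minj j sj; rewrite ltnn.
  apply: (@le_trans _ _ (w j y)).
    by rewrite /w indicE mem_set // mule1 lee_fin leNgt.
  apply: (@le_trans _ _ (\sum_(0 <= k <oo) w k y)%E).
    by apply: le_nneseries_term.
  by rewrite leeDr // lee_fin.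
rewrite /average lee_pdivrMl //.
have mS : measurable_fun P (fun y => \sum_(0 <= k <oo) w k y)%E.
  by apply: ge0_emeasurable_sum => // k _; exact: measurable_funTS.
apply: (@le_trans _ _ (\int[mu]_(y in P) ((s 0%N)%:E + \sum_(0 <= k <oo) w k y))%E).
  apply: ae_ge0_le_integral => //.
  - by apply: measurable_abs; exact: measurable_funTS.
  - by move=> y _; rewrite adde_ge0 ?lee_fin // nneseries_ge0.
  - by apply: emeasurable_funD.
rewrite ge0_integralD //; last 2 first.
- by move=> y _; rewrite lee_fin.
- by move=> y _; rewrite nneseries_ge0.
rewrite (integral_cst mu mP) integral_nneseries //; last by move=> k; exact: measurable_funTS.
have t0 k : 0 <= theta^-1 ^+ k * s k.+1.
  by rewrite mulr_ge0 // exprn_ge0 // invr_ge0 ltW.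
rewrite ge0_muleDr ?lee_fin //; last by rewrite nneseries_ge0 // => k _ _; rewrite lee_fin.
apply: leeD; first by rewrite PE muleC.
rewrite -nneseriesZl; last by move=> k _; rewrite lee_fin.
apply: lee_nneseries; first by move=> k _ _; apply: integral_ge0.
move=> k _; rewrite /w ge0_integralZl_EFin //; last first.
  by apply/measurable_EFinP; exact: measurable_indic.
rewrite integral_indic //.
apply: (@le_trans _ _ ((s k.+1)%:E * ((theta^-1 ^+ k)%:E * mu P))%E).
  by rewrite lee_wpmul2l // lee_fin.
by rewrite PE -!EFinM lee_fin mulrCA mulrA mulrC.
Qed.

End iteration.
End median.

(** * From medians to the maximal operator *)

Section real_facts.
Variable R : realType.

Definition nroot (m : nat) (y : R) : R := y `^ m%:R^-1.

Lemma nroot_ge0 m y : 0 <= nroot m y. Proof. exact: powR_ge0. Qed.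

Lemma nrootK m y : (0 < m)%N -> 0 <= y -> nroot m y ^+ m = y.
Proof.
move=> m0 y0; rewrite -powR_mulrn ?nroot_ge0 // /nroot -powRrM mulVf ?powRr1 //.
by rewrite pnatr_eq0 -lt0n.
Qed.

Lemma ler_nroot m x y : (0 < m)%N -> 0 <= x -> x ^+ m <= y -> x <= nroot m y.
Proof.
move=> m0 x0 xy; have y0 : 0 <= y by apply: le_trans xy; exact: exprn_ge0.
by rewrite -(@ler_pXn2r _ m) ?nnegrE ?nroot_ge0 // nrootK.
Qed.

Lemma geometric_eseries_le (r c : R) : 0 < r < 1 -> 0 <= c ->
  (\sum_(0 <= k <oo) (r ^+ k * c)%:E <= (c / (1 - r))%:E)%E.
Proof.
move=> /andP[r0 r1] c0; apply: lime_le.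
  by apply: is_cvg_nneseries => k _ _; rewrite lee_fin mulr_ge0 // exprn_ge0 // ltW.
apply: nearW => k; rewrite sumEFin lee_fin.
apply: le_trans (@geometric_le_lim R k c r c0 r0 _); last by rewrite ger0_norm // ltW.
rewrite /series /=; apply: ler_sum => i _; by rewrite mulrC.
Qed.

(** Half of the geometric decay is spent on the bound of each term, the other half
    on the summation; hence the coefficients r^(2k) against a bound that only
    knows r^k s k. *)
Lemma series_pow_bound (m : nat) (r S : R) (s : nat -> R) : (0 < m)%N -> 0 < r < 1 ->
  (forall k, 0 <= s k) -> (forall k, (r ^+ k * s k) ^+ m <= S) ->
  ((s 0%N)%:E + \sum_(0 <= k <oo) ((r ^+ 2) ^+ k * s k.+1)%:E <=
   ((1 + r^-1 / (1 - r)) * nroot m S)%:E)%E.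
Proof.
move=> m0 r01 s0 hS; have /andP[r0 r1] := r01.
have b k : r ^+ k * s k <= nroot m S.
  by apply: ler_nroot => //; rewrite mulr_ge0 // exprn_ge0 // ltW.
rewrite mulrDl mul1r EFinD; apply: leeD.
  by have := b 0%N; rewrite expr0 mul1r lee_fin.
have -> : r^-1 / (1 - r) * nroot m S = (r^-1 * nroot m S) / (1 - r) by ring.
have c0 : 0 <= r^-1 * nroot m S by rewrite mulr_ge0 ?nroot_ge0 // invr_ge0 ltW.
apply: le_trans (geometric_eseries_le r01 c0).
apply: lee_nneseries.
  by move=> k _ _; rewrite lee_fin mulr_ge0 // exprn_ge0 // exprn_ge0 // ltW.
move=> k _; rewrite lee_fin -exprM mul2n -addnn exprD -mulrA ler_pM2l ?exprn_gt0 //.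
by rewrite ler_pdivlMl // mulrA -exprS.
Qed.

Lemma exists_expr_lt (r e : R) : 0 < r < 1 -> 0 < e -> exists m0 : nat,
  forall m, (m0 <= m)%N -> r ^+ m <= e.
Proof.
move=> /andP[r0 r1] e0.
have cv : (fun k => r ^+ k) @ \oo --> (0 : R) by apply: cvg_expr; rewrite ger0_norm // ltW.
have /cvgrPdist_le /(_ e e0) [m0 _ hm0] := cv.
exists m0 => m /hm0 /=; by rewrite sub0r normrN ger0_norm // exprn_ge0 // ltW.
Qed.

End real_facts.

Section convexification.
Variables (R : realType) (d : measure_display) (T : measurableType d).
Variables (mu : {measure set T -> \bar R}) (Q : set (set T)).
Variables (C : set (T -> R)) (N : (T -> R) -> R).
Hypotheses (hQ : cube_basis mu Q) (hX : function_space mu C N).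
Implicit Types (f g b : T -> R) (P : set T) (x : T).

Local Notation dnorm := (dual_norm mu C N).

Lemma measurable_absX f m : measurable_fun [set: T] f ->
  measurable_fun [set: T] (fun x => (`|f x| ^+ m)%:E : \bar R).
Proof.
move=> mf; apply/measurable_EFinP; apply: measurable_funX.
exact: measurableT_comp.
Qed.

Variables (lambda v theta : R).
Hypotheses (lambda_v : 0 < lambda < v) (v1 : v < 1) (theta1 : 1 < theta).
Hypothesis growthQ : forall E G, measurable E -> measurable G ->
  (forall P, Q P -> (lambda%:E * mu P < mu (E `&` P))%E -> mu (P `\` G) = 0%E) ->
  forall P, Q P -> (mu (E `&` P) <= v%:E * mu P)%E ->
  (theta%:E * mu (E `&` P) <= mu (G `&` P))%E.

(** The series S of the r^(m k) |h (k+1)|, with r^2 = 1 / theta and h k the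
    iterated medians of |f|^m, has dual norm at most 2 A times that of |f|^m as
    soon as r^m <= 1 / (2 A).  By [average_le_medians] and [series_pow_bound] its
    m-th root dominates all averages of f. *)
Lemma maximal_of_median (A : R) : 0 < A ->
  (forall f, measurable_fun [set: T] f -> (dnorm (fun x => `|f x|%:E) < +oo)%E ->
    exists g, [/\ measurable_fun [set: T] g,
      {ae mu, forall x, gmedian mu Q lambda f x = (g x)%:E} &
      (dnorm (fun x => `|g x|%:E) <= A%:E * dnorm (fun x => `|f x|%:E))%E]) ->
  exists m0 : nat, forall m, (m0 <= m)%N -> (0 < m)%N -> exists2 B : R, 0 < B &
    forall f, measurable_fun [set: T] f -> (dnorm (fun x => (`|f x| ^+ m)%:E) < +oo)%E ->
    exists g, [/\ measurable_fun [set: T] g,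
      {ae mu, forall x, gmaximal mu Q f x = (g x)%:E} &
      (dnorm (fun x => (`|g x| ^+ m)%:E) <=
        (B ^+ m)%:E * dnorm (fun x => (`|f x| ^+ m)%:E))%E].
Proof.
move=> A0 hmed.
have th0 : 0 < theta by exact: lt_trans theta1.
pose r := Num.sqrt theta^-1.
have r0 : 0 < r by rewrite sqrtr_gt0 invr_gt0.
have r2 : r ^+ 2 = theta^-1 by rewrite sqr_sqrtr // invr_ge0 ltW.
have r1 : r < 1.
  rewrite -(@ltr_pXn2r _ 2) ?nnegrE // ?ltW // r2 expr1n invf_lt1 //.
have r01 : 0 < r < 1 by rewrite r0.
have [m0 hm0] : exists m0 : nat, forall m, (m0 <= m)%N -> r ^+ m <= (2 * A)^-1.
  by apply: exists_expr_lt => //; rewrite invr_gt0 mulr_gt0.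
exists m0 => m mm0 mpos.
pose K := 1 + r^-1 / (1 - r).
have K0 : 1 <= K by rewrite lerDl divr_ge0 ?invr_ge0 ?ltW // subr_gt0.
exists (K * (2 * A + 1)); first by rewrite mulr_gt0 //; lra.
move=> f mf fD.
pose good f' := measurable_fun [set: T] f' /\ (dnorm (fun x => `|f' x|%:E) < +oo)%E.
(* A choice of representatives is needed to iterate the median maximal operator. *)
have /choice[F hF] : forall f', exists g, good f' -> [/\ measurable_fun [set: T] g,
      {ae mu, forall x, gmedian mu Q lambda f' x = (g x)%:E} &
      (dnorm (fun x => `|g x|%:E) <= A%:E * dnorm (fun x => `|f' x|%:E))%E].
  move=> f'; have [[mf' fin]|ng] := pselect (good f').
    by have [g hg] := hmed _ mf' fin; exists g.
  by exists f' => /ng.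
pose h k := iter k F (fun x => `|f x| ^+ m).
pose D := dnorm (fun x => (`|f x| ^+ m)%:E).
have D0 : (0 <= D)%E by exact: dual_norm_ge0.
have h0E : dnorm (fun x => `|h 0%N x|%:E) = D.
  by congr (dnorm _); apply/funext => x; rewrite /h /= normrX normr_id.
have hgood k : good (h k) /\ (dnorm (fun x => `|h k x|%:E) <= (A ^+ k)%:E * D)%E.
  elim: k => [|k [gk Dk]].
    split; last by rewrite h0E expr0 mul1e.
    split; last by rewrite h0E.
    apply/measurable_EFinP; exact: measurable_absX.
  have [m1 _ n1] := hF _ gk.
  have n2 : (dnorm (fun x => `|h k.+1 x|%:E) <= (A ^+ k.+1)%:E * D)%E.
    apply: (le_trans n1); rewrite exprS EFinM -muleA lee_wpmul2l // lee_fin ltW //.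
  split; last exact: n2.
  split; [exact: m1|apply: (le_lt_trans n2)].
  by rewrite lte_mul_pinfty // lee_fin exprn_ge0 // ltW.
have mh k : measurable_fun [set: T] (h k) by have [[]] := hgood k.
have hh k : {ae mu, forall x, gmedian mu Q lambda (h k) x = (h k.+1 x)%:E}.
  by have [gk _] := hgood k; have [] := hF _ gk.
pose S x := (\sum_(0 <= k <oo) ((r ^+ m) ^+ k)%:E * `|h k.+1 x|%:E)%E.
have c0 k : 0 <= (r ^+ m) ^+ k by rewrite !exprn_ge0 // ltW.
have mS : measurable_fun [set: T] S.
  apply: ge0_emeasurable_sum; first by move=> k x _ _; rewrite mule_ge0 // lee_fin.
  by move=> k _; apply: emeasurable_funM => //; exact: measurable_abs.
have S0 x : (0 <= S x)%E.
  by apply: nneseries_ge0 => k _ _; rewrite mule_ge0 // lee_fin.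
have DS : (dnorm S <= (2 * A)%:E * D)%E.
  have fD' : D \is a fin_num by rewrite ge0_fin_numE.
  have Dr0 : 0 <= fine D by exact: fine_ge0.
  apply: (le_trans (dual_norm_sum hX _ _)).
  - by move=> k; apply: emeasurable_funM => //; exact: measurable_abs.
  - by move=> k x; rewrite mule_ge0 // lee_fin.
  rewrite -(fineK fD') -EFinM.
  (* The k-th term is compared with 2 A D / 2^(k+1). *)
  apply: le_trans (epsilon_trick0 xpredT _); last first.
    by rewrite mulr_ge0 // mulr_ge0 // ltW.
  apply: lee_nneseries; first by move=> k _ _; exact: dual_norm_ge0.
  move=> k _; apply: (le_trans (dual_normZ hX _ _ _)) => //; first exact: measurable_abs.
  apply: (@le_trans _ _ (((r ^+ m) ^+ k)%:E * ((A ^+ k.+1)%:E * D))%E).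
    by rewrite lee_wpmul2l ?lee_fin //; have [] := hgood k.+1.
  rewrite -(fineK fD') -!EFinM lee_fin.
  rewrite exprS mulrA [in leRHS]natrX exprS.
  have -> : 2 * A * fine D / (2 * 2 ^+ k) = (A * fine D) * (2^-1) ^+ k.
    by rewrite exprVn; field; rewrite expf_neq0 // pnatr_eq0.
  have -> : (r ^+ m) ^+ k * (A * A ^+ k) * fine D = (A * fine D) * (r ^+ m * A) ^+ k.
    by rewrite [in RHS]exprMn; ring.
  rewrite ler_wpM2l //; first by rewrite mulr_ge0 // ltW.
  apply: lerXn2r; rewrite ?nnegrE //; first by rewrite mulr_ge0 ?exprn_ge0 // ltW.
  rewrite -ler_pdivlMr //; apply: le_trans (hm0 _ mm0) _.
  by rewrite invfM.
have Sfin : {ae mu, forall x, (S x < +oo)%E}.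
  apply: (dual_norm_lty_ae hX) => //; apply: le_lt_trans DS _.
  by rewrite lte_mul_pinfty // lee_fin mulr_ge0 // ltW.
pose g x := fine (gmaximal mu Q f x).
have mg : measurable_fun [set: T] g.
  by apply: measurableT_comp => //; exact: measurable_gmaximal.
have key : {ae mu, forall x, gmaximal mu Q f x = (g x)%:E /\ (`|g x| ^+ m)%:E <= (K ^+ m)%:E * S x}%E.
  have hhA : {ae mu, forall x, forall k, gmedian mu Q lambda (h k) x = (h k.+1 x)%:E}.
    exact: ae_foralln.
  apply: filterS2 hhA Sfin => x hx Sx.
  have SxE : S x = (fine (S x))%:E by rewrite fineK // ge0_fin_numE.
  have Mx : (gmaximal mu Q f x <= (K * nroot m (fine (S x)))%:E)%E.
    apply: gmaximal_le => P QP Px.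
    pose s k := nroot m `|h k.+1 x|.
    have s0 k : 0 <= s k by exact: nroot_ge0.
    apply: le_trans (average_le_medians hQ lambda_v v1 theta1 growthQ mh hh mpos mf _ QP Px hx (s := s) _) _.
    - by [].
    - by move=> k; split=> //; rewrite nrootK.
    rewrite -r2; apply: series_pow_bound => // k.
    rewrite exprMn nrootK // exprAC -lee_fin -SxE EFinM.
    by apply: (@le_nneseries_term _ (fun k => ((r ^+ m) ^+ k)%:E * `|h k.+1 x|%:E)%E) => j; rewrite mule_ge0 // lee_fin.
  have gE : gmaximal mu Q f x = (g x)%:E.
    rewrite /g fineK // ge0_fin_numE; last exact: gmaximal_ge0.
    by apply: le_lt_trans Mx _; exact: ltry.
  split=> //; have g0 : 0 <= g x by rewrite -lee_fin -gE; exact: gmaximal_ge0.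
  rewrite SxE -EFinM lee_fin ger0_norm // -[fine _](nrootK mpos) ?fine_ge0 // -exprMn.
  apply: lerXn2r; rewrite ?nnegrE ?mulr_ge0 ?nroot_ge0 //; first by lra.
  by rewrite -lee_fin -gE.
exists g; split=> //; first by apply: filterS key => x [].
have Km : 0 <= K ^+ m by apply: exprn_ge0; lra.
apply: (@le_trans _ _ (dnorm (fun x => (K ^+ m)%:E * S x)%E)).
  apply: dual_norm_ae => //.
  - exact: measurable_absX.
  - exact: emeasurable_funM.
  - by move=> x; rewrite mule_ge0.
  - by apply: filterS key => x [].
apply: (le_trans (dual_normZ hX mS S0 Km)).
rewrite exprMn EFinM -muleA lee_wpmul2l //; apply: (le_trans DS).
rewrite lee_wpmul2r // lee_fin; apply: (@le_trans _ _ (2 * A + 1)); first by lra.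
rewrite -[leLHS]expr1; apply: ler_weXn2l => //; lra.
Qed.

End convexification.

(** * A_1 weights with m-th power in the associate space *)

Section a1_weights.
Variables (R : realType) (d : measure_display) (T : measurableType d).
Variables (mu : {measure set T -> \bar R}) (Q : set (set T)).
Variables (C : set (T -> R)) (N : (T -> R) -> R).
Hypotheses (hQ : cube_basis mu Q) (hX : function_space mu C N).
Implicit Types (f g b u : T -> R) (P : set T) (x : T).

Local Notation dnorm := (dual_norm mu C N).

Variables (m : nat) (B : R).
Hypotheses (m_gt0 : (0 < m)%N) (B_gt0 : 0 < B).
Hypothesis hM : forall f, measurable_fun [set: T] f ->
  (dnorm (fun x => (`|f x| ^+ m)%:E) < +oo)%E ->
  exists g, [/\ measurable_fun [set: T] g,
      {ae mu, forall x, gmaximal mu Q f x = (g x)%:E} &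
      (dnorm (fun x => (`|g x| ^+ m)%:E) <=
        (B ^+ m)%:E * dnorm (fun x => (`|f x| ^+ m)%:E))%E].

(** The Rubio de Francia series v of the (4 B)^(-k) M^k (g^(1/m)).  Since M shifts
    the series, M v <= 4 B v, and the term k = 0 gives g <= v^m.  The dual
    norm is countably subadditive on the m-th powers, not on v: so v^m is
    compared with the series S of the m-th powers with ratio 2 B instead of 4 B,
    the spare factor 2^(-k) making the sum at most 2 S^(1/m). *)
Lemma a1_majorant g : measurable_fun [set: T] g -> (forall x, 0 <= g x) ->
  (dnorm (fun x => (g x)%:E) <= 1)%E ->
  exists v : T -> R, [/\ measurable_fun [set: T] v, (forall x, 0 <= v x),
    {ae mu, forall x, g x <= v x ^+ m},
    (dnorm (fun x => (v x ^+ m)%:E) <= (2 ^+ m.+1)%:E)%E &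
    {ae mu, forall x, (gmaximal mu Q v x <= (4 * B * v x)%:E)%E}].
Proof.
move=> mg g0 g1.
pose good f := measurable_fun [set: T] f /\ (dnorm (fun x => (`|f x| ^+ m)%:E) < +oo)%E.
have /choice[F hF] : forall f, exists g, good f -> [/\ measurable_fun [set: T] g,
      {ae mu, forall x, gmaximal mu Q f x = (g x)%:E} &
      (dnorm (fun x => (`|g x| ^+ m)%:E) <=
        (B ^+ m)%:E * dnorm (fun x => (`|f x| ^+ m)%:E))%E].
  move=> f; have [[mf fin]|ng] := pselect (good f).
    by have [g' hg] := hM mf fin; exists g'.
  by exists f => /ng.
pose h k := iter k F (fun x => nroot m (g x)).
have h0E : (fun x => (`|h 0%N x| ^+ m)%:E : \bar R) = (fun x => (g x)%:E).
  by apply/funext => x; rewrite /h /= ger0_norm ?nroot_ge0 // nrootK.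
have hgood k : good (h k) /\ (dnorm (fun x => (`|h k x| ^+ m)%:E) <= (B ^+ (m * k))%:E)%E.
  elim: k => [|k [gk Dk]].
    split; last by rewrite h0E muln0 expr0.
    split; last by rewrite h0E; apply: le_lt_trans g1 _; exact: ltry.
    rewrite /h /nroot /=.
    by apply: (@measurableT_comp _ _ _ _ _ _ (@powR R ^~ m%:R^-1) _ g) => //; exact: measurable_powR.
  have [m1 _ n1] := hF _ gk.
  have n2 : (dnorm (fun x => (`|h k.+1 x| ^+ m)%:E) <= (B ^+ (m * k.+1))%:E)%E.
    apply: (le_trans n1); rewrite mulnS exprD EFinM lee_wpmul2l // lee_fin exprn_ge0 // ltW //.
  split; last exact: n2.
  by split; [exact: m1|apply: (le_lt_trans n2); exact: ltry].
have mh k : measurable_fun [set: T] (h k) by have [[]] := hgood k.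
have hh k : {ae mu, forall x, gmaximal mu Q (h k) x = (h k.+1 x)%:E}.
  by have [gk _] := hgood k; have [] := hF _ gk.
have B2 : 0 < 2 * B by rewrite mulr_gt0.
have B4 : 0 < 4 * B by rewrite mulr_gt0.
pose S x := (\sum_(0 <= k <oo) (((2 * B) ^- (m * k))%:E * (`|h k x| ^+ m)%:E))%E.
have S0 x : (0 <= S x)%E.
  apply: nneseries_ge0 => k _ _; rewrite mule_ge0 // lee_fin ?exprn_ge0 //.
  by rewrite invr_ge0 exprn_ge0 // ltW.
have mS : measurable_fun [set: T] S.
  apply: ge0_emeasurable_sum.
    move=> k x _ _; rewrite mule_ge0 // lee_fin ?exprn_ge0 //.
    by rewrite invr_ge0 exprn_ge0 // ltW.
  by move=> k _; apply: emeasurable_funM => //; exact: measurable_absX.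
have DS : (dnorm S <= 2%:E)%E.
  apply: (le_trans (dual_norm_sum hX _ _)).
  - by move=> k; apply: emeasurable_funM => //; exact: measurable_absX.
  - move=> k x; rewrite mule_ge0 // lee_fin ?exprn_ge0 //.
    by rewrite invr_ge0 exprn_ge0 // ltW.
  apply: le_trans (epsilon_trick0 xpredT _); last by [].
  apply: lee_nneseries; first by move=> k _ _; exact: dual_norm_ge0.
  move=> k _; apply: (le_trans (dual_normZ hX _ _ _)) => //.
  - exact: measurable_absX.
  - by rewrite invr_ge0 exprn_ge0 // ltW.
  apply: (@le_trans _ _ (((2 * B) ^- (m * k))%:E * (B ^+ (m * k))%:E)%E).
    rewrite lee_wpmul2l ?lee_fin ?invr_ge0 ?exprn_ge0 ?(ltW B2) //.
    by have [] := hgood k.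
  rewrite -EFinM lee_fin exprMn natrX exprS.
  have -> : (2 ^+ (m * k) * B ^+ (m * k))^-1 * B ^+ (m * k) = (2 ^+ (m * k))^-1.
    by field; rewrite !expf_neq0 // gt_eqF.
  rewrite invfM mulrA divff // mul1r lef_pV2 ?posrE ?exprn_gt0 //.
  by apply: ler_weXn2l; [rewrite ler1n|rewrite leq_pmull].
have Sfin : {ae mu, forall x, (S x < +oo)%E}.
  by apply: (dual_norm_lty_ae hX) => //; apply: le_lt_trans DS _; exact: ltry.
pose a k : R := (4 * B) ^- k.
have a0 k : 0 <= a k by rewrite invr_ge0 exprn_ge0 // ltW.
pose V x := (\sum_(0 <= k <oo) ((a k)%:E * `|h k x|%:E))%E.
have aV0 k x : (0 <= (a k)%:E * `|h k x|%:E)%E by rewrite mule_ge0 // lee_fin.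
have V0 x : (0 <= V x)%E by exact: nneseries_ge0.
have mV : measurable_fun [set: T] V.
  apply: ge0_emeasurable_sum => // k _.
  by apply: emeasurable_funM => //; exact: measurable_abs.
have VS : {ae mu, forall x, V x < +oo /\ ((fine (V x)) ^+ m)%:E <= (2 ^+ m)%:E * S x}%E.
  apply: filterS Sfin => x Sx.
  have SxE : S x = (fine (S x))%:E by rewrite fineK // ge0_fin_numE.
  have hV : (V x <= (2 * nroot m (fine (S x)))%:E)%E.
    have -> : 2 * nroot m (fine (S x)) = nroot m (fine (S x)) / (1 - 2^-1) :> R by field.
    apply: le_trans (geometric_eseries_le _ _); [|lra|exact: nroot_ge0].
    apply: lee_nneseries => // k _; rewrite -EFinM lee_fin /a.
    have -> : (4 * B) ^- k * `|h k x| = 2^-1 ^+ k * ((2 * B) ^- k * `|h k x|).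
      have e4 : (4 * B)^-1 = 2^-1 * (2 * B)^-1 :> R by field; rewrite gt_eqF.
      by rewrite -!exprVn e4 exprMn mulrA.
    rewrite ler_wpM2l //; apply: ler_nroot => //.
      by rewrite mulr_ge0 // invr_ge0 exprn_ge0 // ltW.
    rewrite exprMn -exprVn -exprM mulnC exprVn -lee_fin -SxE EFinM.
    apply: (@le_nneseries_term _ (fun k => (((2 * B) ^- (m * k))%:E * (`|h k x| ^+ m)%:E)%E)) => j.
    rewrite mule_ge0 // lee_fin ?exprn_ge0 //.
    by rewrite invr_ge0 exprn_ge0 // ltW.
  have Vfin : (V x < +oo)%E by apply: le_lt_trans hV _; exact: ltry.
  split=> //; rewrite SxE -EFinM lee_fin -[fine (S x)](nrootK m_gt0) ?fine_ge0 // -exprMn.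
  apply: lerXn2r; rewrite ?nnegrE ?mulr_ge0 ?nroot_ge0 ?fine_ge0 //.
  by rewrite -lee_fin fineK // ge0_fin_numE.
pose v x := fine (V x).
have v0 x : 0 <= v x by exact: fine_ge0.
have mv : measurable_fun [set: T] v by apply: measurableT_comp.
have vV : {ae mu, forall x, (v x)%:E = V x}.
  by apply: filterS VS => x [Vx _]; rewrite /v fineK // ge0_fin_numE.
exists v; split=> //.
- apply: filterS vV => x vx; rewrite -[g x](nrootK m_gt0) //.
  apply: lerXn2r; rewrite ?nnegrE ?nroot_ge0 // -lee_fin vx.
  have := @le_nneseries_term _ (fun k => (a k)%:E * `|h k x|%:E)%E 0%N (fun k => aV0 k x).
  by rewrite /a expr0 invr1 mul1e /h /= ger0_norm ?nroot_ge0.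
- apply: (@le_trans _ _ (dnorm (fun x => (2 ^+ m)%:E * S x)%E)).
    apply: (dual_norm_ae hX).
    + by apply/measurable_EFinP; exact: measurable_funX.
    + exact: emeasurable_funM.
    + by move=> x; rewrite lee_fin exprn_ge0.
    + by move=> x; rewrite mule_ge0.
    + by apply: filterS VS => x [].
  apply: (le_trans (dual_normZ hX mS S0 _)); first by [].
  by rewrite exprSr EFinM lee_wpmul2l // lee_fin.
have hhA : {ae mu, forall x, forall k, gmaximal mu Q (h k) x = (h k.+1 x)%:E}.
  exact: ae_foralln.
have vV' := vV; apply: filterS2 hhA vV' => x hx vx; apply: gmaximal_le => P QP Px.
have mP := basis_measurable hQ QP.
have -> : average mu v P = (\sum_(0 <= k <oo) ((a k)%:E * average mu (h k) P))%E.
  rewrite /average (_ : (\int[mu]_(y in P) `|v y|%:E)%E = (\int[mu]_(y in P) V y)%E); last first.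
    apply: ge0_ae_eq_integral => //.
    - by apply: measurable_abs; exact: measurable_funTS.
    - exact: measurable_funTS.
    - by apply: filterS vV => y vy _; rewrite ger0_norm.
  rewrite /V integral_nneseries //; last first.
    by move=> k; apply: emeasurable_funM => //; apply: measurable_abs; exact: measurable_funTS.
  rewrite -nneseriesZl; last first.
    by move=> k _; apply: integral_ge0.
  apply: eq_eseriesr => k _; rewrite ge0_integralZl_EFin //.
    by rewrite muleCA.
  by apply: measurable_abs; exact: measurable_funTS.
rewrite EFinM vx /V -nneseriesZl; last by move=> k _.
pose w k := ((4 * B)%:E * ((a k)%:E * `|h k x|%:E))%E.
have w0 k : (0 <= w k)%E by rewrite mule_ge0 // lee_fin ltW.
apply: (@le_trans _ _ (\sum_(0 <= k <oo) w (k + 1)%N)%E).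
  apply: lee_nneseries; first by move=> k _ _; rewrite mule_ge0 ?lee_fin // average_ge0.
  move=> k _; rewrite /w addn1 (muleA (4 * B)%:E) -EFinM.
  have -> : 4 * B * a k.+1 = a k.
    by rewrite /a exprS; field; rewrite expf_neq0 gt_eqF.
  rewrite EFinM lee_wpmul2l ?lee_fin //.
  apply: (le_trans (average_le_max mu (h k) QP Px)).
  by rewrite hx lee_fin ler_norm.
rewrite nneseries_addn //.
rewrite [leRHS]nneseries_recl; [|by move=> k _; exact: (w0 k)|by []].
by rewrite leeDr //; exact: (w0 0%N).
Qed.
End a1_weights.

(** * Weighted maximal functions dominating averages *)

Section weights.
Variables (R : realType) (d : measure_display) (T : measurableType d).
Variables (mu : {measure set T -> \bar R}) (Q : set (set T)).
Variables (C : set (T -> R)) (N : (T -> R) -> R).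
Hypotheses (hQ : cube_basis mu Q) (hX : function_space mu C N).
Implicit Types (f g b u h v : T -> R) (P : set T) (x : T).

Local Notation dnorm := (dual_norm mu C N).

(** The norm of the associate space of the m-convexification of the dual of C: the
    supremum over all h with |h|^m in the unit ball of that dual. *)
Definition pow_dual_norm (m : nat) u : \bar R :=
  ereal_sup [set (\int[mu]_x `|u x * h x|%:E)%E | h in
    [set h : T -> R | measurable_fun [set: T] h /\ (dnorm (fun x => (`|h x| ^+ m)%:E) <= 1)%E]].

Lemma pow_dual_norm_ge m u h : measurable_fun [set: T] h ->
  (dnorm (fun x => (`|h x| ^+ m)%:E) <= 1)%E ->
  (\int[mu]_x `|u x * h x|%:E <= pow_dual_norm m u)%E.
Proof. by move=> mh h1; apply: ereal_sup_ubound; exists h. Qed.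

Lemma pow_dual_norm_ge0 m u : (0 <= pow_dual_norm m.+1 u)%E.
Proof.
apply: (@le_trans _ _ (\int[mu]_x `|(u x * 0)%R|%:E)%E).
  by apply: integral_ge0 => x _; rewrite lee_fin.
apply: (@pow_dual_norm_ge m.+1 u (cst 0)) => //.
apply: (@le_trans _ _ 0%E); last exact: lee01.
apply: dual_norm_le => b hb; rewrite integral0_eq // => x _.
by rewrite normr0 expr0n mul0e.
Qed.

Lemma integral_prod_le f g : C f -> N f <= 1 -> (forall x, 0 <= f x) ->
  (\int[mu]_x (g x * f x)%:E <= dnorm (fun x => (g x)%:E))%E.
Proof.
move=> Cf Nf f0.
rewrite (eq_integral (fun x => ((g x)%:E * `|f x|%:E)%E)); last first.
  by move=> x _; rewrite -EFinM ger0_norm.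
by apply: integral_le_dual_norm; split.
Qed.

(** By the inequality v^m |h| <= v^(m+1) + |h|^(m+1), which holds according to
    which of v and |h| is larger. *)
Lemma pow_dual_norm_weight (m : nat) f v : C f -> N f <= 1 -> (forall x, 0 <= f x) ->
  measurable_fun [set: T] v -> (forall x, 0 <= v x) ->
  (pow_dual_norm m.+1 (fun x => (f x * v x ^+ m)%R) <= dnorm (fun x => (v x ^+ m.+1)%:E) + 1)%E.
Proof.
move=> Cf Nf f0 mv v0; have mf := fs_measurable hX Cf.
apply: ge_ereal_sup => _ [h [mh h1] <-].
apply: (@le_trans _ _ (\int[mu]_x ((v x ^+ m.+1 * f x)%:E + (`|h x| ^+ m.+1 * f x)%:E))%E).
  apply: ge0_le_integral => //.
  - apply: measurable_abs; apply: measurable_funM => //; apply: measurable_funM => //.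
    exact: measurable_funX.
  - apply: emeasurable_funD; apply/measurable_EFinP; apply: measurable_funM => //.
      exact: measurable_funX.
    by apply: measurable_funX; exact: measurableT_comp.
  move=> x _; rewrite -EFinD lee_fin !normrM (ger0_norm (f0 x)) ger0_norm ?exprn_ge0 //.
  rewrite -mulrDl -mulrA mulrC ler_wpM2r //.
  have [hv|vh] := leP `|h x| (v x).
    rewrite exprSr; apply: (@le_trans _ _ (v x ^+ m * v x)).
      by rewrite ler_wpM2l // exprn_ge0.
    by rewrite lerDl exprn_ge0.
  rewrite [X in _ + X]exprSr; apply: (@le_trans _ _ (`|h x| ^+ m * `|h x|)).
    by rewrite ler_wpM2r // lerXn2r ?nnegrE // ltW.
  by rewrite lerDr exprn_ge0.
rewrite ge0_integralD //.
- apply: leeD; first exact: integral_prod_le.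
  by apply: le_trans h1; exact: integral_prod_le.
- by move=> x _; rewrite lee_fin mulr_ge0 // exprn_ge0.
- by apply/measurable_EFinP; apply: measurable_funM => //; exact: measurable_funX.
- by move=> x _; rewrite lee_fin mulr_ge0 // exprn_ge0.
- apply/measurable_EFinP; apply: measurable_funM => //; apply: measurable_funX.
  exact: measurableT_comp.
Qed.

(** The maximal function of v is finite at almost every point of P, and P has
    positive measure. *)
Lemma average_fin_num v P (c : R) : Q P -> measurable_fun [set: T] v ->
  {ae mu, forall x, (gmaximal mu Q v x <= (c * v x)%:E)%E} -> (average mu v P < +oo)%E.
Proof.
move=> QP mv [Z [mZ Z0 hZ]]; have mP := basis_measurable hQ QP.
have [x [Px nZ]] : exists x, P x /\ ~ Z x.
  apply: contrapT => h; have PZ : P `<=` Z.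
    by move=> x Px; apply: contrapT => nZ; apply: h; exists x.
  have := basis_mu_gt0 hQ QP; rewrite ltNge => /negP; apply.
  by rewrite -Z0; exact: mu_le.
have hx : (gmaximal mu Q v x <= (c * v x)%:E)%E.
  by apply: contrapT => hx; apply: nZ; exact: hZ.
apply: le_lt_trans (ltry (c * v x)); apply: le_trans hx; exact: average_le_max.
Qed.

Lemma integral_average v P : Q P -> (average mu v P < +oo)%E ->
  (\int[mu]_(y in P) `|v y|%:E)%E = (fine (average mu v P) * fine (mu P))%:E.
Proof.
move=> QP fin; have P0 := fine_mu_gt0 hQ QP.
rewrite EFinM fineK ?ge0_fin_numE ?average_ge0 // /average muleAC -EFinM.
by rewrite mulVf ?gt_eqF // mul1e.
Qed.

(** Chebyshev's inequality.  The condition 0 < v covers the case where the mean of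
    v vanishes. *)
Lemma a1_superlevel v P (K : R) : Q P -> measurable_fun [set: T] v -> (forall x, 0 <= v x) ->
  (average mu v P < +oo)%E -> 0 < K ->
  (mu (P `&` [set x | ((0 < v x) && (K * fine (average mu v P) < v x))%R]) <=
    (K^-1)%:E * mu P)%E.
Proof.
move=> QP mv v0 fin K0; have mP := basis_measurable hQ QP.
have P0 := fine_mu_gt0 hQ QP; have PE := mu_fineK hQ QP.
set w := fine (average mu v P).
have w0 : 0 <= w by rewrite fine_ge0 // average_ge0.
have mvP : measurable_fun P (EFin \o v).
  by apply/measurable_EFinP; exact: measurable_funTS.
have mB : measurable (P `&` [set x | ((0 < v x) && (K * w < v x))%R]).
  apply: measurableI => //.
  rewrite (_ : [set x | _] = [set x | 0 < v x] `&` [set x | K * w < v x]); last first.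
    by apply/seteqP; split=> x /=; [move/andP|move=> [? ?]; apply/andP].
  by apply: measurableI; exact: measurable_above.
have [w00|wn0] := eqVneq w 0.
  have I0 : (\int[mu]_(y in P) `|(EFin \o v) y|)%E = 0%E.
    by rewrite [LHS](integral_average QP fin) -/w w00 mul0r.
  have [Z [mZ Z0 hZ]] := (ae_eq_integral_abs mu mP mvP).1 I0.
  apply: (@le_trans _ _ 0%E); last by rewrite mule_ge0 // lee_fin invr_ge0 ltW.
  rewrite -Z0; apply: mu_le => // x [Px /andP[vx _]].
  by apply: hZ => /= /(_ Px) [] vx0; rewrite vx0 ltxx in vx.
have wp : 0 < w by rewrite lt_neqAle eq_sym wn0.
have Kw : 0 < K * w by rewrite mulr_gt0.
have := le_integral_abse mu mP mvP Kw.
rewrite [X in (_ <= X)%E -> _](integral_average QP fin) -/w => mk.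
have : ((K * w)%:E * mu (P `&` [set x | ((0 < v x) && (K * w < v x))%R]) <= (w * fine (mu P))%:E)%E.
  apply: le_trans mk; rewrite lee_wpmul2l // ?lee_fin ?(ltW Kw) //.
  have mC : measurable (P `&` [set x | ((K * w)%:E <= `|(EFin \o v) x|)%E]).
    have -> : [set x | ((K * w)%:E <= `|(EFin \o v) x|)%E] = v @^-1` `[(K * w), +oo[%classic.
      by apply/seteqP; split=> x; rewrite /= in_itv /= andbT lee_fin ger0_norm.
    by apply: measurableI => //; rewrite -[X in measurable X]setTI; exact: mv.
  apply: mu_le => // x [Px /andP[_ vx]]; split=> //=.
  by rewrite lee_fin ger0_norm // ltW.
rewrite -lee_pdivlMl // => h; apply: (le_trans h).
rewrite PE -!EFinM lee_fin le_eqVlt; apply/orP; left; apply/eqP; field.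
by rewrite !gt_eqF.
Qed.

(** F is M(f v^m) / v^m for the weight v of [a1_majorant].  Where 0 < v <= <v>_P / k,
    which holds on P up to a proportion k by [a1_superlevel], the A_1 inequality
    v >= <v>_P / (4 B) on P gives
    M(f v^m) >= (<v>_P / (4 B))^m <f>_P >= (k / (4 B))^m v^m <f>_P. *)
Lemma good_majorant (m : nat) (B B' k : R) : 0 < B -> 0 < B' -> 0 < k ->
  (forall f, measurable_fun [set: T] f ->
    (dnorm (fun x => (`|f x| ^+ m.+1)%:E) < +oo)%E ->
    exists g, [/\ measurable_fun [set: T] g,
      {ae mu, forall x, gmaximal mu Q f x = (g x)%:E} &
      (dnorm (fun x => (`|g x| ^+ m.+1)%:E) <=
        (B ^+ m.+1)%:E * dnorm (fun x => (`|f x| ^+ m.+1)%:E))%E]) ->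
  (forall u, measurable_fun [set: T] u -> (pow_dual_norm m.+1 u < +oo)%E ->
    exists W, [/\ measurable_fun [set: T] W,
      {ae mu, forall x, gmaximal mu Q u x = (W x)%:E} &
      (pow_dual_norm m.+1 W <= B'%:E * pow_dual_norm m.+1 u)%E]) ->
  exists c C0 : R, [/\ 0 < c, 0 < C0 & forall f (L : R), C f -> N f <= 1 ->
    (forall x, 0 <= f x <= L) -> forall g, measurable_fun [set: T] g ->
    (forall x, 0 <= g x) -> (dnorm (fun x => (g x)%:E) <= 1)%E ->
    exists F : T -> R, [/\ measurable_fun [set: T] F, (forall x, 0 <= F x),
      (\int[mu]_x (g x * F x)%:E <= C0%:E)%E &
      forall P, Q P -> (mu (P `&` [set x | (F x < c * fine (average mu f P))%R]) <= k%:E * mu P)%E]].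
Proof.
move=> B0 B'0 k0 hM hM'.
have B4 : 0 < 4 * B by rewrite mulr_gt0.
pose c := (4 * B / k) ^- m.
have c0 : 0 < c by rewrite invr_gt0 exprn_gt0 // divr_gt0.
pose C0 := 4 * (B' * (2 ^+ m.+2 + 1)).
have C00 : 0 < C0 by rewrite mulr_gt0 // mulr_gt0 // ltr_wpDl.
exists c, C0; split=> // f L Cf Nf fL g mg g0 g1.
have f0 x : 0 <= f x by have /andP[] := fL x.
have mf := fs_measurable hX Cf.
have [v [mv v0 gv vD vM]] := a1_majorant hQ hX (ltn0Sn m) B0 hM mg g0 g1.
have vmm : measurable_fun [set: T] (fun x => v x ^+ m) by exact: measurable_funX.
pose u x := f x * v x ^+ m.
have mu_ : measurable_fun [set: T] u by exact: measurable_funM.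
have u0 x : 0 <= u x by rewrite mulr_ge0 // exprn_ge0.
have uD : (pow_dual_norm m.+1 u <= (2 ^+ m.+2 + 1)%:E)%E.
  have h := pow_dual_norm_weight m Cf Nf f0 mv v0.
  apply: (le_trans h).
  by rewrite EFinD leeD2r.
have [W [mW uW WD]] := hM' _ mu_ (le_lt_trans uD (ltry _)).
have {}WD : (pow_dual_norm m.+1 W <= (B' * (2 ^+ m.+2 + 1))%:E)%E.
  by apply: (le_trans WD); rewrite EFinM lee_wpmul2l // lee_fin ltW.
pose Z := [set x | v x = 0].
have mZ : measurable Z.
  rewrite (_ : Z = v @^-1` [set 0]); last by [].
  by rewrite -[X in measurable X]setTI; exact: mv.
(* On the set Z where v, and hence almost everywhere g, vanishes, the quotient is replaced by a
   value that dominates every average c <f>_P. *)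
pose F x := L * c * \1_Z x + `|W x| * (v x ^+ m) `^ (-1).
have mF : measurable_fun [set: T] F.
  apply: measurable_funD.
    by apply: measurable_funM => //; exact: measurable_indic.
  apply: measurable_funM; first exact: measurableT_comp.
  by apply: (@measurableT_comp _ _ _ _ _ _ (@powR R ^~ (-1)) _ (fun x => v x ^+ m)) => //; exact: measurable_powR.
have FE x : 0 < v x -> F x = `|W x| / v x ^+ m.
  move=> vx; rewrite /F powR_inv1 ?exprn_ge0 // indicE memNset ?mulr0 ?add0r //.
  by move=> /= vx0; rewrite vx0 ltxx in vx.
have F0 x : 0 <= F x.
  rewrite addr_ge0 //; last by rewrite mulr_ge0 // powR_ge0.
  rewrite mulr_ge0 // mulr_ge0 ?(ltW c0) //.
  by have /andP[h1 h2] := fL x; exact: le_trans h1 h2.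
exists F; split=> //.
- apply: (@le_trans _ _ (\int[mu]_x (4%:E * `|W x * (v x / 4)|%:E))%E).
    apply: ae_ge0_le_integral => //.
    + by move=> x _; rewrite lee_fin mulr_ge0.
    + by apply/measurable_EFinP; exact: measurable_funM.
    + apply: emeasurable_funM => //; apply: measurable_abs.
      by apply: measurable_funM => //; exact: measurable_funM.
    apply: filterS gv => x gvx _; rewrite -EFinM lee_fin.
    (* The factor 1/4 brings v into the unit ball, since 2^(m+2) <= 4^(m+1). *)
    have -> : 4 * `|W x * (v x / 4)| = v x * `|W x|.
      by rewrite !normrM (ger0_norm (v0 x)) [`|4^-1|]ger0_norm //; field.
    have [vx|vx] := ltP 0 (v x); last first.
      have vx0 : v x = 0 by apply/eqP; rewrite eq_le vx v0.
      move: gvx; rewrite vx0 expr0n /= => gx.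
      have -> : g x = 0 by apply/eqP; rewrite eq_le gx g0.
      by rewrite !mul0r.
    rewrite FE //; apply: (@le_trans _ _ (v x ^+ m.+1 * (`|W x| / v x ^+ m))).
      by rewrite ler_wpM2r // divr_ge0 // exprn_ge0.
    rewrite exprS -mulrA [X in _ * X]mulrC divfK // expf_neq0 // gt_eqF //.
  rewrite ge0_integralZl_EFin //; last first.
    by apply: measurable_abs; apply: measurable_funM => //; exact: measurable_funM.
  rewrite /C0 [in leRHS]EFinM lee_wpmul2l //.
  apply: le_trans WD; apply: pow_dual_norm_ge; first exact: measurable_funM.
  rewrite (_ : (fun x => _) = (fun x => (4 ^- m.+1)%:E * (v x ^+ m.+1)%:E)%E); last first.
    by apply/funext => x; rewrite ger0_norm ?divr_ge0 // expr_div_n mulrC EFinM.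
  apply: (le_trans (dual_normZ hX _ _ _)).
  + by apply/measurable_EFinP; exact: measurable_funX.
  + by move=> x; rewrite lee_fin exprn_ge0.
  + by [].
  apply: (@le_trans _ _ ((4 ^- m.+1)%:E * (2 ^+ m.+2)%:E)%E).
    by rewrite lee_wpmul2l.
  rewrite -EFinM lee_fin mulrC ler_pdivrMr ?exprn_gt0 // mul1r.
  have -> : (4 : R) = 2 ^+ 2 by rewrite expr2; ring.
  by rewrite -exprM; apply: ler_weXn2l; [rewrite ler1n|rewrite mul2n -addnn addnS addSn !ltnS leq_addr].
move=> P QP; have mP := basis_measurable hQ QP.
have fin := average_fin_num QP mv vM.
set w := fine (average mu v P).
have w0 : 0 <= w by rewrite fine_ge0 // average_ge0.
have fP0 : 0 <= fine (average mu f P) by rewrite fine_ge0 // average_ge0.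
have P0 := fine_mu_gt0 hQ QP; have PE := mu_fineK hQ QP.
have fPL : (average mu f P <= L%:E)%E.
  rewrite /average lee_pdivrMl // -PE muleC -(integral_cst mu mP).
  apply: ge0_le_integral => //.
  - by apply: measurable_abs; exact: measurable_funTS.
  - by move=> x _; have /andP[_ h] := fL x; rewrite lee_fin ger0_norm.
have fPfin : average mu f P \is a fin_num.
  by rewrite ge0_fin_numE ?average_ge0 //; exact: le_lt_trans fPL (ltry _).
have [Z1 [mZ1 Z10 hZ1]] := vM.
have [Z2 [mZ2 Z20 hZ2]] := uW.
have k1 : 0 < k^-1 by rewrite invr_gt0.
have bd := a1_superlevel QP mv v0 fin k1.
rewrite invrK -/w in bd.
set E1 := P `&` _ in bd.
have mE1 : measurable E1.
  apply: measurableI => //.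
  rewrite (_ : [set x | _] = [set x | 0 < v x] `&` [set x | k^-1 * w < v x]); last first.
    by apply/seteqP; split=> x /=; [move/andP|move=> [? ?]; apply/andP].
  by apply: measurableI; exact: measurable_above.
apply: (@le_trans _ _ (mu (E1 `|` (Z1 `|` Z2)))); last first.
  apply: (le_trans (mu_leU _ _ _)) => //; first exact: measurableU.
  rewrite -[leRHS]adde0; apply: leeD => //.
  apply: (le_trans (mu_leU _ _ _)) => //.
  by rewrite [X in (X + _)%E]Z10 [X in (_ + X)%E]Z20 adde0.
apply: mu_le.
- by apply: measurableI => //; exact: measurable_below.
- by apply: measurableU => //; exact: measurableU.
move=> x [Px Fx]; have [xZ1|nZ1] := pselect (Z1 x); first by right; left.
have [xZ2|nZ2] := pselect (Z2 x); first by right; right.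
left; have Wx : gmaximal mu Q u x = (W x)%:E.
  by apply: contrapT => hx; apply: nZ2; exact: hZ2.
have [vx|vx] := ltP 0 (v x); last first.
  exfalso; have vx0 : v x = 0 by apply/eqP; rewrite eq_le vx v0.
  move: Fx; rewrite /= ltNge => /negP; apply.
  rewrite /F indicE mem_set // mulr1.
  apply: (@le_trans _ _ (L * c)); last first.
    by rewrite lerDl mulr_ge0 // powR_ge0.
  by rewrite mulrC ler_wpM2r ?(ltW c0) // -lee_fin fineK.
split=> //=; rewrite vx /= ltNge; apply/negP => vK.
have wp : 0 < w.
  by have := lt_le_trans vx vK; rewrite pmulr_rgt0.
move: Fx; rewrite /= ltNge => /negP; apply.
have avu : ((w / (4 * B)) ^+ m * fine (average mu f P) <= W x)%R.
  rewrite -lee_fin -Wx; apply: le_trans (average_le_max mu u QP Px).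
  rewrite EFinM fineK // /average muleCA lee_wpmul2l ?lee_fin ?invr_ge0 ?(ltW P0) //.
  rewrite -ge0_integralZl_EFin //; last 2 first.
  - by apply: measurable_abs; exact: measurable_funTS.
  - by rewrite exprn_ge0 // divr_ge0 // ltW.
  apply: ae_ge0_le_integral => //.
  - by move=> y _; rewrite mule_ge0 // lee_fin exprn_ge0 // divr_ge0 // ltW.
  - apply: emeasurable_funM => //; apply: measurable_abs; exact: measurable_funTS.
  - by apply: measurable_abs; exact: measurable_funTS.
  apply: filterS vM => y vMy Py; rewrite -EFinM lee_fin !ger0_norm //.
  rewrite /u mulrC ler_wpM2l // lerXn2r ?nnegrE ?divr_ge0 ?(ltW B4) //.
  rewrite ler_pdivrMr // mulrC -lee_fin; apply: le_trans vMy.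
  rewrite /w fineK ?ge0_fin_numE ?average_ge0 //; exact: average_le_max.
rewrite FE // ler_pdivlMr ?exprn_gt0 //.
apply: le_trans (ler_norm _); apply: le_trans avu.
rewrite mulrAC ler_wpM2r //.
apply: (@le_trans _ _ (c * (k^-1 * w) ^+ m)).
  by rewrite ler_pM2l // lerXn2r // nnegrE // mulr_ge0 // ltW.
rewrite /c -exprVn -exprMn le_eqVlt; apply/orP; left; apply/eqP; congr (_ ^+ _).
by field; rewrite !gt_eqF.
Qed.

End weights.

(** * Separation of convex sets in L^2 *)

Section projection.
Variables (R : realType) (d : measure_display) (T : measurableType d).
Variables (mu : {measure set T -> \bar R}) (D : set T).
Hypotheses (mD : measurable D) (fD : (mu D < +oo)%E).
Implicit Types (z w : T -> R).

Definition bounded_measurable z :=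
  measurable_fun [set: T] z /\ exists M : R, forall x, `|z x| <= M.

Lemma bounded_measurableD z w : bounded_measurable z -> bounded_measurable w ->
  bounded_measurable (fun x => z x + w x).
Proof.
move=> [mz [M hM]] [mw [M' hM']]; split; first exact: measurable_funD.
by exists (M + M') => x; apply: (le_trans (ler_normD _ _)); exact: lerD.
Qed.

Lemma bounded_measurableM z w : bounded_measurable z -> bounded_measurable w ->
  bounded_measurable (fun x => z x * w x).
Proof.
move=> [mz [M hM]] [mw [M' hM']]; split; first exact: measurable_funM.
by exists (M * M') => x; rewrite normrM; exact: ler_pM.
Qed.

Lemma bounded_measurable_cst (c : R) : bounded_measurable (fun=> c).
Proof. by split=> //; exists `|c|. Qed.

Lemma bounded_integrable z : bounded_measurable z -> mu.-integrable D (EFin \o z).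
Proof.
move=> [mz [M hM]]; apply: measurable_bounded_integrable => //.
  exact: measurable_funTS.
exists M; split; first by rewrite realE; case: (leP 0 M) => // /ltW ->; rewrite orbT.
by move=> M' MM' x _ /=; apply: le_trans (hM x) (ltW MM').
Qed.

Local Notation J z := (\int[mu]_(x in D) (z x))%R.

Lemma Rintegral_boundedD z w : bounded_measurable z -> bounded_measurable w ->
  J (fun x => z x + w x) = J z + J w.
Proof. by move=> bz bw; rewrite RintegralD //; exact: bounded_integrable. Qed.

Lemma Rintegral_boundedZ (c : R) z : bounded_measurable z -> J (fun x => c * z x) = c * J z.
Proof. by move=> bz; rewrite RintegralZl //; exact: bounded_integrable. Qed.

(** Dominated convergence; D has finite measure, so a constant is an integrable
    bound. *)
Lemma Rintegral_bounded_cvg (u : nat -> T -> R) z w (L : R) :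
  (forall k, measurable_fun [set: T] (u k)) -> (forall k x, `|u k x| <= L) ->
  bounded_measurable z -> bounded_measurable w ->
  {ae mu, forall x, D x -> (u ^~ x) @ \oo --> z x} ->
  (fun k => J (fun x => u k x * w x)) @ \oo --> J (fun x => z x * w x).
Proof.
move=> mu_ uL bz bw uz; have [mz _] := bz; have [mw [M hM]] := bw.
have bu k : bounded_measurable (u k) by split=> //; exists L.
have [] := @dominated_convergence _ _ _ mu D mD
  (fun k x => (u k x * w x)%:E) (fun x => (z x * w x)%:E) (fun=> (L * M)%:E).
- move=> k; apply/measurable_EFinP; apply: measurable_funTS; exact: measurable_funM.
- apply/measurable_EFinP; apply: measurable_funTS; exact: measurable_funM.
- apply: filterS uz => x ux /ux cx; apply: cvg_EFin; first exact: nearW.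
  by apply: cvgMl.
- exact: (bounded_integrable (bounded_measurable_cst _)).
- apply: aeW => x k _; rewrite lee_fin normrM; exact: ler_pM.
move=> _ _ cv; apply: fine_cvg; rewrite fineK; first exact: cv.
by apply: integrable_fin_num => //; exact: (bounded_integrable (bounded_measurableM bz bw)).
Qed.

Lemma fast_cauchy_cvg (u : nat -> R) (S : R) : 0 <= S ->
  (forall k, (2 ^+ k * (u k.+1 - u k)) ^+ 2 <= S) -> cvgn u.
Proof.
move=> S0 hS.
have step k : `|u k.+1 - u k| <= geometric (S + 1) 2^-1 k.
  have h : 2 ^+ k * `|u k.+1 - u k| <= S + 1.
    have := hS k; rewrite -real_normK ?num_real // normrM ger0_norm ?exprn_ge0 //.
    set y := 2 ^+ k * _ => hy; have : 0 <= y by rewrite mulr_ge0 // exprn_ge0.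
    by move=> y0; nra.
  by rewrite /= exprVn ler_pdivlMr ?exprn_gt0 // mulrC.
have cs : cvgn (series (fun k => u k.+1 - u k)).
  apply: normed_cvg; apply: (series_le_cvg _ _ step).
  - by [].
  - by move=> k; rewrite geometric_ge0 // addr_ge0.
  - by apply: is_cvg_geometric_series; rewrite ger0_norm // invf_lt1 // ltr1n.
have -> : u = (fun k => u 0%N + series (fun k => u k.+1 - u k) k).
  by apply/funext => k; rewrite /series /= telescope_sumr // addrC subrK.
by apply: is_cvgD => //; exact: is_cvg_cst.
Qed.

(* Z is a convex set of bounded functions at distance at least the square root of
   dist from 0 in L^2(D).  [Z_trunc] keeps the minimizing sequence bounded by L,
   so that its limit is found by pointwise convergence. *)
Variables (Z : set (T -> R)) (L dist : R).
Hypotheses (L_ge0 : 0 <= L) (dist_gt0 : 0 < dist).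
Hypothesis Z_bm : forall z, Z z -> bounded_measurable z.
Hypothesis Z_convex : forall z w (t : R), Z z -> Z w -> 0 <= t <= 1 ->
  Z (fun x => z x + t * (w x - z x)).
Hypothesis Z_trunc : forall z, Z z -> exists z', Z z' /\
  forall x, `|z' x| <= L /\ `|z' x| <= `|z x|.
Hypothesis Z_neq0 : exists z, Z z.
Hypothesis Z_dist : forall z, Z z -> dist <= J (fun x => z x ^+ 2).

Let sq z (bz : bounded_measurable z) : bounded_measurable (fun x => z x ^+ 2).
Proof. exact: bounded_measurableM. Qed.

Let norm_comb z w (t : R) : bounded_measurable z -> bounded_measurable w ->
  J (fun x => (z x + t * (w x - z x)) ^+ 2) =
  (1 - t) ^+ 2 * J (fun x => z x ^+ 2) + 2 * t * (1 - t) * J (fun x => z x * w x)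
  + t ^+ 2 * J (fun x => w x ^+ 2).
Proof.
move=> bz bw.
have bzw := bounded_measurableM bz bw.
have bZ c f : bounded_measurable f -> bounded_measurable (fun x => c * f x).
  by move=> bf; apply: bounded_measurableM => //; exact: bounded_measurable_cst.
transitivity (J (fun x => ((1 - t) ^+ 2 * z x ^+ 2 + 2 * t * (1 - t) * (z x * w x)) + t ^+ 2 * w x ^+ 2)).
  by apply: eq_Rintegral => x _; ring.
rewrite Rintegral_boundedD; [|by apply: bounded_measurableD; apply: bZ => //; exact: sq|by apply: bZ; exact: sq].
rewrite Rintegral_boundedD; [|by apply: bZ; exact: sq|by apply: bZ].
by rewrite !Rintegral_boundedZ //; exact: sq.
Qed.

(** The limit z of a minimizing sequence is the projection of 0 onto the closure of
    Z.  The parallelogram identity makes the sequence Cauchy, and it is chosen to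
    approach the infimum like 16^(-k) so that it converges almost everywhere.
    Comparing z with z + t (w - z) for small t gives the inequality. *)
Lemma separation : exists z, [/\ measurable_fun [set: T] z, (forall x, `|z x| <= L) &
  forall w, Z w -> dist <= J (fun x => z x * w x)].
Proof.
pose I := [set J (fun x => z x ^+ 2) | z in Z].
have I0 : I !=set0 by have [z Zz] := Z_neq0; exists (J (fun x => z x ^+ 2)), z.
have Ilb : lbound I dist by move=> _ [z Zz <-]; exact: Z_dist.
have hI : has_inf I by split=> //; exists dist.
pose e := inf I.
have de : dist <= e by exact: lb_le_inf.
have eI z : Z z -> e <= J (fun x => z x ^+ 2).
  by move=> Zz; apply: ge_inf; [exists dist|exists z].
have /choice[u hu] : forall k : nat, exists z, [/\ Z z, (forall x, `|z x| <= L) &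
    J (fun x => z x ^+ 2) <= e + 16^-1 ^+ k].
  move=> k; have p0 : 0 < 16^-1 ^+ k :> R by rewrite exprn_gt0.
  have [_ [z Zz <-] zlt] := inf_adherent p0 hI.
  have [z' [Zz' z'P]] := Z_trunc Zz.
  exists z'; split=> //; first by move=> x; have [] := z'P x.
  apply: le_trans (ltW zlt); apply: le_Rintegral => //.
  - exact: (bounded_integrable (sq (Z_bm Zz'))).
  - exact: (bounded_integrable (sq (Z_bm Zz))).
  by move=> x _; have [_ h] := z'P x; rewrite -real_normK ?num_real // -[leRHS]real_normK ?num_real // lerXn2r ?nnegrE.
have Zu k : Z (u k) by have [] := hu k.
have uL k x : `|u k x| <= L by have [_ h _] := hu k.
have Ju k : J (fun x => u k x ^+ 2) <= e + 16^-1 ^+ k by have [] := hu k.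
have bu k := Z_bm (Zu k).
have mu_ k : measurable_fun [set: T] (u k) by have [] := bu k.
have bdu k : bounded_measurable (fun x => u k.+1 x - u k x).
  apply: bounded_measurableD => //; have [m1 [M h]] := bu k.
  by split; [exact: measurable_funN|exists M => x; rewrite normrN].
have Jd k : J (fun x => (u k.+1 x - u k x) ^+ 2) <= 4 * 16^-1 ^+ k.
  have h12 : 0 <= (2^-1 : R) <= 1 by rewrite invr_ge0 ler0n invf_le1 // ler1n.
  have := eI _ (Z_convex (Zu k) (Zu k.+1) h12).
  rewrite norm_comb //.
  have -> : J (fun x => (u k.+1 x - u k x) ^+ 2) =
     J (fun x => u k.+1 x ^+ 2) + J (fun x => u k x ^+ 2) - 2 * J (fun x => u k x * u k.+1 x).
    transitivity (J (fun x => (u k.+1 x ^+ 2 + u k x ^+ 2) + (- 2) * (u k x * u k.+1 x))).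
      by apply: eq_Rintegral => x _; ring.
    have bm2 : bounded_measurable (fun x => (- 2) * (u k x * u k.+1 x)).
      apply: bounded_measurableM; first exact: bounded_measurable_cst.
      exact: bounded_measurableM.
    rewrite Rintegral_boundedD //; last by apply: bounded_measurableD; exact: sq.
    rewrite Rintegral_boundedD; [|exact: sq|exact: sq].
    by rewrite Rintegral_boundedZ ?mulNr //; exact: bounded_measurableM.
  have := Ju k; have := Ju k.+1; rewrite exprS.
  have : 0 <= 16^-1 ^+ k :> R by rewrite exprn_ge0.
  lra.
(* The k-th squared increment has integral at most 4 * 16^(-k), so S is
   integrable, and where S is finite the increments are O(2^(-k)). *)
pose S x := (\sum_(0 <= k <oo) ((2 ^+ k * (u k.+1 x - u k x)) ^+ 2)%:E)%E.
have mS : measurable_fun [set: T] S.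
  apply: ge0_emeasurable_sum; first by move=> k x _ _; rewrite lee_fin sqr_ge0.
  move=> k _; apply/measurable_EFinP; apply: measurable_funX; apply: measurable_funM => //.
  by have [] := bdu k.
have S0 x : (0 <= S x)%E by apply: nneseries_ge0 => k _ _; rewrite lee_fin sqr_ge0.
have IS : (\int[mu]_(x in D) S x < +oo)%E.
  rewrite integral_nneseries //; last 2 first.
  - move=> k; apply/measurable_EFinP; apply: measurable_funTS; apply: measurable_funX.
    by apply: measurable_funM => //; have [] := bdu k.
  - by move=> k x _; rewrite lee_fin sqr_ge0.
  apply: (@le_lt_trans _ _ ((8%:R)%:E)); last exact: ltry.
  apply: le_trans (epsilon_trick0 xpredT _); last by [].
  apply: lee_nneseries; first by move=> k _ _; apply: integral_ge0 => x _; rewrite lee_fin sqr_ge0.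
  move=> k _; have bk : bounded_measurable (fun x => (2 ^+ k * (u k.+1 x - u k x)) ^+ 2).
    by apply: sq; apply: bounded_measurableM => //; exact: bounded_measurable_cst.
  rewrite -[leLHS]fineK; last first.
    by apply: integrable_fin_num => //; exact: (bounded_integrable bk).
  rewrite lee_fin.
  have -> : fine (\int[mu]_(x in D) ((2 ^+ k * (u k.+1 x - u k x)) ^+ 2)%:E) =
     4 ^+ k * J (fun x => (u k.+1 x - u k x) ^+ 2).
    rewrite -Rintegral_boundedZ; last exact: sq.
    apply: eq_Rintegral => x _; rewrite exprMn -exprM mulnC exprM.
    by congr (_ ^+ _ * _); rewrite expr2; ring.
  apply: (@le_trans _ _ (4 ^+ k * (4 * 16^-1 ^+ k))); first by rewrite ler_pM2l // exprn_gt0.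
  have -> : 4 ^+ k * (4 * 16^-1 ^+ k) = 4 * 4^-1 ^+ k :> R.
    by rewrite mulrCA -exprMn; congr (_ * _ ^+ _); field.
  rewrite natrX exprS.
  have -> : 8 / (2 * 2 ^+ k) = 4 * 2^-1 ^+ k :> R.
    by rewrite exprVn; field; rewrite expf_neq0.
  rewrite ler_pM2l //; apply: lerXn2r; rewrite ?nnegrE ?invr_ge0 //.
  by rewrite lef_pV2 ?posrE // ler_nat.
have Sfin : {ae mu, forall x, D x -> S x \is a fin_num}.
  apply: integrable_ae => //; apply/integrableP; split; first exact: measurable_funTS.
  by under eq_integral do rewrite gee0_abs //.
have ucv : {ae mu, forall x, D x -> cvgn (u ^~ x)}.
  apply: filterS Sfin => x Sx Dx; apply: (@fast_cauchy_cvg _ (fine (S x))); first exact: fine_ge0.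
  move=> k; rewrite -lee_fin fineK; last exact: Sx.
  apply: (@le_nneseries_term _ (fun k => ((2 ^+ k * (u k.+1 x - u k x)) ^+ 2)%:E)) => j.
  by rewrite lee_fin sqr_ge0.
pose z x := limn_sup (u ^~ x).
have ub x : has_ubound (range (u ^~ x)).
  by exists L => _ [k _ <-]; exact: le_trans (ler_norm _) (uL k x).
have lb x : has_lbound (range (u ^~ x)).
  by exists (- L) => _ [k _ <-]; have := uL k x; rewrite ler_norml => /andP[].
have mz : measurable_fun [set: T] z by apply: measurable_fun_limn_sup.
(* Clipping makes the bound hold at every point, not only where the sequence converges. *)
pose z' x := Num.min L (Num.max (- L) (z x)).
have mz' : measurable_fun [set: T] z'.
  apply: (@measurable_minr _ _ _ _ (fun=> L)) => //.
  exact: (@measurable_maxr _ _ _ _ (fun=> - L)).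
have z'L x : `|z' x| <= L.
  rewrite ler_norml /z' le_min ge_min lexx /= andbT le_max lexx /= andbT.
  by move: L_ge0; lra.
have bz' : bounded_measurable z' by split=> //; exists L.
have uz : {ae mu, forall x, D x -> (u ^~ x) @ \oo --> z' x}.
  apply: filterS ucv => x cx /cx cux.
  have -> : z' x = limn (u ^~ x).
    rewrite /z' /z (cvg_limn_supE cux).
    have l1 : limn (u ^~ x) <= L.
      by apply: limr_le => //; apply: nearW => k; apply: le_trans (ler_norm _) (uL k x).
    have l2 : - L <= limn (u ^~ x).
      by apply: limr_ge => //; apply: nearW => k; have := uL k x; rewrite ler_norml => /andP[].
    by rewrite max_r // min_r.
  exact: cux.
exists z'; split=> // w Zw; have bw := Z_bm Zw.
have cJ := Rintegral_bounded_cvg mu_ uL bz' bw uz.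
set j := J (fun x => z' x * w x) in cJ *.
set W := J (fun x => w x ^+ 2).
have ineq (t : R) : 0 <= t <= 1 -> e <= (1 - t) ^+ 2 * e + 2 * t * (1 - t) * j + t ^+ 2 * W.
  move=> t01.
  have step k : e <= (1 - t) ^+ 2 * (e + 16^-1 ^+ k) + 2 * t * (1 - t) * J (fun x => u k x * w x) + t ^+ 2 * W.
    apply: (le_trans (eI _ (Z_convex (Zu k) Zw t01))).
    by rewrite norm_comb // !lerD2r ler_wpM2l // sqr_ge0.
  have cv : (fun k => (1 - t) ^+ 2 * (e + 16^-1 ^+ k) + 2 * t * (1 - t) * J (fun x => u k x * w x) + t ^+ 2 * W) @ \oo
     --> (1 - t) ^+ 2 * (e + 0) + 2 * t * (1 - t) * j + t ^+ 2 * W.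
    apply: cvgD; last exact: cvg_cst.
    apply: cvgD; apply: cvgMr => //.
    apply: cvgD; first exact: cvg_cst.
    by apply: cvg_expr; rewrite ger0_norm // invf_lt1 // ltr1n.
  rewrite addr0 in cv.
  rewrite -(cvg_lim _ cv) //; apply: limr_ge; first exact: (cvgP _ cv).
  exact: nearW.
apply: (le_trans de); rewrite leNgt; apply/negP => je.
pose K := `|e - 2 * j + W| + 1.
have K0 : 0 < K by rewrite ltr_wpDl.
pose t := Num.min 1 ((e - j) / K).
have t0 : 0 < t by rewrite lt_min ltr01 /= divr_gt0 // subr_gt0.
have t1 : t <= 1 by rewrite ge_min lexx.
have tK : t * K <= e - j.
  by rewrite -ler_pdivlMr // ge_min lexx orbT.
have t01 : 0 <= t <= 1 by rewrite (ltW t0).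
have hi := ineq _ t01.
have hK : e - 2 * j + W <= K by rewrite /K; apply: le_trans (ler_norm _) _; rewrite lerDl.
have tt : t * (e - 2 * j + W) <= t * K by rewrite ler_pM2l.
have : t * (2 * (e - j)) <= t * (t * (e - 2 * j + W)) by move: hi; lra.
rewrite ler_pM2l //; lra.
Qed.

End projection.

(** * A minimax argument *)

Section minimax.
Variables (R : realType) (d : measure_display) (T : measurableType d).
Variables (mu : {measure set T -> \bar R}).
Variables (C : set (T -> R)) (N : (T -> R) -> R).
Hypothesis hX : function_space mu C N.
Implicit Types (f g b z F : T -> R).
Local Notation dnorm := (dual_norm mu C N).

Lemma ball_convex (K : R) b b' (t : R) : C b -> N b <= K -> C b' -> N b' <= K -> 0 <= t <= 1 ->
  C (fun x => b x + t * (b' x - b x)) /\ N (fun x => b x + t * (b' x - b x)) <= K.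
Proof.
move=> Cb Nb Cb' Nb' /andP[t0 t1].
have -> : (fun x => b x + t * (b' x - b x)) = ((1 - t) \*: b) \+ (t \*: b').
  by apply/funext => x /=; rewrite /GRing.scale /=; ring.
have h1 := fsZ hX (1 - t) Cb; have h2 := fsZ hX t Cb'.
split; first exact: (fsD hX).
apply: (le_trans (fs_normD hX h1 h2)); rewrite !(fs_normZ hX) //.
rewrite (ger0_norm t0) ger0_norm ?subr_ge0 //.
have -> : K = (1 - t) * K + t * K by ring.
by apply: lerD; rewrite ler_wpM2l // subr_ge0.
Qed.

Lemma min_lipschitz (x y L : R) : `|Num.min x L - Num.min y L| <= `|x - y|.
Proof.
have := ler_norm (x - y); have := ler_norm (y - x); rewrite (distrC y x) => h1 h2.
have [xL|xL] := leP x L; have [yL|yL] := leP y L => //.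
- by rewrite ler_norml; lra.
- by rewrite ler_norml; lra.
- by rewrite subrr normr0.
Qed.

(* A stands for the set of functions that are large on most of finitely many
   cubes with union D; by [A_dual] no single g separates it from the ball of
   radius C0 of C. *)
Variables (D : set T) (L C0 : R) (A : set (T -> R)).
Hypotheses (mD : measurable D) (fD : (mu D < +oo)%E) (L_ge0 : 0 <= L) (C0_gt0 : 0 < C0).
Hypothesis A_pos : forall F, A F -> measurable_fun [set: T] F /\ forall x, 0 <= F x.
Hypothesis A_convex : forall F F' (t : R), A F -> A F' -> 0 <= t <= 1 ->
  A (fun x => F x + t * (F' x - F x)).
Hypothesis A_min : forall F, A F -> A (fun x => Num.min (F x) L).
Hypothesis A_cst : A (fun=> L).
Hypothesis A_dual : forall g, measurable_fun [set: T] g -> (forall x, 0 <= g x) ->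
  (dnorm (fun x => (g x)%:E) <= 1)%E ->
  exists F, A F /\ (\int[mu]_x (g x * F x)%:E <= C0%:E)%E.

Let D' z : set T := D `&` [set x | 0 < z x].

Let measurable_D' z : measurable_fun [set: T] z -> measurable (D' z).
Proof.
by move=> mz; apply: measurableI => //; exact: measurable_above.
Qed.

Let pos_part z x : R := z x * \1_(D' z) x.

Let pos_part_ge0 z x : 0 <= pos_part z x.
Proof.
rewrite /pos_part indicE; case: (boolP (x \in _)) => [/set_mem [_ zx]|_]; last by rewrite mulr0.
by rewrite mulr1 ltW.
Qed.

Let bounded_measurable_pos_part z : bounded_measurable z -> bounded_measurable (pos_part z).
Proof.
move=> bz; have [mz _] := bz; apply: bounded_measurableM => //; split.
  by apply: measurable_indic; exact: measurable_D'.
by exists 1 => x; rewrite indicE; case: (x \in _); rewrite ?normr1 ?normr0.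
Qed.

Let pos_part_integral z (h : T -> R) : (forall x, 0 <= h x) ->
  (\int[mu]_x (pos_part z x * h x)%:E = \int[mu]_(x in D) (pos_part z x * h x)%:E)%E.
Proof.
move=> h0; rewrite [RHS]integral_mkcond; apply: eq_integral => x _.
rewrite patchE; case: ifPn => // xD; rewrite /pos_part indicE memNset ?mulr0 ?mul0r //.
by move=> [Dx _]; move: xD; rewrite mem_set.
Qed.

(** An element of the unit ball that almost norms the positive part of z is
    truncated to be bounded and restricted to the set where z > 0, so that
    pairing it with z and with the positive part is the same; b is C0 times it. *)
Let norming z (r : R) : bounded_measurable z ->
  (r%:E < dnorm (fun x => (pos_part z x)%:E))%E ->
  exists b, [/\ C b, N b <= C0, (forall x, 0 <= b x), (exists M : R, forall x, b x <= M) &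
    C0 * r <= \int[mu]_(x in D) (z x * b x)].
Proof.
move=> bz /ereal_sup_gt [_ [b0 [Cb0 Nb0] <-] rb]; have [mz _] := bz.
have mb0 := fs_measurable hX Cb0.
have [mp _] := bounded_measurable_pos_part bz.
pose u (j : nat) x : R := Num.min `|b0 x| j%:R.
have mu_ j : measurable_fun [set: T] (u j).
  apply: (@measurable_minr _ _ _ _ (fun x => `|b0 x|) (fun=> j%:R)) => //.
  exact: measurableT_comp.
have u0 j x : 0 <= u j x by rewrite le_min normr_ge0 ler0n.
have mpu j : measurable_fun [set: T] (fun x => (pos_part z x * u j x)%:E).
  by apply/measurable_EFinP; exact: measurable_funM.
have pu0 j x : (0 <= (pos_part z x * u j x)%:E)%E by rewrite lee_fin mulr_ge0.
have [j hj] : exists j, (r%:E < \int[mu]_x (pos_part z x * u j x)%:E)%E.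
  apply: contrapT => nj.
  have cv := @cvg_monotone_convergence _ _ _ mu _ measurableT
    (fun j x => (pos_part z x * u j x)%:E) mpu (fun j x _ => pu0 j x).
  have /cv {}cv : forall x, [set: T] x -> {homo (fun j => (pos_part z x * u j x)%:E) : n m / (n <= m)%N >-> (n <= m)%E}.
    move=> x _ p q pq; rewrite lee_fin ler_wpM2l // le_min ge_min lexx /=.
    by rewrite ge_min ler_nat pq orbT.
  move: rb; apply/negP; rewrite -leNgt.
  rewrite [leLHS](_ : _ = \int[mu]_x (limn (fun j => (pos_part z x * u j x)%:E)))%E; last first.
    apply: eq_integral => x _; apply/esym/cvg_lim => //.
    apply: (@cvg_near_cst _ _ ((pos_part z x)%:E * `|b0 x|%:E)%E).
    exists (Num.bound `|b0 x|) => // k /= hk; rewrite EFinM /u min_l //.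
    apply: le_trans (ltW (archi_boundP (normr_ge0 _))) _.
    by rewrite ler_nat.
  rewrite -(cvg_lim _ cv) //; apply: lime_le; first exact: (cvgP _ cv).
  by apply: nearW => j; rewrite leNgt; apply/negP => h; apply: nj; exists j.
pose b x := C0 * (u j x * \1_(D' z) x).
have b0' x : 0 <= b x by rewrite mulr_ge0 ?(ltW C0_gt0) // mulr_ge0.
have mb : measurable_fun [set: T] b.
  apply: measurable_funM => //; apply: measurable_funM => //.
  by apply: measurable_indic; exact: measurable_D'.
have [Cb Nb] : C b /\ N b <= N (C0 \*: b0).
  apply: (fs_ideal hX) => //; first exact: (fsZ hX).
  apply: aeW => x; rewrite ger0_norm // normrM (gtr0_norm C0_gt0) ler_pM2l //.
  apply: (@le_trans _ _ (u j x)); last by rewrite ge_min lexx.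
  by rewrite indicE; case: (x \in _); rewrite ?mulr1 // mulr0.
exists b; split=> //.
- by apply: (le_trans Nb); rewrite (fs_normZ hX) // gtr0_norm // ger_pMr.
- exists (C0 * j%:R) => x; rewrite ler_pM2l // indicE.
  by case: (x \in _); rewrite ?mulr1 ?mulr0 // ge_min lexx orbT.
rewrite (_ : \int[mu]_(x in D) (z x * b x) = \int[mu]_(x in D) (C0 * (pos_part z x * u j x))); last first.
  apply: eq_Rintegral => x _; rewrite /b /pos_part; ring.
have bu : bounded_measurable (u j).
  by split=> //; exists j%:R => x; rewrite ger0_norm // ge_min lexx orbT.
have bpu := bounded_measurableM (bounded_measurable_pos_part bz) bu.
rewrite (Rintegral_boundedZ mD fD) // ler_pM2l // -lee_fin /Rintegral fineK.
  by rewrite -pos_part_integral //; exact: ltW.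
by apply: integrable_fin_num => //; exact: (bounded_integrable mD fD bpu).
Qed.

(** Otherwise the differences F - b form a convex set at positive L^2 distance from
    0, and [separation] gives z with int z F >= eta + int z b for all F and b.
    Let s be the dual norm of the positive part of z.  If s is finite, [A_dual]
    gives F with int z F <= (s + e) C0, while some b has int z b >= (s - e) C0;
    with e = eta / (4 C0) this is a contradiction.  If s is infinite, int z b is
    unbounded, against F = L. *)
Lemma minimax (eta : R) : 0 < eta -> exists F b, [/\ A F, C b /\ N b <= C0,
  (forall x, 0 <= F x <= L), (forall x, 0 <= b x <= L) &
  \int[mu]_(x in D) ((F x - b x) ^+ 2) <= eta].
Proof.
move=> eta0; apply: contrapT => hn.
pose Z := [set z : T -> R | exists F b, [/\ A F, C b /\ N b <= C0, (forall x, 0 <= b x),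
  (exists M : R, forall x, F x <= M /\ b x <= M) & z = (fun x => F x - b x)]].
have bmF F (M : R) : A F -> (forall x, F x <= M) -> bounded_measurable F.
  move=> /A_pos [mF F0] FM; split=> //; exists M => x; rewrite ger0_norm //.
have bmb b (M : R) : C b -> (forall x, 0 <= b x) -> (forall x, b x <= M) -> bounded_measurable b.
  move=> Cb b0 bM; split; first exact: (fs_measurable hX Cb).
  by exists M => x; rewrite ger0_norm.
have bmN b : bounded_measurable b -> bounded_measurable (fun x => - b x).
  by move=> [mb [M hM]]; split; [exact: measurable_funN|exists M => x; rewrite normrN].
have Zbm z : Z z -> bounded_measurable z.
  move=> [F [b [AF [Cb Nb] b0 [M hM] ->]]].
  apply: bounded_measurableD; first by apply: (bmF F M) => // x; have [] := hM x.
  by apply: bmN; apply: (bmb b M) => // x; have [] := hM x.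
have trunc F b : A F -> C b -> N b <= C0 -> (forall x, 0 <= b x) ->
    let F' x := Num.min (F x) L in let b' x := Num.min (b x) L in
    [/\ A F', C b' /\ N b' <= C0, (forall x, 0 <= F' x <= L), (forall x, 0 <= b' x <= L) &
      Z (fun x => F' x - b' x)].
  move=> AF Cb Nb b0 F' b'; have [mF F0] := A_pos AF.
  have AF' : A F' := A_min AF.
  have mb' : measurable_fun [set: T] b'.
    by apply: (@measurable_minr _ _ _ _ b (fun=> L)) => //; exact: (fs_measurable hX Cb).
  have b'0 x : 0 <= b' x <= L by rewrite /b' le_min b0 L_ge0 /= ge_min lexx orbT.
  have F'0 x : 0 <= F' x <= L by rewrite /F' le_min F0 L_ge0 /= ge_min lexx orbT.
  have [Cb' Nb'] : C b' /\ N b' <= N b.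
    apply: (fs_ideal hX) => //; apply: aeW => x; rewrite !ger0_norm //.
      by rewrite ge_min lexx.
    by have /andP[] := b'0 x.
  have Nb'' := le_trans Nb' Nb.
  split=> //; exists F', b'; split=> //; first by move=> x; have /andP[] := b'0 x.
  by exists L => x; have /andP[_ ?] := F'0 x; have /andP[_ ?] := b'0 x.
have Ztr z : Z z -> exists z', Z z' /\ forall x, `|z' x| <= L /\ `|z' x| <= `|z x|.
  move=> [F [b [AF [Cb Nb] b0 _ ->]]].
  have [_ _ F'0 b'0 Z'] := trunc F b AF Cb Nb b0.
  eexists; split; first exact: Z'.
  move=> x; split; last exact: min_lipschitz.
  by have /andP[? ?] := F'0 x; have /andP[? ?] := b'0 x; rewrite ler_norml; lra.
have Zcv z w (t : R) : Z z -> Z w -> 0 <= t <= 1 -> Z (fun x => z x + t * (w x - z x)).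
  move=> [F [b [AF [Cb Nb] b0 [M hM] ->]]] [F' [b' [AF' [Cb' Nb'] b'0 [M' hM'] ->]]] t01.
  have /andP[t0 t1] := t01.
  exists (fun x => F x + t * (F' x - F x)), (fun x => b x + t * (b' x - b x)); split.
  - exact: A_convex.
  - exact: ball_convex.
  - by move=> x; have := b0 x; have := b'0 x => h1 h2; nra.
  - exists (`|M| + `|M'|) => x; have [h1 h2] := hM x; have [h3 h4] := hM' x.
    have k1 := ler_norm M; have k2 := ler_norm M'.
    have k3 := normr_ge0 M; have k4 := normr_ge0 M'.
    by split; nra.
  - by apply/funext => x; ring.
have Zd z : Z z -> eta <= \int[mu]_(x in D) (z x ^+ 2).
  move=> Zz; have bz := Zbm _ Zz; move: Zz => [F [b [AF [Cb Nb] b0 hM zE]]].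
  have [AF' Cb' F'0 b'0 Z'] := trunc F b AF Cb Nb b0.
  have bz' := Zbm _ Z'.
  apply: (@le_trans _ _ (\int[mu]_(x in D) ((Num.min (F x) L - Num.min (b x) L) ^+ 2))).
    rewrite leNgt; apply/negP => /ltW h; apply: hn.
    by exists (fun x => Num.min (F x) L), (fun x => Num.min (b x) L).
  apply: le_Rintegral => //.
  - exact: (bounded_integrable mD fD (bounded_measurableM bz' bz')).
  - exact: (bounded_integrable mD fD (bounded_measurableM bz bz)).
  move=> x _; rewrite zE -real_normK ?num_real // -[leRHS]real_normK ?num_real //.
  by rewrite lerXn2r ?nnegrE // min_lipschitz.
have Z0 : exists z, Z z.
  exists (fun x => L - 0), (fun=> L), (cst 0); split=> //.
    by split; [exact: (fs0 hX)|rewrite (norm0 hX) ltW].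
  by exists L.
have [z [mz zL zZ]] := separation mD fD L_ge0 Zbm Zcv Ztr Z0 Zd.
have bz : bounded_measurable z by split=> //; exists L.
have bp := bounded_measurable_pos_part bz; have [mp _] := bp.
have JB F b (M : R) : A F -> (forall x, F x <= M) -> C b -> (forall x, 0 <= b x) -> (forall x, b x <= M) ->
   \int[mu]_(x in D) (z x * (F x - b x)) =
   \int[mu]_(x in D) (z x * F x) - \int[mu]_(x in D) (z x * b x).
  move=> AF FM Cb b0 bM; rewrite -RintegralB //.
  - by apply: eq_Rintegral => x _; ring.
  - exact: (bounded_integrable mD fD (bounded_measurableM bz (bmF _ _ AF FM))).
  - exact: (bounded_integrable mD fD (bounded_measurableM bz (bmb _ _ Cb b0 bM))).
have mk F b (M : R) : A F -> (forall x, F x <= M) -> C b -> N b <= C0 -> (forall x, 0 <= b x) -> (exists M : R, forall x, b x <= M) ->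
   eta <= \int[mu]_(x in D) (z x * F x) - \int[mu]_(x in D) (z x * b x).
  move=> AF FM Cb Nb b0 [M' bM'].
  have FM2 x : F x <= `|M| + `|M'|.
    by apply: (le_trans (FM x)); apply: le_trans (ler_norm M) _; rewrite lerDl.
  have bM2 x : b x <= `|M| + `|M'|.
    by apply: (le_trans (bM' x)); apply: le_trans (ler_norm M') _; rewrite lerDr.
  rewrite -(JB F b (`|M| + `|M'|)) //; apply: zZ.
  by exists F, b; split=> //; exists (`|M| + `|M'|).
have gD0 := dual_norm_ge0 hX (fun x => (pos_part z x)%:E).
have [sfin|sinf] := boolP (dnorm (fun x => (pos_part z x)%:E) \is a fin_num); last first.
  have sE : dnorm (fun x => (pos_part z x)%:E) = +oo%E.
    by apply/eqP; move: sinf; rewrite ge0_fin_numE // ltey negbK.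
  pose r := \int[mu]_(x in D) (z x * L) / C0.
  have rlt : (r%:E < dnorm (fun x => (pos_part z x)%:E))%E by rewrite sE ltry.
  have [b [Cb Nb b0 bM hb]] := norming bz rlt.
  have := mk (fun=> L) b L A_cst (fun=> lexx L) Cb Nb b0 bM.
  have : C0 * r = \int[mu]_(x in D) (z x * L) by rewrite /r mulrC divfK // gt_eqF.
  by move: hb; lra.
set s := fine (dnorm (fun x => (pos_part z x)%:E)).
have sE : dnorm (fun x => (pos_part z x)%:E) = s%:E by rewrite fineK.
have s0 : 0 <= s by exact: fine_ge0.
pose e := eta / (4 * C0).
have e0 : 0 < e by rewrite divr_gt0 // mulr_gt0.
have s'0 : 0 < s + e by rewrite ltr_wpDl.
have [F [AF FD]] : exists F, A F /\ (\int[mu]_x ((s + e)^-1 * pos_part z x * F x)%:E <= C0%:E)%E.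
  apply: A_dual.
  - by apply: measurable_funM.
  - by move=> x; rewrite mulr_ge0 // invr_ge0 ltW.
  apply: (le_trans (dual_normZ hX (h := fun x => (pos_part z x)%:E) _ _ _)).
  - exact/measurable_EFinP.
  - by move=> x; rewrite lee_fin.
  - by rewrite invr_ge0 ltW.
  by rewrite sE -EFinM lee_fin mulrC ler_pdivrMr // mul1r lerDl ltW.
have [mF F0] := A_pos AF.
pose F' x := Num.min (F x) L.
have AF' : A F' := A_min AF.
have [mF' F'0] := A_pos AF'.
have F'L x : F' x <= L by rewrite ge_min lexx orbT.
have zF : \int[mu]_(x in D) (z x * F' x) <= (s + e) * C0.
  have bF' := bmF _ _ AF' F'L.
  apply: (@le_trans _ _ (\int[mu]_(x in D) (pos_part z x * F' x))).
    apply: le_Rintegral => //.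
    - exact: (bounded_integrable mD fD (bounded_measurableM bz bF')).
    - exact: (bounded_integrable mD fD (bounded_measurableM bp bF')).
    move=> x Dx; rewrite ler_wpM2r // /pos_part indicE.
    have [zx|zx] := ltP 0 (z x); first by rewrite mem_set ?mulr1.
    by rewrite memNset ?mulr0 // => -[_] /=; rewrite ltNge zx.
  rewrite -lee_fin /Rintegral fineK; last first.
    by apply: integrable_fin_num => //; exact: (bounded_integrable mD fD (bounded_measurableM bp bF')).
  rewrite -pos_part_integral // EFinM -lee_pdivrMl //.
  apply: le_trans FD; rewrite -ge0_integralZl_EFin //; last 3 first.
  - by move=> x _; rewrite lee_fin mulr_ge0.
  - by apply/measurable_EFinP; exact: measurable_funM.
  - by rewrite invr_ge0 ltW.
  apply: ge0_le_integral => //.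
  - by move=> x _; rewrite -EFinM lee_fin mulr_ge0 ?invr_ge0 ?(ltW s'0) // mulr_ge0.
  - apply: emeasurable_funM => //; apply/measurable_EFinP; exact: measurable_funM.
  - apply/measurable_EFinP; apply: measurable_funM => //; exact: measurable_funM.
  move=> x _; rewrite -EFinM lee_fin mulrA ler_wpM2l //.
    by rewrite mulr_ge0 // invr_ge0 ltW.
  by rewrite ge_min lexx.
have rlt : ((s - e)%:E < dnorm (fun x => (pos_part z x)%:E))%E.
  by rewrite sE lte_fin ltrBlDr ltrDl.
have [b [Cb Nb b0 bM hb]] := norming bz rlt.
have := mk F' b L AF' F'L Cb Nb b0 bM.
have eE : C0 * e = eta / 4 by rewrite /e; field; rewrite gt_eqF.
move: hb zF; rewrite mulrBr mulrDl (mulrC s) (mulrC e) eE; lra.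
Qed.

End minimax.

(** * Functions that are large on most of a set *)

Section finite.
Variables (R : realType) (d : measure_display) (T : measurableType d).
Variables (mu : {measure set T -> \bar R}) (Q : set (set T)).
Variables (C : set (T -> R)) (N : (T -> R) -> R).
Hypotheses (hQ : cube_basis mu Q) (hX : function_space mu C N).
Implicit Types (f g b F : T -> R) (P : set T).
Local Notation dnorm := (dual_norm mu C N).

Definition hinge (a : R) F : T -> R := fun x => Num.max 0 (1 - F x / a).

Lemma hinge01 a F x : 0 < a -> 0 <= F x -> 0 <= hinge a F x <= 1.
Proof.
move=> a0 F0; rewrite /hinge le_max lexx /= ge_max ler01 /=.
by rewrite lerBlDr lerDl divr_ge0 // ltW.
Qed.

Lemma bounded_measurable_hinge a F : 0 < a -> measurable_fun [set: T] F -> (forall x, 0 <= F x) ->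
  bounded_measurable (hinge a F).
Proof.
move=> a0 mF F0; split; last first.
  by exists 1 => x; have /andP[h1 h2] := hinge01 a0 (F0 x); rewrite ger0_norm.
apply: (@measurable_maxr _ _ _ _ (fun=> 0) (fun x => 1 - F x / a)) => //.
by apply: measurable_funB => //; exact: measurable_funM.
Qed.

(** A convex relaxation of the condition that F < a holds on at most the proportion k
    of P: the indicator of F < a is replaced by the convex function [hinge] of F,
    which it dominates ([mostly_ge_superlevel]), and which is at least 1/2 where
    F < a / 2 ([mostly_ge_close]). *)
Definition mostly_ge (k a : R) P F :=
  \int[mu]_(x in P) hinge a F x <= k * fine (mu P).

Lemma mostly_ge_convex k a P F F' (t : R) : Q P -> 0 < a ->
  measurable_fun [set: T] F -> (forall x, 0 <= F x) ->
  measurable_fun [set: T] F' -> (forall x, 0 <= F' x) -> 0 <= t <= 1 ->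
  mostly_ge k a P F -> mostly_ge k a P F' ->
  mostly_ge k a P (fun x => F x + t * (F' x - F x)).
Proof.
move=> QP a0 mF F0 mF' F'0 /andP[t0 t1] hF hF'.
have mP := basis_measurable hQ QP; have fP := basis_mu_lty hQ QP.
have bF := bounded_measurable_hinge a0 mF F0; have bF' := bounded_measurable_hinge a0 mF' F'0.
have bZ (c : R) z : bounded_measurable z -> bounded_measurable (fun x : T => c * z x).
  by move=> bz; apply: bounded_measurableM => //; exact: bounded_measurable_cst.
have mFF : measurable_fun [set: T] (fun x => F x + t * (F' x - F x)).
  by apply: measurable_funD => //; apply: measurable_funM => //; exact: measurable_funB.
have FF0 x : 0 <= F x + t * (F' x - F x).
  by have := F0 x; have := F'0 x => h1 h2; nra.
rewrite /mostly_ge.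
apply: (@le_trans _ _ (\int[mu]_(x in P) ((1 - t) * hinge a F x + t * hinge a F' x))).
  apply: le_Rintegral => //.
  - exact: (bounded_integrable mP fP (bounded_measurable_hinge a0 mFF FF0)).
  - exact: (bounded_integrable mP fP (bounded_measurableD (bZ _ _ bF) (bZ _ _ bF'))).
  move=> x _; have /andP[h1 _] := hinge01 a0 (F0 x); have /andP[h2 _] := hinge01 a0 (F'0 x).
  rewrite {1}/hinge ge_max addr_ge0 ?mulr_ge0 ?subr_ge0 //=.
  have k1 : 1 - F x / a <= hinge a F x by rewrite le_max lexx orbT.
  have k2 : 1 - F' x / a <= hinge a F' x by rewrite le_max lexx orbT.
  have -> : 1 - (F x + t * (F' x - F x)) / a = (1 - t) * (1 - F x / a) + t * (1 - F' x / a) by ring.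
  by apply: lerD; rewrite ler_wpM2l // subr_ge0.
rewrite (Rintegral_boundedD mP fP (bZ _ _ bF) (bZ _ _ bF')) !(Rintegral_boundedZ mP fP) //.
have -> : k * fine (mu P) = (1 - t) * (k * fine (mu P)) + t * (k * fine (mu P)) by ring.
by apply: lerD; rewrite ler_wpM2l // subr_ge0.
Qed.

Lemma mostly_ge_min k a P F (L : R) : 0 < a -> a <= L ->
  mostly_ge k a P F -> mostly_ge k a P (fun x => Num.min (F x) L).
Proof.
move=> a0 aL; rewrite /mostly_ge; congr (_ <= _); apply: eq_Rintegral => x _.
rewrite /hinge; have [//|LF] := leP (F x) L.
have h1 : 1 <= F x / a by rewrite ler_pdivlMr // mul1r; lra.
have h2 : 1 <= L / a by rewrite ler_pdivlMr // mul1r.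
by rewrite !max_l // subr_le0.
Qed.

Lemma mostly_ge_superlevel k a P F : Q P -> 0 < a ->
  measurable_fun [set: T] F -> (forall x, 0 <= F x) ->
  (mu (P `&` [set x | (F x < a)%R]) <= k%:E * mu P)%E -> mostly_ge k a P F.
Proof.
move=> QP a0 mF F0; have mP := basis_measurable hQ QP; have fP := basis_mu_lty hQ QP.
rewrite (mu_fineK hQ QP) -EFinM => small.
have mS : measurable [set x | F x < a] by exact: measurable_below.
rewrite /mostly_ge -lee_fin /Rintegral fineK; last first.
  by apply: integrable_fin_num => //; exact: (bounded_integrable mP fP (bounded_measurable_hinge a0 mF F0)).
apply: le_trans small; rewrite setIC -integral_indic //; apply: ge0_le_integral => //.
- by move=> x _; rewrite lee_fin; have /andP[] := hinge01 a0 (F0 x).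
- by apply/measurable_EFinP; apply: measurable_funTS; have [] := bounded_measurable_hinge a0 mF F0.
- by apply/measurable_EFinP; apply: measurable_funTS; exact: measurable_indic.
move=> x _; rewrite lee_fin; have /andP[_ h1] := hinge01 a0 (F0 x).
rewrite indicE; have [Fa|aF] := ltP (F x) a; first by rewrite mem_set.
rewrite memNset; last by rewrite /= ltNge aF.
by rewrite /hinge max_l // subr_le0 ler_pdivlMr // mul1r.
Qed.

(** Where b < a / 4, either F < a / 2 and the hinge exceeds 1/2, or F - b >= a / 4.
    So the indicator of b < a / 4 is at most
    2 hinge + (16 / a^2) (F - b)^2, whose integral over P is at most
    (2 k + k) mu P. *)
Lemma mostly_ge_close k a P F b (D : set T) (eta L : R) : Q P -> 0 < a ->
  measurable D -> (mu D < +oo)%E -> P `<=` D ->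
  measurable_fun [set: T] F -> (forall x, 0 <= F x <= L) ->
  measurable_fun [set: T] b -> (forall x, 0 <= b x <= L) ->
  mostly_ge k a P F -> \int[mu]_(x in D) ((F x - b x) ^+ 2) <= eta ->
  16 / a ^+ 2 * eta <= k * fine (mu P) ->
  (mu (P `&` [set x | (b x < a / 4)%R]) <= (3 * k)%:E * mu P)%E.
Proof.
move=> QP a0 mD fD PD mF FL mb bL hF close heta.
have mP := basis_measurable hQ QP; have fP := basis_mu_lty hQ QP.
have F0 x : 0 <= F x by have /andP[] := FL x.
have b0 x : 0 <= b x by have /andP[] := bL x.
have bmF : bounded_measurable F.
  by split=> //; exists L => x; rewrite ger0_norm //; have /andP[] := FL x.
have bmb : bounded_measurable (fun x => - b x).
  split; first exact: measurable_funN.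
  by exists L => x; rewrite normrN ger0_norm //; have /andP[] := bL x.
have bd : bounded_measurable (fun x => (F x - b x) ^+ 2).
  by have bd := bounded_measurableD bmF bmb; exact: bounded_measurableM.
have bZ (c : R) z : bounded_measurable z -> bounded_measurable (fun x : T => c * z x).
  by move=> bz; apply: bounded_measurableM => //; exact: bounded_measurable_cst.
have bH := bounded_measurable_hinge a0 mF F0.
have mS : measurable [set x | b x < a / 4] by exact: measurable_below.
have bsum := bounded_measurableD (bZ 2 _ bH) (bZ (16 / a ^+ 2) _ bd).
have dP : \int[mu]_(x in P) ((F x - b x) ^+ 2) <= eta.
  apply: le_trans close; rewrite -lee_fin /Rintegral !fineK.
  - apply: ge0_subset_integral => //.
      by apply/measurable_EFinP; apply: measurable_funTS; have [] := bd.
    by move=> x _; rewrite lee_fin sqr_ge0.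
  - by apply: integrable_fin_num => //; exact: (bounded_integrable mD fD bd).
  - by apply: integrable_fin_num => //; exact: (bounded_integrable mP fP bd).
have tot : \int[mu]_(x in P) (2 * hinge a F x + 16 / a ^+ 2 * (F x - b x) ^+ 2) <= 3 * k * fine (mu P).
  rewrite (Rintegral_boundedD mP fP (bZ 2 _ bH) (bZ (16 / a ^+ 2) _ bd)) !(Rintegral_boundedZ mP fP) //.
  have h : 16 / a ^+ 2 * \int[mu]_(x in P) ((F x - b x) ^+ 2) <= 16 / a ^+ 2 * eta.
    by rewrite ler_wpM2l // divr_ge0 // sqr_ge0.
  by move: hF; rewrite /mostly_ge; lra.
rewrite (mu_fineK hQ QP) -EFinM; apply: (@le_trans _ _ (\int[mu]_(x in P) (2 * hinge a F x + 16 / a ^+ 2 * (F x - b x) ^+ 2))%R%:E); last by rewrite lee_fin.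
rewrite /Rintegral fineK; last first.
  by apply: integrable_fin_num => //; exact: (bounded_integrable mP fP bsum).
rewrite setIC -integral_indic //; apply: ge0_le_integral => //.
- by apply/measurable_EFinP; apply: measurable_funTS; exact: measurable_indic.
- by apply/measurable_EFinP; apply: measurable_funTS; have [] := bsum.
move=> x _; rewrite lee_fin; have /andP[h0 _] := hinge01 a0 (F0 x).
have q0 : 0 <= 16 / a ^+ 2 * (F x - b x) ^+ 2 by rewrite mulr_ge0 ?divr_ge0 ?sqr_ge0.
rewrite indicE; have [ba|ab] := ltP (b x) (a / 4); last first.
  rewrite memNset; last by rewrite /= ltNge ab.
  by apply: addr_ge0 => //; rewrite mulr_ge0.
rewrite mem_set //=.
have [Fa|aF] := ltP (F x) (a / 2).
  have : 1 - F x / a <= hinge a F x by rewrite le_max lexx orbT.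
  have h : F x / a < 1 / 2 by rewrite ltr_pdivrMr //; lra.
  by lra.
have : 1 <= 16 / a ^+ 2 * (F x - b x) ^+ 2.
  rewrite mulrAC ler_pdivlMr ?exprn_gt0 // mul1r.
  have h : a / 4 <= F x - b x by lra.
  by nra.
by lra.
Qed.

End finite.

(** * The maximal operator on the space *)

Section finite_sup.
Variables (R : realType) (T : Type).

Fixpoint finite_sup (t : nat -> T -> R) (n : nat) (x : T) : R :=
  if n is m.+1 then Num.max (finite_sup t m x) (t m x) else 0.

Lemma finite_sup_ge0 t n x : 0 <= finite_sup t n x.
Proof. by elim: n => //= n IH; rewrite le_max IH. Qed.

Lemma finite_sup_ge t n j x : (j < n)%N -> t j x <= finite_sup t n x.
Proof.
elim: n => // n IH; rewrite ltnS leq_eqVlt => /predU1P[->|jn] /=.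
  by rewrite le_max lexx orbT.
by rewrite le_max IH.
Qed.

Lemma finite_sup_le t n x y : 0 <= y -> (forall j, (j < n)%N -> t j x <= y) -> finite_sup t n x <= y.
Proof.
move=> y0; elim: n => //= n IH h; rewrite ge_max h // andbT IH // => j jn.
by apply: h; exact: ltnW.
Qed.

Lemma cvg_from_below (u : nat -> R) (l : R) : (forall n, u n <= l) ->
  (forall y, y < l -> exists n0, forall n, (n0 <= n)%N -> y < u n) -> u @ \oo --> l.
Proof.
move=> ul hl; apply/cvgrPdist_le => e e0.
have [n0 hn] := hl (l - e) (ltac:(by rewrite gtrBl)).
exists n0 => // n /= /hn h; have h' := ul n; rewrite ger0_norm; lra.
Qed.

End finite_sup.

Section assembly.
Variables (R : realType) (d : measure_display) (T : measurableType d).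
Variables (mu : {measure set T -> \bar R}) (Q : set (set T)).
Variables (C : set (T -> R)) (N : (T -> R) -> R).
Hypotheses (hQ : cube_basis mu Q) (hX : function_space mu C N).
Implicit Types (f g b F : T -> R) (P : set T).
Local Notation dnorm := (dual_norm mu C N).

Variables (lambda c C0 A : R).
Hypotheses (lambda01 : 0 < lambda < 1) (c_gt0 : 0 < c) (C0_gt0 : 0 < C0) (A_gt0 : 0 < A).
(* The value (1 - lambda) / 4 makes 3 k < 1 - lambda, so that by
   [mostly_ge_close] b is large on a proportion above lambda. *)
Let k := (1 - lambda) / 4.
Hypothesis majorant : forall f (L : R), C f -> N f <= 1 ->
    (forall x, 0 <= f x <= L) -> forall g, measurable_fun [set: T] g ->
    (forall x, 0 <= g x) -> (dnorm (fun x => (g x)%:E) <= 1)%E ->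
    exists F : T -> R, [/\ measurable_fun [set: T] F, (forall x, 0 <= F x),
      (\int[mu]_x (g x * F x)%:E <= C0%:E)%E &
      forall P, Q P -> (mu (P `&` [set x | (F x < c * fine (average mu f P))%R]) <= k%:E * mu P)%E].
Hypothesis median : forall b, C b -> exists w, [/\ C w,
    {ae mu, forall x, gmedian mu Q lambda b x = (w x)%:E} & N w <= A * N b].

Let k_gt0 : 0 < k. Proof. by rewrite divr_gt0 // subr_gt0; case/andP: lambda01. Qed.

Lemma average_le_bound f P (L : R) : Q P -> measurable_fun [set: T] f ->
  (forall x, `|f x| <= L) -> (average mu f P <= L%:E)%E.
Proof.
move=> QP mf fL; have mP := basis_measurable hQ QP.
rewrite /average lee_pdivrMl ?(fine_mu_gt0 hQ) // -(mu_fineK hQ QP) muleC -(integral_cst mu mP).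
apply: ge0_le_integral => //.
- by apply: measurable_abs; exact: measurable_funTS.
- by move=> x _; rewrite lee_fin.
Qed.

(** [minimax] applied to the functions that are mostly at least c <f>_(P j) on P j
    for all j < J gives b in the ball of radius C0; then w is a multiple of the
    median maximal function of b, which [median_gt] bounds from below. *)
Lemma finite_majorant (P : nat -> set T) (J : nat) f (L : R) : (forall j, Q (P j)) ->
  C f -> N f <= 1 -> (forall x, 0 <= f x <= L) ->
  exists w, [/\ C w, N w <= 8 / c * (A * C0) &
    {ae mu, forall x j, (j < J)%N -> P j x -> fine (average mu f (P j)) <= w x}].
Proof.
move=> QP Cf Nf fL; have mf := fs_measurable hX Cf.
have f0 x : 0 <= f x by have /andP[] := fL x.
have mP j := basis_measurable hQ (QP j).
have L0 : 0 <= L.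
  have PE : (0 < mu (P 0%N))%E by exact: (basis_mu_gt0 hQ).
  have [x _] : P 0%N !=set0.
    by apply/set0P/eqP => P0; move: PE; rewrite P0 measure0 ltxx.
  by have /andP[h1 h2] := fL x; exact: le_trans h1 h2.
pose av j := fine (average mu f (P j)).
have av0 j : 0 <= av j by rewrite fine_ge0 // average_ge0.
have avL j : av j <= L.
  rewrite -lee_fin /av fineK; first by apply: average_le_bound => // x; rewrite ger0_norm //; have /andP[] := fL x.
  rewrite ge0_fin_numE ?average_ge0 //; apply: le_lt_trans (ltry L).
  by apply: average_le_bound => // x; rewrite ger0_norm //; have /andP[] := fL x.
pose a j := c * av j.
have aL j : a j <= c * L by rewrite ler_pM2l.
pose D := \bigcup_(j < J) P j.
have mD : measurable D by exact: bigcup_measurable.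
have fD : (mu D < +oo)%E.
  apply: (@le_lt_trans _ _ (\sum_(0 <= j <oo) mu (if (j < J)%N then P j else set0))%E).
    apply: (@measure_sigma_subadditive _ _ _ mu D (fun j => if (j < J)%N then P j else set0)) => //.
      by move=> j; case: ifP.
    by move=> x [j /= jJ Px]; exists j => //; rewrite jJ.
  rewrite (nneseries_split _ J) // [X in (_ + X)%E]eseries0; last first.
    by move=> j Jj _; rewrite ltnNge Jj /= measure0.
  rewrite adde0 lte_sum_pinfty // => j _; case: ifP => _; last by rewrite measure0.
  exact: (basis_mu_lty hQ).
pose AA := [set F : T -> R | [/\ measurable_fun [set: T] F, (forall x, 0 <= F x) &
   forall j, (j < J)%N -> 0 < a j -> mostly_ge mu k (a j) (P j) F]].
(* The L^2 closeness needed by [mostly_ge_close], for the finitely many cubes at once. *)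
have [eta eta0 heta] : exists2 eta : R, 0 < eta & forall j, (j < J)%N -> 0 < a j ->
    16 / a j ^+ 2 * eta <= k * fine (mu (P j)).
  elim: (J) => [|J' [eta eta0 IH]]; first by exists 1.
  have [aJ|aJ] := leP (a J') 0.
    exists eta => // j; rewrite ltnS leq_eqVlt => /predU1P[->|]; last exact: IH.
    by rewrite ltNge aJ.
  have kJ : 0 < k * fine (mu (P J')) by rewrite mulr_gt0 // (fine_mu_gt0 hQ).
  pose e' := k * fine (mu (P J')) / (16 / a J' ^+ 2).
  have h16 : 0 < 16 / a J' ^+ 2 by rewrite divr_gt0 // exprn_gt0.
  have e'0 : 0 < e' by rewrite divr_gt0.
  exists (Num.min eta e'); first by rewrite lt_min eta0.
  move=> j; rewrite ltnS leq_eqVlt => /predU1P[->|jJ] aj.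
    by rewrite mulrC -ler_pdivlMr // ge_min lexx orbT.
  apply: le_trans (IH j jJ aj); rewrite ler_wpM2l //.
    by rewrite divr_ge0 // exprn_ge0 // ltW.
  by rewrite ge_min lexx.
have cL0 : 0 <= c * L by rewrite mulr_ge0 // ltW.
have [F [b [[mF F0 hF] [Cb Nb] FL bL close]]] : exists F b, [/\ AA F, C b /\ N b <= C0,
    (forall x, 0 <= F x <= c * L), (forall x, 0 <= b x <= c * L) &
    \int[mu]_(x in D) ((F x - b x) ^+ 2) <= eta].
  apply: (minimax hX mD fD cL0 C0_gt0 _ _ _ _ _ eta0).
  - by move=> F [].
  - move=> F F' t [mF F0 hF] [mF' F'0 hF'] t01; have /andP[t0 t1] := t01; split.
    + by apply: measurable_funD => //; apply: measurable_funM => //; exact: measurable_funB.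
    + by move=> x; have := F0 x; have := F'0 x => h1 h2; nra.
    + by move=> j jJ aj; apply: (mostly_ge_convex hQ (QP j)) => //; [exact: hF|exact: hF'].
  - move=> F [mF F0 hF]; split.
    + exact: (@measurable_minr _ _ _ _ F (fun=> c * L)).
    + by move=> x; rewrite le_min F0.
    + by move=> j jJ aj; apply: mostly_ge_min => //; exact: hF.
  - split=> // j jJ aj; apply: (mostly_ge_superlevel hQ) => //.
    rewrite (_ : _ `&` _ = set0) ?measure0 ?mule_ge0 ?lee_fin ?(ltW k_gt0) //.
    by rewrite -subset0 => x [_ /=]; rewrite ltNge aL.
  - move=> g mg g0 g1; have [F [mF F0 hF1 hF2]] := majorant Cf Nf fL mg g0 g1.
    exists F; split=> //; split=> // j jJ aj.
    by apply: (mostly_ge_superlevel hQ) => //; exact: hF2.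
have mb := fs_measurable hX Cb.
have [w0 [Cw0 hw0 Nw0]] := median Cb.
pose w : T -> R := (8 / c) \*: (fun x => `|w0 x|).
have h8 : 0 < 8 / c by rewrite divr_gt0.
have [Cw1 Nw1] : C (fun x => `|w0 x|) /\ N (fun x => `|w0 x|) <= N w0.
  apply: (fs_ideal hX Cw0); last by apply: aeW => x; rewrite normr_id.
  by apply: measurableT_comp => //; exact: (fs_measurable hX Cw0).
exists w; split; first exact: (fsZ hX).
  rewrite /w (fs_normZ hX) // gtr0_norm // ler_pM2l //.
  apply: (le_trans Nw1); apply: (le_trans Nw0); by rewrite ler_pM2l.
apply: filterS hw0 => x hx j jJ Px.
have [aj|aj] := ltP 0 (a j); last first.
  have av00 : av j <= 0 by move: aj; rewrite /a pmulr_rle0.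
  by apply: (le_trans av00); apply: mulr_ge0 => //; exact: ltW.
have big : (lambda%:E * mu (P j) < mu (superlevel b (a j / 8) `&` P j))%E.
  have PD : P j `<=` D by move=> y Py; exists j.
  have small := mostly_ge_close hQ (QP j) aj mD fD PD mF FL mb bL (hF j jJ aj) close (heta j jJ aj).
  have mS : measurable [set x | b x < a j / 4] by exact: measurable_below.
  have mL : measurable (superlevel b (a j / 8) `&` P j).
    by apply: measurableI => //; exact: measurable_superlevel.
  have mI : measurable (P j `&` [set x | b x < a j / 4]) by exact: measurableI.
  have cover : (mu (P j) <= mu (superlevel b (a j / 8) `&` P j) + mu (P j `&` [set x | (b x < a j / 4)%R]))%E.
    apply: le_trans (mu_leU _ mL mI); apply: mu_le => //; first exact: measurableU.
    move=> y Py; have [h|h] := ltP (b y) (a j / 4); [by right|left; split=> //].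
    rewrite /superlevel /=; apply: lt_le_trans (ler_norm _); apply: lt_le_trans h; lra.
  have {}cover := le_trans cover (leeD2l _ small).
  have P0 := fine_mu_gt0 hQ (QP j).
  have mLfin : mu (superlevel b (a j / 8) `&` P j) \is a fin_num.
    rewrite ge0_fin_numE //; apply: le_lt_trans (basis_mu_lty hQ (QP j)).
    by apply: mu_le => //; exact: subIsetr.
  move: cover; rewrite (mu_fineK hQ (QP j)) -(fineK mLfin) -!EFinM -EFinD !lee_fin lte_fin.
  rewrite /k; set m := fine (mu (P j)) in P0 *; have /andP[l0 l1] := lambda01.
  move=> h; have : 0 < (1 - lambda) * m by rewrite mulr_gt0 // subr_gt0.
  by lra.
have := median_gt hQ mb (QP j) Px big; rewrite hx lte_fin => h.
have -> : w x = 8 / c * `|w0 x| by [].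
rewrite -/(av j) mulrAC ler_pdivlMr //.
have := ler_norm (w0 x); move: h; rewrite /a; lra.
Qed.

Lemma averageZ (s : R) f P : Q P -> measurable_fun [set: T] f -> 0 <= s ->
  average mu (s \*: f) P = (s%:E * average mu f P)%E.
Proof.
move=> QP mf s0; have mP := basis_measurable hQ QP.
rewrite /average muleCA; congr (_ * _)%E.
rewrite -(@ge0_integralZl_EFin _ _ _ mu P mP (fun x => `|f x|%:E)) //; last first.
  by apply: measurable_abs; exact: measurable_funTS.
by apply: eq_integral => x _; rewrite -EFinM /= /GRing.scale /= normrM ger0_norm.
Qed.

Let K := 8 / c * (A * C0).
Let K_gt0 : 0 < K. Proof. by rewrite /K !mulr_gt0 ?invr_gt0. Qed.

(** Let G n be the supremum over the first n sets of the basis of the averages of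
    the truncation of f at n.  These increase to the maximal function, and
    [finite_majorant] bounds their norms by K.  The Fatou property first applies
    to the maximal function truncated at s; letting s grow, saturation shows that
    the maximal function is finite almost everywhere, and then the Fatou property
    applies to it. *)
Lemma maximal_bounded_ball f : C f -> N f <= 1 ->
  exists g, [/\ C g, {ae mu, forall x, gmaximal mu Q f x = (g x)%:E} & N g <= K].
Proof.
move=> Cf Nf; have mf := fs_measurable hX Cf.
have [q Qq hq] := basis_countable hQ.
pose fn (n : nat) x := Num.min `|f x| n%:R.
have mnf : measurable_fun [set: T] (fun x => `|f x|) by exact: measurableT_comp.
have mfn n : measurable_fun [set: T] (fn n).
  exact: (@measurable_minr _ _ _ _ (fun x => `|f x|) (fun=> n%:R)).
have fn0 n x : 0 <= fn n x <= n%:R.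
  by rewrite le_min normr_ge0 ler0n ge_min lexx orbT.
have fnf n x : `|fn n x| <= `|f x|.
  by rewrite ger0_norm; [rewrite ge_min lexx|have /andP[] := fn0 n x].
have fnmono n m x : (n <= m)%N -> `|fn n x| <= `|fn m x|.
  move=> nm; rewrite !ger0_norm; [|by have /andP[] := fn0 m x|by have /andP[] := fn0 n x].
  by rewrite le_min ge_min lexx /= ge_min ler_nat nm orbT.
have Cfn n : C (fn n) /\ N (fn n) <= 1.
  have [h1 h2] := fs_ideal hX Cf (mfn n) (aeW _ (fnf n)).
  by split=> //; exact: le_trans h2 Nf.
have avfin n j : average mu (fn n) (q j) \is a fin_num.
  rewrite ge0_fin_numE ?average_ge0 //; apply: le_lt_trans (ltry n%:R).
  apply: average_le_bound => // x; have /andP[h1 h2] := fn0 n x; by rewrite ger0_norm.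
pose t n j x : R := fine (average mu (fn n) (q j)) * \1_(q j) x.
pose G n := finite_sup (t n) n.
have av0 n j : 0 <= fine (average mu (fn n) (q j)) by rewrite fine_ge0 // average_ge0.
have t0 n j x : 0 <= t n j x by rewrite mulr_ge0.
have mG n : measurable_fun [set: T] (G n).
  rewrite /G; elim: {2}n => [|m IH] /=; first exact: measurable_cst.
  apply: (@measurable_maxr _ _ _ _ (finite_sup (t n) m)) => //.
  apply: measurable_funM => //; apply: measurable_indic; exact: (basis_measurable hQ).
have G0 n x : 0 <= G n x by exact: finite_sup_ge0.
have tmono n m j x : (n <= m)%N -> t n j x <= t m j x.
  move=> nm; rewrite /t ler_wpM2r // fine_le //; apply: (le_average hQ) => // y _; exact: fnmono.
have Gmono x : nondecreasing_seq (G ^~ x).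
  move=> n m nm; apply: finite_sup_le => // j jn.
  apply: (le_trans (tmono _ _ _ _ nm)); apply: finite_sup_ge; exact: leq_trans nm.
have CG n : C (G n) /\ N (G n) <= K.
  have [Cn Nn] := Cfn n.
  have [w [Cw Nw hw]] := finite_majorant n Qq Cn Nn (fn0 n).
  have [h1 h2] : C (G n) /\ N (G n) <= N w.
    apply: (fs_ideal hX Cw (mG n)); apply: filterS hw => x hx; rewrite ger0_norm //.
    apply: finite_sup_le => // j jn; rewrite /t indicE.
    case: (boolP (x \in q j)) => [/set_mem qx|_]; last by rewrite mulr0.
    by rewrite mulr1; apply: le_trans (hx j jn qx) (ler_norm _).
  by split=> //; exact: le_trans h2 Nw.
pose M := gmaximal mu Q f.
have mM : measurable_fun [set: T] M by exact: measurable_gmaximal.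
have M0 x : (0 <= M x)%E by exact: gmaximal_ge0.
have GM n x : ((G n x)%:E <= M x)%E.
  have -> : M x = ereal_sup (range (fun j => average mu f (q j) * (\1_(q j) x)%:E)%E).
    exact: (gmaximalE hQ).
  rewrite /G; elim: {2}n => [|m IH] /=.
    apply: le_trans (ereal_sup_ubound _); last by exists 0%N.
    by rewrite mule_ge0 ?average_ge0 // lee_fin.
  rewrite EFin_max ge_max IH /=; apply: le_trans (ereal_sup_ubound _); last by exists m.
  rewrite EFinM lee_wpmul2r ?lee_fin // fineK //; exact: (le_average hQ).
have MG x y : (y%:E < M x)%E -> exists n0, forall n, (n0 <= n)%N -> y < G n x.
  have -> : M x = ereal_sup (range (fun j => average mu f (q j) * (\1_(q j) x)%:E)%E).
    exact: (gmaximalE hQ).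
  move=> /ereal_sup_gt [_ [j _ <-]]; rewrite indicE.
  case: (boolP (x \in q j)) => [/set_mem qx|_]; last first.
    by rewrite mule0 lte_fin => y0; exists 0%N => n _; exact: lt_le_trans (G0 n x).
  rewrite mule1 => yav.
  have [n hn] : exists n, (y%:E < average mu (fn n) (q j))%E.
    apply: contrapT => nn; move: yav; apply/negP; rewrite -leNgt.
    have mq := basis_measurable hQ (Qq j).
    have p0 := fine_mu_gt0 hQ (Qq j).
    rewrite /average lee_pdivrMl //.
    have cv : (fun n => (\int[mu]_(x in q j) `|fn n x|%:E)%E) @ \oo -->
        (\int[mu]_(x in q j) limn (fun n => `|fn n x|%:E))%E.
      apply: (@cvg_monotone_convergence _ _ _ mu _ mq (fun n x => `|fn n x|%:E)).
      - by move=> n; exact: (measurable_abs (measurable_funTS (mfn n))).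
      - by move=> n x' _; rewrite lee_fin.
      - by move=> x' _ n m nm; rewrite lee_fin; exact: fnmono.
    rewrite [leLHS](_ : _ = \int[mu]_(x in q j) limn (fun n => `|fn n x|%:E))%E; last first.
      apply: eq_integral => z _; apply/esym/cvg_lim => //.
      apply: (@cvg_near_cst _ _ `|f z|%:E).
      exists (Num.bound `|f z|) => // n /= hn.
      have /andP[h1 _] := fn0 n z; rewrite ger0_norm // /fn min_l //.
      apply: le_trans (ltW (archi_boundP (normr_ge0 _))) _; by rewrite ler_nat.
    rewrite -(cvg_lim _ cv) //; apply: lime_le; first exact: (cvgP _ cv).
    apply: nearW => n; rewrite -lee_pdivrMl // leNgt; apply/negP => h; apply: nn.
    by exists n.
  exists (maxn n j.+1) => m; rewrite geq_max => /andP[nm jm].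
  apply: (@lt_le_trans _ _ (t m j x)); last exact: finite_sup_ge.
  rewrite /t indicE mem_set // mulr1 -lte_fin fineK //.
  apply: (lt_le_trans hn); apply: (le_average hQ) => // z _; exact: fnmono.
have bounded (u : nat -> T -> R) (l : T -> R) : (forall n, C (u n) /\ N (u n) <= K) ->
    measurable_fun [set: T] l ->
    {ae mu, forall x, (forall j, 0 <= u j x) /\ nondecreasing_seq (u ^~ x) /\ u ^~ x @ \oo --> l x} ->
    C l /\ N l <= K.
  move=> Cu ml ul; have [] := fs_fatou hX (fun n => (Cu n).1) ml ul.
    by exists K => _ [n _ <-]; have [] := Cu n.
  move=> Cl ->; split=> //; apply: ge_sup; first by exists (N (u 0%N)), 0%N.
  by move=> _ [n _ <-]; have [] := Cu n.
pose gs (s : R) x := fine (mine (M x) s%:E).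
have Cgs s : 0 < s -> C (gs s) /\ N (gs s) <= K.
  move=> s0; apply: (bounded (fun n x => Num.min (G n x) s)).
  - move=> n; have [h1 h2] := CG n.
    have [] // := fs_ideal hX h1 (g := fun x => Num.min (G n x) s).
    + exact: (@measurable_minr _ _ _ _ (G n) (fun=> s)).
    + apply: aeW => x; rewrite !ger0_norm ?le_min ?G0 ?(ltW s0) //.
      by rewrite ge_min lexx.
    by move=> h3 h4; split=> //; exact: le_trans h4 h2.
  - apply: measurableT_comp => //.
    exact: (@measurable_mine _ _ _ _ M (fun=> s%:E)).
  - apply: aeW => x; split; first by move=> j; rewrite le_min G0 (ltW s0).
    split; first by move=> n m nm; rewrite le_min ge_min Gmono //= ge_min lexx orbT.
    have gsE : (gs s x)%:E = mine (M x) s%:E.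
      rewrite /gs fineK // ge0_fin_numE ?le_min ?M0 ?lee_fin ?(ltW s0) //.
      by apply: (@le_lt_trans _ _ s%:E); [rewrite ge_min lexx orbT|exact: ltry].
    apply: cvg_from_below.
      move=> n; rewrite -lee_fin gsE le_min; apply/andP; split.
        by apply: le_trans (GM n x); rewrite lee_fin ge_min lexx.
      by rewrite lee_fin ge_min lexx orbT.
    move=> y; rewrite -lte_fin gsE lt_min => /andP[/MG [n0 hn0] ys].
    by exists n0 => n /hn0 h; rewrite lt_min h -lte_fin ys.
have Mfin : {ae mu, forall x, (M x < +oo)%E}.
  pose E := [set x | M x = +oo%E].
  have mE : measurable E by rewrite -[E]setTI; exact: (mM measurableT _ (emeasurable_set1 _)).
  exists E; split=> //; last by move=> x /= /negP; rewrite -leNgt leye_eq => /eqP.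
  apply/eqP; rewrite eq_le measure_ge0 andbT leNgt; apply/negP => E0.
  have [F [mF FE F0 CF]] := fs_saturation hX mE E0.
  have Ns s : 0 < s -> s * N (\1_F) <= K.
    move=> s0; have [h1 h2] := Cgs s s0.
    rewrite -[X in X * _](gtr0_norm s0) -(fs_normZ hX) //; apply: le_trans h2.
    have [] // := fs_ideal hX h1 (g := s \*: (\1_F : T -> R)).
    - apply: (fs_measurable hX); exact: (fsZ hX).
    - apply: aeW => x /=; rewrite indicE.
      case: (boolP (x \in F)) => [/set_mem/FE /= Mx|_]; last first.
        by rewrite [_ *: _]mulr0 normr0.
      by rewrite /gs Mx /mine ltNge leey /= [_ *: _]mulr1.
  have NF0 := fs_ge0 hX CF.
  have NF : N (\1_F) = 0.
    apply/eqP; rewrite eq_le NF0 andbT leNgt; apply/negP => NFp.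
    have := Ns ((K + 1) / N (\1_F)); rewrite divr_gt0 ?ltr_wpDr ?(ltW K_gt0) //.
    move=> /(_ isT); rewrite divfK ?gt_eqF //; lra.
  have [Z [mZ Z0 hZ]] := fs_eq0 hX CF NF.
  move: F0; rewrite ltNge => /negP; apply; rewrite -Z0; apply: mu_le => // x Fx.
  by apply: hZ => /=; rewrite indicE mem_set //; apply/eqP; rewrite oner_eq0.
pose g x := fine (M x).
have gM : {ae mu, forall x, M x = (g x)%:E}.
  by apply: filterS Mfin => x Mx; rewrite /g fineK // ge0_fin_numE.
exists g; have [Cg Ng] : C g /\ N g <= K.
  apply: (bounded G) => //; first by apply: measurableT_comp.
  apply: filterS gM => x gx; split; first by move=> j.
  split; first exact: Gmono.
  apply: cvg_from_below; first by move=> n; rewrite -lee_fin -gx.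
  by move=> y; rewrite -lte_fin -gx => /MG.
by [].
Qed.

(** By homogeneity with the scale s > N f, which is positive even if N f vanishes, and
    by letting s tend to N f. *)
Lemma maximal_bounded f : C f -> exists g, [/\ C g,
  {ae mu, forall x, gmaximal mu Q f x = (g x)%:E} & N g <= K * N f].
Proof.
move=> Cf; have Nf := fs_ge0 hX Cf; have mf := fs_measurable hX Cf.
have main s : N f < s -> exists g, [/\ C g,
    {ae mu, forall x, gmaximal mu Q f x = (g x)%:E} & N g <= K * s].
  move=> Nfs; have s0 : 0 < s by exact: le_lt_trans Nfs.
  have Cf' : C (s^-1 \*: f) by exact: (fsZ hX).
  have Nf' : N (s^-1 \*: f) <= 1.
    by rewrite (fs_normZ hX) // gtr0_norm ?invr_gt0 // mulrC ler_pdivrMr // mul1r ltW.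
  have [g [Cg Mg Ng]] := maximal_bounded_ball Cf' Nf'.
  exists (s \*: g); split; first exact: (fsZ hX).
    apply: filterS Mg => x gx.
    have fE : f = s \*: (s^-1 \*: f).
      by apply/funext => y; rewrite /= /GRing.scale /= mulrA divff ?mul1r // gt_eqF.
    have -> : gmaximal mu Q f x = (s%:E * gmaximal mu Q (s^-1 \*: f) x)%E.
      rewrite {1}fE; apply/eqP; rewrite eq_le; apply/andP; split.
        apply: gmaximal_le => P QP Px; rewrite averageZ ?(ltW s0) //; last exact: (fs_measurable hX).
        by rewrite lee_wpmul2l ?lee_fin ?(ltW s0) //; exact: average_le_max.
      rewrite -lee_pdivlMl //; apply: gmaximal_le => P QP Px.
      rewrite lee_pdivlMl // -averageZ ?(ltW s0) //; last exact: (fs_measurable hX).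
      exact: average_le_max.
    by rewrite gx -EFinM.
  by rewrite (fs_normZ hX) // gtr0_norm // mulrC ler_wpM2r // ltW.
have [g [Cg Mg Ng]] := main (N f + 1) (ltac:(by rewrite ltrDl)).
exists g; split=> //; apply/ler_addgt0Pr => e e0.
have eK : 0 < e / K by rewrite divr_gt0.
have [g' [Cg' Mg' Ng']] := main (N f + e / K) (ltac:(by rewrite ltrDl)).
have mg := fs_measurable hX Cg.
have [] : C g /\ N g <= N g'.
  apply: (fs_ideal hX Cg' mg); apply: filterS2 Mg Mg' => x -> [->] //.
move=> _ h; apply: (le_trans h); apply: (le_trans Ng').
by rewrite mulrDr [K * (e / K)]mulrC divfK // gt_eqF.
Qed.

End assembly.

(** * Euclidean space *)

Section euclidean.
Variables (R : realType) (n : nat).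
Local Notation T := (Rn R n).
Local Notation mu := (leb R n).

Definition cubes : set (set T) := [set P | exists a l, 0 < l /\ P = cube a l].

Definition coord (x : T) (i : 'I_n) : R := tnth x i.

Lemma ccube_cube (a : 'I_n -> R) l : ccube coord a l = cube ([tuple a i | i < n] : T) l.
Proof. by apply/seteqP; split=> x h i; have := h i; rewrite /coord tnth_mktuple. Qed.

Lemma ocube_hcube (a : 'I_n -> R) l : ocube coord a l = hcube ([tuple a i | i < n] : T) l.
Proof. by apply/seteqP; split=> x h i; have := h i; rewrite /coord tnth_mktuple. Qed.

Lemma cube_ccube (a : T) l : cube a l = ccube coord (coord a) l.
Proof. by []. Qed.

Lemma leb_ccube (a : 'I_n -> R) l : 0 < l -> mu (ccube coord a l) = (l ^+ n)%:E.
Proof. by move=> l0; rewrite ccube_cube; exact: leb_cube. Qed.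

Lemma leb_ocube (a : 'I_n -> R) l : 0 < l -> mu (ocube coord a l) = (l ^+ n)%:E.
Proof. by move=> l0; rewrite ocube_hcube; exact: leb_hcube. Qed.

Lemma cubes_basis : cube_basis mu cubes.
Proof.
split.
- by move=> _ [a [l [l0 ->]]]; exact: measurable_cube.
- move=> _ [a [l [l0 ->]]].
  have -> : mu (cube a l) = (l ^+ n)%:E by exact: leb_cube.
  by rewrite lte_fin exprn_gt0.
- move=> _ [a [l [l0 ->]]].
  have -> : mu (cube a l) = (l ^+ n)%:E by exact: leb_cube.
  exact: ltry.
- move=> x; exists (cube x 1); first by exists x, 1.
  by move=> i; rewrite lexx lerDl ler01.
have [q [hq hc]] := @ccube_rat_basis R n _ T mu coord leb_ccube.
exists q.
  move=> j; have [a [l [l0 ->]]] := hq j.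
  by exists [tuple a i | i < n], l; rewrite ccube_cube.
move=> _ c [a [l [l0 ->]]] c1; rewrite cube_ccube; exact: hc.
Qed.

Lemma cubes_growth (u v : R) : 0 < u < v -> v < 1 ->
  forall E G : set T, measurable E -> measurable G ->
  (forall P, cubes P -> (u%:E * mu P < mu (E `&` P))%E -> mu (P `\` G) = 0%E) ->
  forall P, cubes P -> (mu (E `&` P) <= v%:E * mu P)%E ->
  ((1 + (1 - v) / 2 ^+ n)%:E * mu (E `&` P) <= mu (G `&` P))%E.
Proof.
move=> uv v1 E G mE mG hG _ [a [l [l0 ->]]]; rewrite cube_ccube => low.
have hG' (b : 'I_n -> R) r : 0 < r ->
    (u%:E * mu (ccube coord b r) < mu (E `&` ccube coord b r))%E ->
    mu (ccube coord b r `\` G) = 0%E.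
  move=> r0; apply: hG; exists [tuple b i | i < n], r.
  by rewrite ccube_cube.
exact: (growth (@measurable_coord R n) leb_ccube leb_ocube (@leb_outer_regular R n) mE mG uv v1 hG' l0 low).
Qed.

Lemma maximalE f x : maximal f x = gmaximal mu cubes f x.
Proof.
rewrite /maximal /gmaximal.
rewrite (_ : [set P | exists a l, [/\ 0 < l, P = cube a l & P x]] = [set P | cubes P /\ P x]) //.
apply/seteqP; split=> P /=.
  by move=> [a [l [l0 PE Px]]]; split=> //; exists a, l.
by move=> [[a [l [l0 PE]]] Px]; exists a, l.
Qed.

Lemma median_maximalE lambda f x : median_maximal lambda f x = gmedian mu cubes lambda f x.
Proof.
rewrite /median_maximal /gmedian.
rewrite (_ : [set P | exists a l, [/\ 0 < l, P = cube a l & P x]] = [set P | cubes P /\ P x]) //.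
apply/seteqP; split=> P /=.
  by move=> [a [l [l0 PE Px]]]; split=> //; exists a, l.
by move=> [[a [l [l0 PE]]] Px]; exists a, l.
Qed.

Lemma function_space_of_bfs (X : fspace R n) : banach_function_space X ->
  function_space mu (carrier X) (fnorm X).
Proof. by case=> *; split. Qed.

Lemma associate_enormE (X : fspace R n) f :
  associate_enorm X f = dual_norm mu (carrier X) (fnorm X) (fun x => `|f x|%:E).
Proof.
rewrite /associate_enorm /dual_norm; congr ereal_sup.
by apply/seteqP; split=> _ [g hg <-]; exists g => //; apply: eq_integral => x _; rewrite normrM EFinM.
Qed.

End euclidean.

Lemma nroot_le_mul (R : realType) (m : nat) (B x y : R) : (0 < m)%N -> 0 < B -> 0 <= x -> 0 <= y ->
  y <= B ^+ m * x -> nroot m y <= B * nroot m x.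
Proof.
move=> m0 B0 x0 y0 yx.
rewrite -(@ler_pXn2r _ m) ?nnegrE ?nroot_ge0 //; last by rewrite mulr_ge0 ?nroot_ge0 // ltW.
by rewrite exprMn !nrootK.
Qed.

Section interface.
Variables (R : realType) (n : nat) (X : fspace R n).
Hypothesis hX : function_space (leb R n) (carrier X) (fnorm X).
Local Notation T := (Rn R n).
Local Notation mu := (leb R n).
Local Notation dnorm := (dual_norm (leb R n) (carrier X) (fnorm X)).
Implicit Types f g h u : T -> R.

Lemma carrier_associate f : carrier (associate X) f <->
  measurable_fun [set: T] f /\ (dnorm (fun x => `|f x|%:E) < +oo)%E.
Proof. by rewrite /= associate_enormE. Qed.

Lemma fnorm_associate f : fnorm (associate X) f = fine (dnorm (fun x => `|f x|%:E)).
Proof. by rewrite /= associate_enormE. Qed.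

Lemma dnorm_fineK (h : T -> \bar R) : (dnorm h < +oo)%E -> dnorm h = (fine (dnorm h))%:E.
Proof. by move=> fin; rewrite fineK // ge0_fin_numE //; exact: dual_norm_ge0. Qed.

Lemma median_bounded_associate lambda :
  bounded_on (@median_maximal R n lambda) (associate X) -> exists2 A : R, 0 < A &
  forall f, measurable_fun [set: T] f -> (dnorm (fun x => `|f x|%:E) < +oo)%E ->
    exists g, [/\ measurable_fun [set: T] g,
      {ae mu, forall x, gmedian mu (@cubes R n) lambda f x = (g x)%:E} &
      (dnorm (fun x => `|g x|%:E) <= A%:E * dnorm (fun x => `|f x|%:E))%E].
Proof.
move=> [A A0 hA]; exists A => // f mf fin.
have [g [/carrier_associate[mg gfin] hg]] := hA f (proj2 (carrier_associate f) (conj mf fin)).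
rewrite !fnorm_associate => ng; exists g; split=> //.
  by apply: filterS hg => x; rewrite median_maximalE.
by rewrite (dnorm_fineK fin) (dnorm_fineK gfin) -EFinM lee_fin.
Qed.

Variable m : nat.
Local Notation Y := (power (associate X) (m.+1%:R^-1)).

Lemma powR_nat h : (fun x => `|h x| `^ (m.+1%:R^-1)^-1) = (fun x => `|h x| ^+ m.+1) :> (T -> R).
Proof. by apply/funext => x; rewrite invrK powR_mulrn. Qed.

Lemma absX_abs h : (fun x => `|(`|h x| ^+ m.+1)%R|%:E : \bar R) = (fun x => (`|h x| ^+ m.+1)%:E).
Proof. by apply/funext => x; rewrite normrX normr_id. Qed.

Lemma carrier_power h : carrier Y h <->
  measurable_fun [set: T] h /\ (dnorm (fun x => (`|h x| ^+ m.+1)%:E) < +oo)%E.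
Proof.
rewrite [carrier Y h]/= powR_nat associate_enormE absX_abs.
split=> [[mh [_ fin]]|[mh fin]]; first exact: (conj mh fin).
split; [exact: mh|split; [|exact: fin]].
by apply: measurable_funX; exact: measurableT_comp.
Qed.

Lemma fnorm_power h : fnorm Y h = nroot m.+1 (fine (dnorm (fun x => (`|h x| ^+ m.+1)%:E))).
Proof. by rewrite /= powR_nat associate_enormE absX_abs. Qed.

Lemma power_ballP h : (carrier Y h /\ fnorm Y h <= 1) <->
  (measurable_fun [set: T] h /\ (dnorm (fun x => (`|h x| ^+ m.+1)%:E) <= 1)%E).
Proof.
rewrite fnorm_power carrier_power.
have d0 : 0 <= fine (dnorm (fun x => (`|h x| ^+ m.+1)%:E)).
  by apply: fine_ge0; exact: dual_norm_ge0.
split=> [[[mh fin] h1]|[mh h1]].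
  split=> //; rewrite (dnorm_fineK fin) lee_fin -(nrootK (ltn0Sn m) d0).
  by rewrite -(expr1n _ m.+1); apply: lerXn2r; rewrite ?nnegrE ?nroot_ge0.
have fin := le_lt_trans h1 (ltry 1).
split=> //; move: h1; rewrite (dnorm_fineK fin) lee_fin => h1.
by rewrite -(@ler_pXn2r _ m.+1) ?nnegrE ?nroot_ge0 // expr1n nrootK.
Qed.

(** The unit ball of the convexified associate space, with its norm on
    representatives, is the set over which [pow_dual_norm] is a supremum. *)
Lemma associate_power_enorm u : associate_enorm Y u =
  pow_dual_norm mu (carrier X) (fnorm X) m.+1 u.
Proof.
have ballE : [set h | carrier Y h /\ fnorm Y h <= 1] =
    [set h : T -> R | measurable_fun [set: T] h /\ (dnorm (fun x => (`|h x| ^+ m.+1)%:E) <= 1)%E].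
  by apply/seteqP; split=> h /power_ballP.
exact: (congr1 (fun S : set (T -> R) =>
  ereal_sup [set (\int[mu]_x `|u x * h x|%:E)%E | h in S]) ballE).
Qed.

Lemma maximal_bounded_power (B : R) : 0 < B ->
  (forall f, measurable_fun [set: T] f -> (dnorm (fun x => (`|f x| ^+ m.+1)%:E) < +oo)%E ->
    exists g, [/\ measurable_fun [set: T] g,
      {ae mu, forall x, gmaximal mu (@cubes R n) f x = (g x)%:E} &
      (dnorm (fun x => (`|g x| ^+ m.+1)%:E) <=
        (B ^+ m.+1)%:E * dnorm (fun x => (`|f x| ^+ m.+1)%:E))%E]) ->
  bounded_on (@maximal R n) Y.
Proof.
move=> B0 hB; exists B => // f /carrier_power [mf fin].
have [g [mg gM gD]] := hB f mf fin.
have gfin : (dnorm (fun x => (`|g x| ^+ m.+1)%:E) < +oo)%E.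
  by apply: (le_lt_trans gD); rewrite (dnorm_fineK fin) -EFinM ltry.
exists g; split; first exact/carrier_power.
  by apply: filterS gM => x; rewrite maximalE.
rewrite !fnorm_power; apply: (nroot_le_mul (ltn0Sn m) B0).
- by apply: fine_ge0; exact: dual_norm_ge0.
- by apply: fine_ge0; exact: dual_norm_ge0.
by move: gD; rewrite (dnorm_fineK fin) (dnorm_fineK gfin) -EFinM lee_fin.
Qed.

Lemma pdnorm_fineK w : (pow_dual_norm mu (carrier X) (fnorm X) m.+1 w < +oo)%E ->
  pow_dual_norm mu (carrier X) (fnorm X) m.+1 w =
  (fine (pow_dual_norm mu (carrier X) (fnorm X) m.+1 w))%:E.
Proof.
move=> fin; rewrite fineK // ge0_fin_numE //.
exact: pow_dual_norm_ge0.
Qed.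

Lemma maximal_bounded_associate_power :
  bounded_on (@maximal R n) (associate Y) -> exists2 B : R, 0 < B &
  forall u, measurable_fun [set: T] u ->
    (pow_dual_norm mu (carrier X) (fnorm X) m.+1 u < +oo)%E ->
    exists W, [/\ measurable_fun [set: T] W,
      {ae mu, forall x, gmaximal mu (@cubes R n) u x = (W x)%:E} &
      (pow_dual_norm mu (carrier X) (fnorm X) m.+1 W <=
       B%:E * pow_dual_norm mu (carrier X) (fnorm X) m.+1 u)%E].
Proof.
move=> [B B0 hB]; exists B => // u mu_ ufin.
have [W [[mW Wfin] WM WN]] := hB u (conj mu_ (eq_ind_r (fun e => (e < +oo)%E) ufin (associate_power_enorm u))).
exists W; split.
- exact: mW.
- by apply: filterS WM => x; rewrite maximalE.
move: WN Wfin; rewrite [fnorm _ W]/= [fnorm _ u]/=.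
rewrite !associate_power_enorm => WN Wfin.
rewrite (pdnorm_fineK Wfin) (pdnorm_fineK ufin) -EFinM lee_fin; exact: WN.
Qed.

End interface.

Theorem theorem1p3 (R : realType) (n : nat) (n_gt0 : (0 < n)%N)
  (X : fspace R n) (bfsX : banach_function_space X)
  (hM : exists2 p0 : R, 1 < p0 & forall p : R, p0 <= p ->
     bounded_on (@maximal R n) (power (associate X) p^-1) ->
     bounded_on (@maximal R n) (associate (power (associate X) p^-1)))
  (hm : exists2 lambda : R, 0 < lambda < 1 &
     bounded_on (median_maximal lambda) X /\
     bounded_on (median_maximal lambda) (associate X)) :
  bounded_on (@maximal R n) X.
Proof.
have hX := function_space_of_bfs bfsX.
have hQ := @cubes_basis R n.
have [p0 p0_gt1 {}hM] := hM.
have [lambda lambda01 [[A A0 hA] hA']] := hm.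
have /andP[l0 l1] := lambda01.
(* Any density strictly between lambda and 1 serves as threshold in the growth of level sets. *)
pose v := (1 + lambda) / 2.
have uv : 0 < lambda < v by rewrite l0 /v; lra.
have v1 : v < 1 by rewrite /v; lra.
pose theta := 1 + (1 - v) / 2 ^+ n.
have theta1 : 1 < theta by rewrite ltrDl divr_gt0 ?exprn_gt0 // subr_gt0.
have [A' A'0 hmed] := median_bounded_associate hX hA'.
have [m0 step1] := maximal_of_median hQ hX uv v1 theta1 (cubes_growth uv v1) A'0 hmed.
pose m := maxn m0 (Num.bound p0).
have m0m : (m0 <= m.+1)%N by rewrite (leq_trans (leq_maxl _ _) (leqnSn _)).
have [B B0 hB] := step1 m.+1 m0m (ltn0Sn m).
have p0m : p0 <= m.+1%:R.
  apply: le_trans (ltW (archi_boundP (le_trans ler01 (ltW p0_gt1)))) _.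
  by rewrite ler_nat (leq_trans (leq_maxr _ _) (leqnSn _)).
have hMY := maximal_bounded_power hX B0 hB.
have [B' B'0 hB'] := maximal_bounded_associate_power hX (hM _ p0m hMY).
have k0 : 0 < (1 - lambda) / 4 by rewrite divr_gt0 // subr_gt0.
have [c [C0 [c0 C00 major]]] := good_majorant hQ hX B0 B'0 k0 hB hB'.
have medX b : carrier X b -> exists w, [/\ carrier X w,
    {ae leb R n, forall x, gmedian (leb R n) (@cubes R n) lambda b x = (w x)%:E} &
    fnorm X w <= A * fnorm X b].
  move=> Cb; have [w [Cw wM wN]] := hA b Cb; exists w; split=> //.
  by apply: filterS wM => x; rewrite median_maximalE.
exists (8 / c * (A * C0)); first by rewrite !mulr_gt0 // invr_gt0.
move=> f Cf; have [g [Cg gM gN]] := maximal_bounded hQ hX lambda01 c0 C00 A0 major medX Cf.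
exists g; split=> //; apply: filterS gM => x; by rewrite maximalE.
Qed.
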